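(* Fix an integer $d \geq 2$. Let $\mathbf{X}^{(1)}, \mathbf{X}^{(2)}, \ldots$ be i.i.d. random $d$-dimensional vectors having independent Exponential$(1)$ coordinates. For $b > 0$ let $$\rho_n(b) := \#\{\text{maxima } \mathbf{r} \text{ of } \{\mathbf{X}^{(1)},\ldots,\mathbf{X}^{(n)}\} \text{ with } \|\mathbf{r}\| \le b\},$$ and for $a\in\mathbb{R}$ let $$b_n \equiv b_n(a) := \mathrm{L} n - \mathrm{L}_3 n - \mathrm{L}(d-1) - \mathrm{L}\Bigl(1 - \frac{a}{\mathrm{L}_2 n}\Bigr), \qquad \lambda \equiv \lambda(a) := \frac{e^{(d-1)a}}{(d-1)!}, \qquad a_n := \frac{1}{2(d-1)}(\mathrm{L}_3 n - 2\,\mathrm{L}_4 n).$$ Then as $n \to \infty$ we have $$\mathrm{d_{TV}}\bigl(\rho_n(b_n), \mathrm{Po}(\lambda)\bigr) = O\Bigl((\mathrm{L}_2 n)^{-\left(d - \frac32\right)} (\mathrm{L}_3 n)^{-1}\Bigr) \quad \text{uniformly for } |a| \le a_n.$$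
   Context: $\mathrm{L} = \mathrm{L}_1$ denotes the natural logarithm and $\mathrm{L}_k$ its $k$-th iterate (e.g. $\mathrm{L}_2 n = \ln\ln n$). For $\mathbf{x},\mathbf{y}\in\mathbb{R}^d$, $\mathbf{x} \prec \mathbf{y}$ means $x_j < y_j$ for every $j \in \{1,\ldots,d\}$. A maximum of $\{\mathbf{X}^{(1)},\ldots,\mathbf{X}^{(n)}\}$ is an observation $\mathbf{X}^{(k)}$ ($1\le k\le n$) such that $\mathbf{X}^{(k)} \not\prec \mathbf{X}^{(i)}$ for all $1 \le i \le n$. The $\ell^1$-norm is $\|\mathbf{x}\| = \sum_{j=1}^d |x_j|$. $\mathrm{Po}(\lambda)$ denotes the Poisson distribution with mean $\lambda$ (or a random variable with that distribution). The total variation distance between the laws of integer-valued random variables is $\mathrm{d_{TV}}(W_1,W_2) := \sup_{A\subseteq\mathbb{Z}}|\mathbb{P}(W_1\in A) - \mathbb{P}(W_2\in A)|$. ''$f_n(a) = O(g_n)$ uniformly for $|a|\le a_n$'' means there are constants $C$ and $n_0$ (depending only on $d$) with $|f_n(a)| \le C g_n$ for all $n\ge n_0$ and all $a$ with $|a|\le a_n$. *)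

(* Defs.v *)
From HB Require Import structures.
From mathcomp Require Import all_boot all_order all_algebra.
From mathcomp Require Import finmap.
From mathcomp Require Import all_classical all_reals all_analysis.

Set Implicit Arguments.
Unset Strict Implicit.
Unset Printing Implicit Defensive.

Import Order.TTheory GRing.Theory Num.Theory.
Import numFieldNormedType.Exports.

Local Open Scope classical_set_scope.
Local Open Scope ring_scope.

Definition mutually_independent (R : realType) (I : choiceType)
    (disp disp' : measure_display)
    (T : measurableType disp) (T' : measurableType disp')
    (P : probability T R) (Y : I -> T -> T') : Prop :=
  forall (J : {fset I}) (B : I -> set T'),
    (forall i, i \in J -> measurable (B i)) ->
    (P (\bigcap_(i in [set` J]) (Y i @^-1` B i)) =
     \prod_(i <- J) P (Y i @^-1` B i))%E.

Definition identically_distributed (R : realType) (I : Type)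
    (disp disp' : measure_display)
    (T : measurableType disp) (T' : measurableType disp')
    (P : probability T R) (Y : I -> {RV P >-> T'}) : Prop :=
  forall (i j : I) (B : set T'), measurable B ->
    distribution P (Y i) B = distribution P (Y j) B.

(* X i stands for the (i+1)-st vector; [d.-tuple R] carries the product
   sigma-algebra, i.e. the Borel sets of R^d. *)
Record iid_exp1_vectors (R : realType) (d : nat) (disp : measure_display)
    (T : measurableType disp) (P : probability T R)
    (X : nat -> {RV P >-> d.-tuple R}) : Prop := IidExp1Vectors {
  vectors_independent :
    mutually_independent P (fun i (w : T) => (X i w : d.-tuple R));
  vectors_identically_distributed : identically_distributed X;
  coordinates_independent : forall i : nat,
    mutually_independent P (fun (j : 'I_d) (w : T) => tnth (X i w) j : R);
  coordinates_exp1 : forall (i : nat) (j : 'I_d) (B : set R), measurable B ->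
    P ((fun w : T => tnth (X i w) j) @^-1` B) = exponential_prob 1 B }.

Definition prec (R : realType) (d : nat) (x y : d.-tuple R) : bool :=
  [forall j : 'I_d, tnth x j < tnth y j].

Definition l1norm (R : realType) (d : nat) (x : d.-tuple R) : R :=
  \sum_(j < d) `|tnth x j|.

Definition is_maximum (R : realType) (d n : nat) (x : 'I_n -> d.-tuple R)
    (k : 'I_n) : bool :=
  [forall i : 'I_n, ~~ prec (x k) (x i)].

(* Maxima are observations, so they are counted by their index. *)
Definition rho (R : realType) (d n : nat) (b : R) (x : nat -> d.-tuple R) : nat :=
  #|[pred k : 'I_n | is_maximum (fun i : 'I_n => x i) k && (l1norm (x k) <= b)]|.

Definition iterln (R : realType) (k : nat) (x : R) : R := iter k (@ln R) x.

Definition b_ (R : realType) (d n : nat) (a : R) : R :=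
  iterln 1 n%:R - iterln 3 n%:R - ln (d%:R - 1) - ln (1 - a / iterln 2 n%:R).

Definition lambda_ (R : realType) (d : nat) (a : R) : R :=
  expR ((d%:R - 1) * a) / (d - 1)`!%:R.

Definition a_ (R : realType) (d n : nat) : R :=
  1 / (2 * (d%:R - 1)) * (iterln 3 n%:R - 2 * iterln 4 n%:R).

Definition law (R : realType) (disp : measure_display)
    (T : measurableType disp) (P : probability T R) (W : T -> int)
    : set int -> \bar R :=
  fun A => P (W @^-1` A).

Definition dTV (R : realType) (mu nu : set int -> \bar R) : \bar R :=
  ereal_sup [set `|mu A - nu A|%E | A in [set: set int]].

(* The second argument of [poisson_prob] is a dummy. *)
Definition poisson (R : realType) (lambda : R) : probability nat R :=
  poisson_prob lambda 0%N.

(* Main.v *)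
Require Import Defs.
From HB Require Import structures.
From mathcomp Require Import all_boot all_order all_algebra.
From mathcomp Require Import finmap.
From mathcomp Require Import all_classical all_reals all_analysis.
From mathcomp Require Import measurable_realfun.
From mathcomp Require Import ring lra.

(** Write k = d - 1, |x| for the l1-norm, and [low b] for the region |x| <= b.  A
vector x with nonnegative coordinates is dominated by a fresh one with
probability A = exp(-|x|), so it survives n fresh ones with probability about
exp(-n A).  At the level b = b_n(a) the number M = n exp(-b) equals
k (ln ln n - a), hence exp(-M) is a negative power of ln n: low maxima are rare,
and as exp(-n A) drops doubly exponentially when |x| decreases, almost all of
them lie in the [band] b - 1 <= |x| <= b.  Their expected number is about
b^k / k! * exp(-M), which is about lambda.

The difficulty is dependence: an observation is both a candidate and a possible
dominator of the others.  It is removed by a coupling.  Take two independent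
samples x and x', and replace x_i by x'_i whenever both are low.  The result is
again an i.i.d. sample ([merge_tuple_law]), yet essentially its low points come
from x' and its high points from x.  A low point near the edge is dominated
almost only by high points, so the number of low maxima of the merged sample is,
up to rare events, the number of points of x' in the band that no point of x
dominates ([coupling_bound]).  Given x, that number is exactly binomial with
parameters n and q(x) = [free_mass] ([count_undom_law]).

It remains to compare a mixed binomial law with a Poisson law.  A second order
expansion in the success probability shows that replacing the random q by its
mean costs at most 2 n^2 Var(q), as the first order term averages out
([mixed_binomial_le]); replacing the mean by lambda / n costs
|n E q - lambda|; and the binomial law is compared with the Poisson law by
[le_cam].  The variance is small because two points x, y of the band are avoided
almost independently unless they are close: a fresh point dominates both with
probability at most exp(-(r / 2)) times the larger of the two domination
probabilities, r being the l1-distance of x and y ([pair_excess_le]), and the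
close pairs carry little mass ([integral_l1dist]).

All the errors are at most a constant times lambda (ln ln n)^(-k), apart from a
power of 1 / n; since |a| <= a_n makes M of order ln ln n and
lambda at most (ln ln n)^(1/2) / ln ln ln n, this is the stated rate
([approximation_error_le]).  Only upper bounds on probabilities are proved, for
every event; applied to the complement they give the lower bounds ([two_sided]). *)

Set Implicit Arguments.
Unset Strict Implicit.
Unset Printing Implicit Defensive.

Import Order.TTheory GRing.Theory Num.Theory.
Import numFieldNormedType.Exports.

Local Open Scope classical_set_scope.
Local Open Scope ring_scope.

(** * Laws of i.i.d. samples *)

Section iid_sample.
Context {disp : measure_display} {T : measurableType disp} {R : realType}.
Variable m : probability T R.

Definition cons_tuple n (p : T * n.-tuple T) : n.+1.-tuple T :=
  [tuple of p.1 :: p.2].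

Lemma measurable_cons_tuple n : measurable_fun setT (@cons_tuple n).
Proof. exact: (@measurable_cons _ _ _ _ fst n snd). Qed.

HB.instance Definition _ n :=
  isMeasurableFun.Build _ _ _ _ (@cons_tuple n) (@measurable_cons_tuple n).

Fixpoint iid n : probability (n.-tuple T) R :=
  match n with
  | 0 => \d_([tuple] : 0.-tuple T)
  | n'.+1 => distribution (m \x iid n')%E (@cons_tuple n')
  end.

Lemma integral_iid0 (f : 0.-tuple T -> \bar R) : measurable_fun [set: _.-tuple T] f ->
  (\int[iid 0]_t f t = f [tuple])%E.
Proof. by move=> mf; rewrite /= integral_dirac ?diracT ?mul1e. Qed.

Lemma integral_iidS n (f : n.+1.-tuple T -> \bar R) :
  measurable_fun [set: _.-tuple T] f -> (forall t, 0 <= f t)%E ->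
  (\int[iid n.+1]_t f t =
   \int[m]_x \int[iid n]_t f [tuple of x :: t])%E.
Proof.
move=> mf f0.
rewrite [LHS]ge0_integral_pushforward//.
rewrite fubini_tonelli1//; last by move=> p; exact: f0.
by apply: measurableT_comp => //; exact: measurable_cons_tuple.
Qed.

Lemma measurable_prod_tnth n (g : 'I_n -> T -> R) :
  (forall i, measurable_fun setT (g i)) ->
  measurable_fun [set: n.-tuple T] (fun t : n.-tuple T => \prod_(i < n) g i (tnth t i)).
Proof.
move=> mg; apply: measurable_prod => i _.
by apply: measurableT_comp => //; exact: measurable_tnth.
Qed.

Lemma integral_iid_prod n (g : 'I_n -> T -> R) :
  (forall i, measurable_fun setT (g i)) -> (forall i x, 0 <= g i x) ->
  (\int[iid n]_t (\prod_(i < n) g i (tnth t i))%:E =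
   \prod_(i < n) \int[m]_x (g i x)%:E)%E.
Proof.
elim: n g => [|n IH] g mg g0.
  rewrite integral_iid0; first by rewrite !big_ord0.
  by apply/measurable_EFinP; exact: measurable_prod_tnth.
rewrite integral_iidS; last 2 first.
- by apply/measurable_EFinP; exact: measurable_prod_tnth.
- by move=> t; rewrite lee_fin prodr_ge0.
under eq_integral => x _.
  under eq_integral => t _.
    rewrite big_ord_recl tnth0 EFinM.
    under eq_bigr do rewrite tnthS.
    over.
  rewrite ge0_integralZl//=; last 3 first.
  - apply/measurable_EFinP.
    exact: (@measurable_prod_tnth n (fun i => g (lift ord0 i))).
  - by move=> t _; rewrite lee_fin prodr_ge0.
  - by rewrite lee_fin.
  rewrite (IH (fun i => g (lift ord0 i)))//.
  over.
rewrite big_ord_recl ge0_integralZr//.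
- exact/measurable_EFinP.
- by move=> x _; rewrite lee_fin.
- by apply: prode_ge0 => i _; apply: integral_ge0 => x _; rewrite lee_fin.
Qed.

(** The boxes are stable under intersection and generate the product
sigma-algebra, so a finite measure on tuples is determined by its values on
them. *)
Definition box n (B : 'I_n -> set T) : set (n.-tuple T) :=
  [set t | forall i, B i (tnth t i)].

Lemma measurable_box n (B : 'I_n -> set T) :
  (forall i, measurable (B i)) -> measurable (box B).
Proof.
move=> mB; rewrite (_ : box B = \big[setI/setT]_(i < n) (@tnth n T ^~ i @^-1` B i)).
  apply: bigsetI_measurable => i _.
  by rewrite -[X in measurable X]setTI; exact: measurable_tnth.
rewrite -bigcap_seq; apply/seteqP; split => t Bt i; first by move=> _; exact: Bt.
by apply: Bt; rewrite /= mem_index_enum.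
Qed.

Lemma boxI n (B C : 'I_n -> set T) : box B `&` box C = box (fun i => B i `&` C i).
Proof.
apply/seteqP; split => [t [Bt Ct] i|t BCt]; first by split.
by split => i; have [] := BCt i.
Qed.

Lemma measurable_tuple_boxes n :
  (measurable : set (set (n.-tuple T))) =
  <<s [set box B | B in [set B : 'I_n -> set T | forall i, measurable (B i)]] >>.
Proof.
apply/seteqP; split; last first.
  apply: smallest_sub; first exact: sigma_algebra_measurable.
  by move=> _ [B mB <-]; exact: measurable_box.
apply: smallest_sub; first exact: smallest_sigma_algebra.
move=> A /=; rewrite -bigcup_seq => -[i _] [C mC <-]; apply: sub_sigma_algebra.
exists (fun j => if j == i then C else setT).
  by move=> j /=; case: ifP.
apply/seteqP; split => [t Ct|t [_ Ct] j]; last by case: ifPn => // /eqP ->.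
by split => //; have := Ct i; rewrite eqxx.
Qed.

Lemma boxes_unique n (m1 m2 : {measure set (n.-tuple T) -> \bar R}) :
  (m1 setT < +oo)%E ->
  (forall B : 'I_n -> set T, (forall i, measurable (B i)) ->
     m1 (box B) = m2 (box B)) ->
  forall A, measurable A -> m1 A = m2 A.
Proof.
move=> m1oo m12 A mA.
have boxT : box (fun _ : 'I_n => setT) = setT by apply/seteqP; split.
apply: (measure_unique
  [set box B | B in [set B : 'I_n -> set T | forall i, measurable (B i)]]
  (fun=> setT)) => //.
- exact: measurable_tuple_boxes.
- move=> _ _ [B mB <-] [C mC <-]; exists (fun i => B i `&` C i).
    by move=> i; exact: measurableI.
  by rewrite boxI.
- by move=> _; exists (fun=> setT).
- by apply/seteqP; split => // t _; exists 0%N.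
- by move=> _ [B mB <-]; exact: m12.
Qed.

Lemma indic_box n (B : 'I_n -> set T) t :
  \1_(box B) t = \prod_(i < n) \1_(B i) (tnth t i) :> R.
Proof.
rewrite indicE; case: (boolP (t \in box B)) => [|tB].
  rewrite inE => Bt; rewrite big1// => i _.
  by rewrite indicE mem_set//; exact: Bt.
have [i nBi] : exists i, ~ B i (tnth t i).
  by apply/existsNP; rewrite notin_setE in tB.
by rewrite (bigD1 i)//= indicE memNset// mul0r.
Qed.

Lemma iid_box n (B : 'I_n -> set T) : (forall i, measurable (B i)) ->
  iid n (box B) = (\prod_(i < n) m (B i))%E.
Proof.
move=> mB; rewrite -(setIT (box B)) -integral_indic//; last exact: measurable_box.
under eq_integral do rewrite indic_box.
rewrite (@integral_iid_prod n (fun i => \1_(B i)))//.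
by apply: eq_bigr => i _; rewrite integral_indic// setIT.
Qed.

Lemma iid_unique n (m1 : {measure set (n.-tuple T) -> \bar R}) :
  (forall B : 'I_n -> set T, (forall i, measurable (B i)) ->
     m1 (box B) = (\prod_(i < n) m (B i))%E) ->
  forall A, measurable A -> m1 A = iid n A.
Proof.
move=> m1B; apply: boxes_unique => [|B mB]; last first.
  by rewrite m1B//; exact/esym/iid_box.
have -> : setT = box (fun _ : 'I_n => setT) by apply/seteqP; split.
by rewrite m1B// big1 ?ltry// => i _; exact: probability_setT.
Qed.

(** [set_tuple i] overwrites coordinate i.  Overwriting it by a fresh point
preserves the law of the sample, which is how one coordinate is singled out and
integrated on its own. *)
Definition set_tuple n (i : 'I_n) (p : T * n.-tuple T) : n.-tuple T :=
  [tuple if j == i then p.1 else tnth p.2 j | j < n].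

Lemma measurable_set_tuple n (i : 'I_n) : measurable_fun setT (set_tuple i).
Proof.
apply/measurable_fun_tnthP => j.
rewrite (_ : _ \o _ = fun p => if j == i then p.1 else tnth p.2 j); last first.
  by apply/funext => p; rewrite /= tnth_mktuple.
case: (j == i); first exact: measurable_fst.
apply: (@measurableT_comp _ _ _ _ _ _ (@tnth n T ^~ j) _ snd) => //.
exact: measurable_tnth.
Qed.

HB.instance Definition _ n i :=
  isMeasurableFun.Build _ _ _ _ (@set_tuple n i) (@measurable_set_tuple n i).

Lemma iid_resample n (i : 'I_n) A : measurable A ->
  iid n A = distribution (m \x iid n)%E (set_tuple i) A.
Proof.
move=> mA; apply/esym/iid_unique => // B mB.
transitivity ((m \x iid n)%E
    (B i `*` box (fun j => if j == i then setT else B j))).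
  congr ((m \x iid n)%E _); apply/seteqP; split => -[x t] /=.
    move=> Bt; split; first by have := Bt i; rewrite tnth_mktuple eqxx.
    by move=> j; case: ifPn => // ji; have := Bt j; rewrite tnth_mktuple (negbTE ji).
  by move=> [/= Bx Bt] j; rewrite tnth_mktuple; case: ifPn => [/eqP ->//|ji];
    have := Bt j; rewrite (negbTE ji).
transitivity (m (B i) * iid n (box (fun j => if j == i then setT else B j)))%E.
  by apply: product_measure1E => //; apply: measurable_box => j; case: ifP.
rewrite iid_box; last by move=> j; case: ifP.
rewrite [in RHS](bigD1 i)//=; congr (_ * _)%E.
rewrite (bigD1 i)//= eqxx probability_setT mul1e.
by apply: eq_bigr => j /negbTE ->.
Qed.

Lemma integral_iid_resample n (i : 'I_n) (f : n.-tuple T -> \bar R) :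
  measurable_fun setT f -> (forall t, 0 <= f t)%E ->
  (\int[iid n]_t f t = \int[m]_x \int[iid n]_t f (set_tuple i (x, t)))%E.
Proof.
move=> mf f0.
rewrite (eq_measure_integral (distribution (m \x iid n)%E (set_tuple i)));
  last by move=> A mA _; exact: iid_resample.
rewrite ge0_integral_pushforward//.
rewrite fubini_tonelli1//; last by move=> p; exact: f0.
by apply: measurableT_comp => //; exact: measurable_set_tuple.
Qed.

Lemma integral_iid_tnth n (i : 'I_n) (f : T -> \bar R) :
  measurable_fun setT f -> (forall t, 0 <= f t)%E ->
  (\int[iid n]_t f (tnth t i) = \int[m]_x f x)%E.
Proof.
move=> mf f0; rewrite (integral_iid_resample i)//; last first.
  by apply: measurableT_comp => //; exact: measurable_tnth.
apply: eq_integral => x _; transitivity (\int[iid n]_t (cst (f x) t))%E.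
  by apply: eq_integral => t _; rewrite tnth_mktuple eqxx.
by rewrite integral_cst// [X in (_ * X)%E]probability_setT mule1.
Qed.
End iid_sample.

(** * Binomial expectations and the Poisson law *)

Section binomial_expectation.
Context {R : realType}.
Implicit Types (f g : nat -> R) (p q c : R).

(** The expectation of f at a binomial variable with parameters n and p, by
conditioning on the first trial: this form is the one on which all the
comparisons below go by induction, for an arbitrary f. *)
Fixpoint bern n f p : R :=
  if n is n'.+1 then (1 - p) * bern n' f p + p * bern n' (f \o succn) p
  else f 0%N.

(** The derivative of [bern n f] with respect to the success probability. *)
Fixpoint dbern n f p : R :=
  if n is n'.+1 then (1 - p) * dbern n' f p + p * dbern n' (f \o succn) p
                     + (bern n' (f \o succn) p - bern n' f p)
  else 0.

Lemma bernB n f g p :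
  bern n (fun k => f k - g k) p = bern n f p - bern n g p.
Proof.
elim: n f g => //= n IH f g.
by rewrite IH (IH (f \o succn) (g \o succn)); ring.
Qed.

Lemma bern_ge0 n f p : 0 <= p <= 1 -> (forall k, 0 <= f k) -> 0 <= bern n f p.
Proof.
move=> /andP[p0 p1]; elim: n f => //= n IH f f0.
by rewrite addr_ge0// mulr_ge0 ?subr_ge0// IH// => k; exact: f0.
Qed.

Lemma bern_norm n f p c : 0 <= p <= 1 -> (forall k, `|f k| <= c) ->
  `|bern n f p| <= c.
Proof.
move=> /andP[p0 p1]; elim: n f => //= n IH f fc.
have h1 := IH f fc; have h2 := IH (f \o succn) (fun k => fc k.+1).
have p10 : 0 <= 1 - p by rewrite subr_ge0.
rewrite (le_trans (ler_normD _ _))// !normrM (ger0_norm p0) (ger0_norm p10).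
by have := ler_wpM2l p10 h1; have := ler_wpM2l p0 h2; lra.
Qed.

(** Changing the success probability of one of the n trials from p to q changes
the expectation by at most c |q - p|. *)
Lemma bern_lipschitz n f p q c : 0 <= p <= 1 -> 0 <= q <= 1 ->
  (forall k, `|f k.+1 - f k| <= c) ->
  `|bern n f q - bern n f p| <= n%:R * c * `|q - p|.
Proof.
move=> p01 q01; elim: n f => [|n IH] f fc.
  by rewrite subrr normr0 !mul0r.
have [p0 p1] := andP p01.
have E : bern n.+1 f q - bern n.+1 f p =
    ((1 - p) * (bern n f q - bern n f p)
     + p * (bern n (f \o succn) q - bern n (f \o succn) p))
    + (q - p) * bern n (fun k => (f \o succn) k - f k) q.
  by rewrite bernB /=; ring.
have h1 := IH f fc; have h2 := IH (f \o succn) (fun k => fc k.+1).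
have h3 := bern_norm n q01 fc.
have -> : n.+1%:R * c * `|q - p| = n%:R * c * `|q - p| + c * `|q - p|.
  by rewrite -natr1; ring.
rewrite E (le_trans (ler_normD _ _))// lerD//.
  rewrite (le_trans (ler_normD _ _))// !normrM.
  have p10 : 0 <= 1 - p by rewrite subr_ge0.
  rewrite (ger0_norm p0) (ger0_norm p10).
  have := ler_wpM2l p10 h1; have := ler_wpM2l p0 h2; lra.
by rewrite normrM mulrC ler_wpM2r.
Qed.

(** Differentiating in the success probability is taking n differences of f, so
the remainder of the first order expansion involves the second differences of f
and at most n^2 pairs of trials. *)
Lemma bern_taylor n f p q c : 0 <= p <= 1 -> 0 <= q <= 1 ->
  (forall k, `|f k.+2 - f k.+1 - (f k.+1 - f k)| <= c) ->
  `|bern n f q - bern n f p - (q - p) * dbern n f p|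
    <= n%:R ^+ 2 * c * (q - p) ^+ 2.
Proof.
move=> p01 q01; elim: n f => [|n IH] f fc.
  by rewrite /= subrr mulr0 subrr normr0 expr0n/= !mul0r.
have [p0 p1] := andP p01.
have p10 : 0 <= 1 - p by rewrite subr_ge0.
have c0 : 0 <= c by rewrite (le_trans _ (fc 0%N)).
pose D k := (f \o succn) k - f k.
have E : bern n.+1 f q - bern n.+1 f p - (q - p) * dbern n.+1 f p =
    ((1 - p) * (bern n f q - bern n f p - (q - p) * dbern n f p)
     + p * (bern n (f \o succn) q - bern n (f \o succn) p
            - (q - p) * dbern n (f \o succn) p))
    + (q - p) * (bern n D q - bern n D p).
  by rewrite /D !bernB /=; ring.
have h1 := IH f fc; have h2 := IH (f \o succn) (fun k => fc k.+1).
have h3 := @bern_lipschitz n D p q c p01 q01 fc.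
have h4 : `|(q - p) * (bern n D q - bern n D p)| <= n%:R * c * (q - p) ^+ 2.
  rewrite normrM -real_normK ?num_real// expr2 [leRHS]mulrCA.
  by rewrite ler_wpM2l// mulrC [leRHS]mulrC mulrC.
rewrite E (le_trans (ler_normD _ _))//.
apply: (@le_trans _ _ (n%:R ^+ 2 * c * (q - p) ^+ 2 + n%:R * c * (q - p) ^+ 2)).
  apply: lerD => //; rewrite (le_trans (ler_normD _ _))// !normrM.
  rewrite (ger0_norm p0) (ger0_norm p10).
  have := ler_wpM2l p10 h1; have := ler_wpM2l p0 h2; lra.
rewrite -!mulrDl ler_wpM2r ?sqr_ge0// ler_wpM2r//.
by rewrite -natr1; have := ler0n R n; nra.
Qed.

Lemma bern_cst n c p : bern n (fun=> c) p = c.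
Proof.
elim: n => //= n IH; rewrite [X in p * X]IH IH; ring.
Qed.

Lemma bern_id n p : bern n (fun k => k%:R) p = n%:R * p.
Proof.
elim: n => [|n IH] /=; first by rewrite mul0r.
have -> : bern n ((fun k => k%:R) \o succn) p = n%:R * p + 1.
  rewrite -IH -[X in _ + X](bern_cst n 1 p); apply/eqP.
  by rewrite addrC -subr_eq -bernB; apply/eqP; congr bern; apply/funext => k /=;
    rewrite -natr1; ring.
by rewrite IH -natr1; ring.
Qed.

Lemma bern_sum n f p :
  bern n f p = \sum_(k < n.+1) 'C(n, k)%:R * p ^+ k * (1 - p) ^+ (n - k) * f k.
Proof.
elim: n f => [|n IH] f; first by rewrite big_ord1 /= bin0 !expr0 !mul1r.
rewrite /= IH IH (big_ord_recl n.+1) /=.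
under [X in _ = _ + X]eq_bigr => i _.
  rewrite /bump/= add1n binS natrD subSS.
  rewrite (_ : _ * f i.+1 =
    'C(n, i.+1)%:R * p ^+ i.+1 * (1 - p) ^+ (n - i) * f i.+1
    + p * ('C(n, i)%:R * p ^+ i * (1 - p) ^+ (n - i) * f i.+1)); last first.
    by rewrite exprS; ring.
  over.
rewrite big_split/= -mulr_sumr [in RHS]addrA; congr (_ + _).
rewrite [in LHS]big_ord_recl [in RHS]big_ord_recr/=.
rewrite (bin_small (ltnSn n)) !mul0r addr0.
rewrite mulrDr !bin0 !subn0 mulr_sumr; congr (_ + _); first by rewrite exprS; ring.
apply: eq_bigr => i _; rewrite /bump/= add1n.
by rewrite -(subnSK (ltn_ord i)) (exprS (1 - p)); ring.
Qed.

Lemma poisson_partial_le (l : R) (A : set nat) n : 0 < l ->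
  ((\sum_(k < n.+1) poisson_pmf l k * \1_A k)%:E <= poisson_prob l 0 A)%E.
Proof.
move=> l0; rewrite /poisson_prob l0.
have -> : (\esum_(k in A) (poisson_pmf l k)%:E =
           \sum_(k <oo | k \in A) (poisson_pmf l k)%:E)%E.
  by rewrite nneseries_esum ?set_mem_set// => k _; rewrite lee_fin poisson_pmf_ge0.
rewrite (le_trans _ (nneseries_lim_ge n.+1 _))//; last first.
  by move=> k _ _; rewrite lee_fin poisson_pmf_ge0.
rewrite big_mkord [in leRHS]big_mkcond/= -sumEFin; apply: lee_sum => k _.
rewrite indicE; case: ifPn => _; last by rewrite mulr0.
by rewrite mulr1.
Qed.

(** With p = l / n, both (1 - p)^(n - k) and 1 - p k are bounded by
exponentials, and the product of the two bounds is exactly exp(-l). *)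
Lemma binomial_term_le n k (l : R) : 0 < l <= n%:R -> (k <= n)%N ->
  'C(n, k)%:R * (l / n%:R) ^+ k * (1 - l / n%:R) ^+ (n - k)
    * (1 - l / n%:R * k%:R) <= poisson_pmf l k.
Proof.
move=> /andP[l0 ln] kn; have n0 : 0 < n%:R :> R by exact: lt_le_trans ln.
rewrite /poisson_pmf l0; set p := l / n%:R.
have p0 : 0 <= p by rewrite divr_ge0 ?ltW.
have p1 : p <= 1 by rewrite ler_pdivrMr// mul1r.
have p10 : 0 <= 1 - p by rewrite subr_ge0.
have h1 : 'C(n, k)%:R * p ^+ k <= l ^+ k * k`!%:R^-1.
  rewrite ler_pdivlMr ?ltr0n ?fact_gt0// mulrAC -natrM bin_ffact.
  rewrite /p expr_div_n mulrCA -[leRHS]mulr1 ler_wpM2l ?exprn_ge0 ?(ltW l0)//.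
  rewrite ler_pdivrMr ?exprn_gt0// mul1r -natrX ler_nat.
  rewrite ffact_prod -[X in (_ <= _ ^ X)%N](card_ord k) -prod_nat_const.
  by apply: leq_prod => i _; exact: leq_subr.
have h2 : (1 - p) ^+ (n - k) * (1 - p * k%:R) <= expR (- l).
  have [neg|pos] := leP (1 - p * k%:R) 0.
    by rewrite (le_trans _ (expR_ge0 _))// mulr_ge0_le0// exprn_ge0.
  have -> : - l = - p * (n - k)%:R + - (p * k%:R).
    rewrite natrB// /p; field; exact: lt0r_neq0.
  rewrite expRD; apply: ler_pM; [exact: exprn_ge0|exact: ltW| |].
    by rewrite mulrC expRM_natl lerXn2r ?nnegrE ?expR_ge0// expR_ge1Dx.
  exact: expR_ge1Dx.
rewrite -mulrA; apply: (@le_trans _ _ ('C(n, k)%:R * p ^+ k * expR (- l))).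
  by rewrite ler_wpM2l// mulr_ge0// exprn_ge0.
by rewrite ler_wpM2r ?expR_ge0.
Qed.

(** The one-sided form of the Poisson approximation: summing the corrections
p k of [binomial_term_le] against the binomial weights gives p times the mean
n p, that is l^2 / n. *)
Lemma le_cam n (l : R) (A : set nat) : 0 < l <= n%:R ->
  ((bern n \1_A (l / n%:R))%:E <= poisson_prob l 0 A + (l ^+ 2 / n%:R)%:E)%E.
Proof.
move=> ln; have /andP[l0 ln'] := ln.
have n0 : 0 < n%:R :> R by exact: lt_le_trans ln'.
rewrite (le_trans _ (leeD2r _ (poisson_partial_le A n l0)))// -EFinD lee_fin.
set p := l / n%:R.
have p0 : 0 <= p by rewrite divr_ge0 ?ltW.
have p10 : 0 <= 1 - p by rewrite subr_ge0 ler_pdivrMr// mul1r.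
have -> : l ^+ 2 / n%:R = p * bern n (fun k => k%:R) p.
  by rewrite bern_id /p; field; exact: lt0r_neq0.
rewrite !bern_sum mulr_sumr -big_split/= ler_sum// => k _.
have := binomial_term_le ln (ltn_ord k : (k <= n)%N); rewrite -/p => h.
set w := _ * (1 - p) ^+ (n - k) in h *.
have w0 : 0 <= w by rewrite !mulr_ge0 ?exprn_ge0.
have : 0 <= p * (w * k%:R) by rewrite mulr_ge0// mulr_ge0.
rewrite indicE; move: (poisson_pmf _ _) w h w0 => r w h w0.
case: (_ \in _); rewrite /= ?mulr1 ?mulr0 ?add0r => h0 //; lra.
Qed.

End binomial_expectation.

(** * Counting in samples, and merging two samples *)

Section product_sections.
Context {d1 d2 : measure_display} {T1 : measurableType d1}
  {T2 : measurableType d2} {R : realType}.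
Variables (m1 : probability T1 R) (m2 : probability T2 R).

Lemma product_sectionl (S : set (T1 * T2)) :
  ((m1 \x m2) S = \int[m1]_x m2 [set y | S (x, y)])%E.
Proof.
by apply: eq_integral => x _ /=; congr (m2 _); apply/seteqP; split => y /=;
  rewrite /xsection/= inE.
Qed.

Lemma product_sectionr (S : set (T1 * T2)) : measurable S ->
  ((m1 \x m2) S = \int[m2]_y m1 [set x | S (x, y)])%E.
Proof.
move=> mS; transitivity ((m1 \x^ m2) S)%E.
  by apply: product_measure_unique => // A B mA mB; exact: product_measure2E.
by apply: eq_integral => y _ /=; congr (m1 _); apply/seteqP; split => x /=;
  rewrite /ysection/= inE.
Qed.

Lemma measurable_section_measurel (S : set (T1 * T2)) : measurable S ->
  measurable_fun setT (fun x => m2 [set y | S (x, y)]).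
Proof.
move=> mS; have := measurable_fun_xsection m2 mS.
by congr measurable_fun; apply/funext => x /=; congr (m2 _); apply/seteqP;
  split => y; rewrite /xsection/= inE.
Qed.

Lemma measurable_section_measurer (S : set (T1 * T2)) : measurable S ->
  measurable_fun setT (fun y => m1 [set x | S (x, y)]).
Proof.
move=> mS; have := measurable_fun_ysection m1 mS.
by congr measurable_fun; apply/funext => x /=; congr (m1 _); apply/seteqP;
  split => y; rewrite /ysection/= inE.
Qed.

End product_sections.

Section measurable_predicates.
Context {disp : measure_display} {T : measurableType disp}.

Lemma measurable_pred_set (p : T -> bool) :
  measurable_fun setT p -> measurable [set x | p x].
Proof. by move=> mp; rewrite -[X in measurable X]setTI; exact: mp. Qed.

Lemma measurable_set_pred (p : T -> bool) :
  measurable [set x | p x] -> measurable_fun setT p.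
Proof. by move=> mp; apply: (measurable_fun_bool true); rewrite setTI. Qed.

Lemma measurable_forall (I : finType) (p : I -> T -> bool) :
  (forall i, measurable_fun setT (p i)) ->
  measurable_fun setT (fun x => [forall i, p i x]).
Proof.
move=> mp; apply: measurable_set_pred.
rewrite (_ : [set _ | _] = \bigcap_(i in [set: I]) [set x | p i x]).
  by apply: fin_bigcap_measurable => // i _; exact: measurable_pred_set.
by apply/seteqP; split => x /= => [/forallP h i _|h]; [exact: h|];
  apply/forallP => i; exact: h.
Qed.

Lemma measurable_count n (p : 'I_n -> T -> bool) :
  (forall i, measurable_fun setT (p i)) ->
  measurable_fun setT (fun x => #|[pred i | p i x]|).
Proof.
move=> mp.
rewrite (_ : (fun _ => _) = fun x => (\sum_(i < n) (p i x : nat))%N); last first.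
  by apply/funext => x; rewrite -sum1_card big_mkcond; apply: eq_bigr => i _.
elim: n p mp => [|n IH] p mp.
  by rewrite (_ : (fun _ => _) = cst 0%N)//; apply/funext => x; rewrite big_ord0.
under eq_fun do rewrite big_ord_recl.
apply: measurable_fun_addn; last exact: IH.
exact: measurableT_comp (mp ord0).
Qed.

End measurable_predicates.

Section counting.
Context {disp : measure_display} {T : measurableType disp} {R : realType}.
Variable m : probability T R.

Lemma integral_iid_count n (p : T -> bool) (f : nat -> R) :
  measurable_fun setT p -> (forall k, 0 <= f k) ->
  (\int[iid m n]_t (f #|[pred i | p (tnth t i)]|)%:E =
   (bern n f (fine (m [set x | p x])))%:E)%E.
Proof.
move=> mp; set q := fine _.
have mq : m [set x | p x] = q%:E.
  by rewrite fineK// fin_num_measure//; exact: measurable_pred_set.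
have mp' n' : measurable_fun setT
   (fun t : n'.-tuple T => #|[pred i : 'I_n' | p (tnth t i)]|).
  apply: (@measurable_count _ _ n' (fun i t => p (tnth t i))) => i.
  by apply: measurableT_comp => //; exact: measurable_tnth.
have mfp n' (g : nat -> R) : measurable_fun setT
   (fun t : n'.-tuple T => (g #|[pred i : 'I_n' | p (tnth t i)]|)%:E).
  apply/measurable_EFinP.
  by apply: (@measurableT_comp _ _ _ _ _ _ g _ _ _ (mp' n')).
elim: n f => [|n IH] f f0.
  rewrite integral_iid0; last exact: mfp.
  by rewrite eq_card0// => -[].
rewrite integral_iidS; last 2 first.
- exact: mfp.
- by move=> t; rewrite lee_fin.
have q01 : 0 <= q <= 1.
  rewrite -!lee_fin -mq probability_le1 ?measure_ge0//.
  exact: measurable_pred_set.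
have mP := measurable_pred_set mp.
transitivity (\int[m]_x ((bern n f q)%:E * (\1_(~` [set x | p x]) x)%:E
    + (bern n (f \o succn) q)%:E * (\1_[set x | p x] x)%:E))%E.
  apply: eq_integral => x _.
  have card_recl (t : n.-tuple T) : #|[pred i | p (tnth [tuple of x :: t] i)]| =
      (p x + #|[pred i : 'I_n | p (tnth t i)]|)%N.
    rewrite -!sum1_card big_mkcond [in RHS]big_mkcond big_ord_recl /= unfold_in /= tnth0.
    by case: (p x); congr (_ + _)%N; apply: eq_bigr => i _;
      rewrite !unfold_in /= tnthS.
  rewrite !indicE in_setC mem_setE (_ : x \in p = p x)//.
  case: (p x) card_recl => card_recl; under eq_integral do rewrite card_recl ?add0n ?add1n.
    by rewrite /= mule1 mule0 add0e -(IH (f \o succn)) // => k; exact: f0.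
  by rewrite /= mule1 mule0 adde0 IH.
have b0 : 0 <= bern n f q by exact: bern_ge0.
have b1 : 0 <= bern n (f \o succn) q by apply: bern_ge0 => // k; exact: f0.
have mI := measurable_indic (measurableC mP) : measurable_fun setT (\1__ : T -> R).
rewrite ge0_integralD//; last 4 first.
- by move=> x _; rewrite mule_ge0// lee_fin.
- by apply: measurable_funeM; exact/measurable_EFinP.
- by move=> x _; rewrite mule_ge0// lee_fin.
- by apply: measurable_funeM; exact/measurable_EFinP.
rewrite !ge0_integralZl_EFin//; [|exact/measurable_EFinP|exact/measurable_EFinP].
rewrite !integral_indic ?setIT//; last exact: measurableC.
transitivity ((bern n f q)%:E * (1 - q)%:E + (bern n (f \o succn) q)%:E * q%:E)%E.
  have mCq : m (~` [set x | p x]) = (1 - q)%:E.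
    by rewrite probability_setC// mq EFinB.
  by rewrite -mCq -mq.
by rewrite -!EFinM -EFinD; congr EFin; rewrite /=; ring.
Qed.

(** The step that makes candidates independent of dominators.  If x and x' are
independent with law m, then so is the merged point distributed: on the event
that both are low they are exchangeable, and otherwise x is kept. *)
Definition merge (low : T -> bool) (x x' : T) : T :=
  if low x && low x' then x' else x.

Definition merge_tuple (low : T -> bool) n (p : n.-tuple T * n.-tuple T)
  : n.-tuple T := [tuple merge low (tnth p.1 i) (tnth p.2 i) | i < n].

Lemma measurable_merge (low : T -> bool) : measurable_fun setT low ->
  measurable_fun setT (fun p : T * T => merge low p.1 p.2).
Proof.
move=> ml; apply: measurable_fun_ifT => //.
by apply: measurable_and; exact: measurableT_comp.
Qed.

Lemma measurable_merge_tuple (low : T -> bool) n : measurable_fun setT low ->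
  measurable_fun setT (@merge_tuple low n).
Proof.
move=> ml; apply/measurable_fun_tnthP => i.
rewrite (_ : _ \o _ = fun p => merge low (tnth p.1 i) (tnth p.2 i)); last first.
  by apply/funext => p; rewrite /= tnth_mktuple.
apply: (@measurableT_comp _ _ _ _ _ _ _ _
  (fun p : n.-tuple T * n.-tuple T => (tnth p.1 i, tnth p.2 i))
  (measurable_merge ml)).
by apply/measurable_fun_pairP; split;
  apply: (@measurableT_comp _ _ _ _ _ _ (@tnth n T ^~ i)) => //;
  exact: measurable_tnth.
Qed.

Lemma merge_law (low : T -> bool) (B : set T) :
  measurable_fun setT low -> measurable B ->
  (m \x m)%E [set p | B (merge low p.1 p.2)] = m B.
Proof.
move=> ml mB; pose L := [set x | low x].
have mL : measurable L by exact: measurable_pred_set.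
have mCL := measurableC mL.
rewrite (_ : [set _ | _] = ((~` L `&` B) `*` setT) `|` (L `*` (L `&` B))
    `|` ((L `&` B) `*` (~` L))); last first.
  have hT : is_true true by []. have hF : ~ is_true false by [].
  by apply/seteqP; split => -[x y] /=; rewrite /merge /L /=;
    case: (low x); case: (low y) => /=; tauto.
have mBL := measurableI _ _ mL mB.
have mBCL := measurableI _ _ mCL mB.
rewrite measureU; [|by apply: measurableU; exact: measurableX|exact: measurableX|]; last first.
  by apply/seteqP; split => // -[x y] /=; tauto.
rewrite measureU; [|exact: measurableX|exact: measurableX|]; last first.
  by apply/seteqP; split => // -[x y] /=; tauto.
transitivity (m (~` L `&` B) * m setT + m L * m (L `&` B)
  + m (L `&` B) * m (~` L))%E.
  by congr (_ + _ + _)%E; apply: product_measure1E.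
rewrite probability_setT mule1 probability_setC//.
have /fineK <- : m L \is a fin_num by exact: fin_num_measure.
have E : m B = (m (~` L `&` B) + m (L `&` B))%E.
  rewrite -measureU//; first by rewrite -setIUl setUC setUv setTI.
  by apply/seteqP; split => // x /=; tauto.
rewrite E -(fineK (fin_num_measure _ _ mBL)) -(fineK (fin_num_measure _ _ mBCL)).
by rewrite -EFinB -!EFinM -!EFinD; congr EFin; ring.
Qed.

Lemma merge_tuple_law (low : T -> bool) n (A : set (n.-tuple T)) :
  measurable_fun setT low -> measurable A ->
  (iid m n \x iid m n)%E [set p | A (merge_tuple low p)] = iid m n A.
Proof.
move=> ml mA.
pose Ym : {mfun (n.-tuple T * n.-tuple T)%type >-> n.-tuple T} :=
  HB.pack (@merge_tuple low n)
    (isMeasurableFun.Build _ _ _ _ _ (@measurable_merge_tuple low n ml)).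
apply: (iid_unique (m1 := distribution (iid m n \x iid m n)%E Ym)) => // B mB.
have mS i : measurable [set p : T * T | B i (merge low p.1 p.2)].
  by rewrite -[X in measurable X]setTI; exact: measurable_merge.
transitivity (\int[iid m n]_t iid m n
    [set s | box B (merge_tuple low (s, t))])%E.
  apply: product_sectionr; rewrite -[X in measurable X]setTI.
  by apply: measurable_merge_tuple => //; exact: measurable_box.
pose g i y := fine (m [set x | B i (merge low x y)]).
have mg i : measurable_fun setT (g i).
  apply: measurableT_comp => //.
  exact: (measurable_section_measurer m (mS i)).
have msec i y : measurable [set x | B i (merge low x y)].
  have := mS i; rewrite -[X in measurable X -> _]setTI => h.
  rewrite -[X in measurable X]setTI.
  apply: (@measurableT_comp _ _ _ _ _ _ (fun p : T * T => merge low p.1 p.2) _ (fun x => (x, y))).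
  - exact: measurable_merge.
  - exact: pair2_measurable.
  - by [].
  - exact: mB.
have gE i y : m [set x | B i (merge low x y)] = (g i y)%:E.
  by rewrite fineK// fin_num_measure.
transitivity (\int[iid m n]_t (\prod_(i < n) g i (tnth t i))%:E)%E.
  apply: eq_integral => t _.
  rewrite (_ : [set s | _] = box (fun i => [set x | B i (merge low x (tnth t i))])).
    by rewrite iid_box// -prodEFin; apply: eq_bigr => i _; rewrite gE.
  by apply/seteqP; split => s Bs i; have := Bs i; rewrite /= tnth_mktuple.
rewrite integral_iid_prod//; last by move=> i x; rewrite fine_ge0.
apply: eq_bigr => i _; rewrite -(merge_law ml (mB i)) product_sectionr//.
by apply: eq_integral => y _; rewrite -gE.
Qed.

End counting.

(** * Coupling maxima with independent undominated points *)

Section union_bound.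
Context {disp : measure_display} {T : measurableType disp} {R : realType}.
Variable P : {measure set T -> \bar R}.

Lemma union_bound (I : finType) (F : I -> set T) (S : set T) :
  measurable S -> (forall i, measurable (F i)) ->
  (forall x, S x -> exists i, F i x) ->
  (P S <= \sum_(i : I) P (F i))%E.
Proof.
move=> mS mF SF.
apply: (@le_trans _ _ (P (\big[setU/set0]_(i : I) F i))).
  apply: le_measure; rewrite ?inE//; first exact: bigsetU_measurable.
  by move=> x /SF[i Fix]; rewrite -bigcup_seq; exists i => //=; rewrite mem_index_enum.
elim: (index_enum I) => [|i s IH]; first by rewrite !big_nil measure0.
rewrite !big_cons (le_trans (measureU2 _ _ _))//; first exact: bigsetU_measurable.
exact: leeD2l.
Qed.

End union_bound.

Section undominated_points.
Context {disp : measure_display} {T : measurableType disp} {R : realType}.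
Variable m : probability T R.
Variables (dom : T -> T -> bool) (low band : T -> bool).
Hypothesis mdom : measurable_fun setT (fun p : T * T => dom p.1 p.2).
Hypothesis domxx : forall x, dom x x = false.
Hypotheses (mlow : measurable_fun setT low) (mband : measurable_fun setT band).
Hypothesis band_low : forall x, band x -> low x.

(** Here [dom] is the strict domination relation, [low] the region whose maxima
are counted and [band] the part of it near the edge. *)
Definition undom n (t : n.-tuple T) (y : T) : bool :=
  [forall k : 'I_n, ~~ dom y (tnth t k)].

Definition count_maxima (keep : T -> bool) n (t : n.-tuple T) : nat :=
  #|[pred i : 'I_n | keep (tnth t i) && undom t (tnth t i)]|.

Definition count_undom n (p : n.-tuple T * n.-tuple T) : nat :=
  #|[pred i : 'I_n | band (tnth p.2 i) && undom p.1 (tnth p.2 i)]|.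

Definition near x := band x || ~~ low x.

(** The three ways in which the count of maxima of the merged sample can differ
from the count of undominated points.  In [near_event], both points of
index i are in the band or high, so that the merge may keep the wrong one.  In [cross_event], a band point of the second
sample is dominated by some low point of the first one, possibly erased by the
merge, and by no high point.  In [inner_event], it is dominated by a low point
of its own sample and by no point of the first one. *)
Definition near_event n (i : 'I_n) (p : n.-tuple T * n.-tuple T) : bool :=
  near (tnth p.1 i) && near (tnth p.2 i).

Definition cross_event n (ij : 'I_n * 'I_n) (p : n.-tuple T * n.-tuple T) : bool :=
  let y := tnth p.2 ij.1 in
  band y && [forall k : 'I_n, let x := tnth p.1 k in
    if k == ij.2 then dom y x && low x else ~~ (dom y x && ~~ low x)].

Definition inner_event n (ij : 'I_n * 'I_n) (p : n.-tuple T * n.-tuple T) : bool :=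
  let y := tnth p.2 ij.1 in let z := tnth p.2 ij.2 in
  [&& ij.2 != ij.1, band y && (dom y z && low z) & undom p.1 y].

Lemma merge_mismatch n (p : n.-tuple T * n.-tuple T) :
  count_maxima band (merge_tuple low p) <> count_undom p ->
  (exists i, near_event i p) \/
  ((exists ij, cross_event ij p) \/ (exists ij, inner_event ij p)).
Proof.
move=> neq; apply: contra_notP neq.
move=> /not_orP[/forallNP E1 /not_orP[/forallNP E2 /forallNP E3]].
apply: eq_card => i; rewrite !inE.
set y := merge_tuple low p; set x := p.1; set x' := p.2.
have yE k : tnth y k = merge low (tnth x k) (tnth x' k) by rewrite tnth_mktuple.
have high_y k : ~~ low (tnth x k) -> tnth y k = tnth x k.
  by rewrite yE /merge => /negbTE ->.
apply/idP/idP => /andP[bi ui].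
(* a maximum of the merged sample that lies in the band: it comes from x' *)
- have [lx|hx] := boolP (low (tnth x i)); last first.
    by move: bi; rewrite (high_y _ hx) => /band_low lxi; rewrite lxi in hx.
  have [lx'|hx'] := boolP (low (tnth x' i)); last first.
    have yi : tnth y i = tnth x i by rewrite yE /merge (negbTE hx') andbF.
    by exfalso; apply: (E1 i); rewrite /near_event /near -/x -/x' -yi bi hx' orbT.
  have yi : tnth y i = tnth x' i by rewrite yE /merge lx lx'.
  rewrite yi in bi ui; rewrite bi/=.
  apply/forallP => j; apply/negP => dj.
  have [lj|hj] := boolP (low (tnth x j)); last first.
    by move/forallP: ui => /(_ j); rewrite high_y// dj.
  apply: (E2 (i, j)); rewrite /cross_event/= -/x -/x' bi/=.
  apply/forallP => k; case: eqP => [->|_]; first by rewrite dj lj.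
  apply/negP => /andP[dk hk].
  by move/forallP: ui => /(_ k); rewrite high_y// dk.
(* an undominated band point of x': the merge keeps it *)
- have lx' := band_low bi.
  have lx : low (tnth x i).
    apply/negPn/negP => hx; apply: (E1 i).
    by rewrite /near_event /near -/x -/x' bi hx orbT.
  have yi : tnth y i = tnth x' i by rewrite yE /merge lx lx'.
  rewrite yi bi/=; apply/forallP => j; apply/negP => dj.
  have dxj : ~~ dom (tnth x' i) (tnth x j) by move/forallP: ui; apply.
  move: dj; rewrite yE /merge; case: ifPn => [/andP[lj lj']|_] dj; last first.
    by rewrite dj in dxj.
  apply: (E3 (i, j)); rewrite /inner_event/= -/x -/x' bi dj lj' ui !andbT/=.
  by apply/eqP => ji; move: dj; rewrite ji domxx.
Qed.

Lemma measurable_dom d' (T' : measurableType d') (f g : T' -> T) :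
  measurable_fun setT f -> measurable_fun setT g ->
  measurable_fun setT (fun x => dom (f x) (g x)).
Proof.
by move=> mf mg; exact: (measurableT_comp mdom (measurable_fun_pair mf mg)).
Qed.

Lemma measurable_undom d' (T' : measurableType d') n (f : T' -> n.-tuple T)
    (g : T' -> T) :
  measurable_fun setT f -> measurable_fun setT g ->
  measurable_fun setT (fun x => undom (f x) (g x)).
Proof.
move=> mf mg; apply: measurable_forall => k; apply: measurable_neg.
apply: measurable_dom => //.
by apply: (@measurableT_comp _ _ _ _ _ _ (@tnth n T ^~ k)) => //; exact: measurable_tnth.
Qed.

Lemma measurable_tnth1 n (i : 'I_n) :
  measurable_fun setT (fun p : n.-tuple T * n.-tuple T => tnth p.1 i).
Proof.
by apply: (@measurableT_comp _ _ _ _ _ _ (@tnth n T ^~ i)) => //; exact: measurable_tnth.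
Qed.

Lemma measurable_tnth2 n (i : 'I_n) :
  measurable_fun setT (fun p : n.-tuple T * n.-tuple T => tnth p.2 i).
Proof.
by apply: (@measurableT_comp _ _ _ _ _ _ (@tnth n T ^~ i)) => //; exact: measurable_tnth.
Qed.

Lemma measurable_near : measurable_fun setT near.
Proof. by apply: measurable_or => //; exact: measurable_neg. Qed.

Lemma measurable_count_maxima keep n : measurable_fun setT keep ->
  measurable_fun setT (@count_maxima keep n).
Proof.
move=> mk; apply: measurable_count => i; apply: measurable_and.
  by apply: measurableT_comp => //; exact: measurable_tnth.
by apply: measurable_undom => //; exact: measurable_tnth.
Qed.

Lemma measurable_count_undom n : measurable_fun setT (@count_undom n).
Proof.
apply: measurable_count => i; apply: measurable_and.
  by apply: measurableT_comp => //; exact: measurable_tnth2.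
by apply: measurable_undom => //; exact: measurable_tnth2.
Qed.

Lemma measurable_near_event n i : measurable_fun setT (@near_event n i).
Proof.
apply: measurable_and; apply: (measurableT_comp measurable_near).
  exact: measurable_tnth1.
exact: measurable_tnth2.
Qed.

Lemma measurable_cross_event n ij : measurable_fun setT (@cross_event n ij).
Proof.
apply: measurable_and.
  by apply: (measurableT_comp mband); exact: measurable_tnth2.
apply: measurable_forall => k.
have m1 := measurable_dom (measurable_tnth2 ij.1) (measurable_tnth1 k).
have m2 := measurableT_comp mlow (measurable_tnth1 k).
case: (k == ij.2); first exact: measurable_and.
by apply/measurable_neg/measurable_and => //; exact: measurable_neg.
Qed.

Lemma measurable_inner_event n ij : measurable_fun setT (@inner_event n ij).
Proof.
have m1 := measurable_dom (measurable_tnth2 ij.1) (measurable_tnth2 ij.2).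
apply: measurable_and => //; apply: measurable_and; last first.
  by apply: measurable_undom => //; exact: measurable_tnth2.
apply: measurable_and; first exact: measurableT_comp (measurable_tnth2 _).
by apply: measurable_and => //; exact: measurableT_comp (measurable_tnth2 _).
Qed.

Definition hit (y : T) : R := fine (m [set z | dom y z]).
Definition hit_low (y : T) : R := fine (m [set z | dom y z && low z]).
Definition hit_high (y : T) : R := fine (m [set z | dom y z && ~~ low z]).

Lemma measurable_dom_section y : measurable [set z | dom y z].
Proof. by apply: measurable_pred_set; exact: measurable_dom. Qed.

Lemma measurable_dom_low y : measurable [set z | dom y z && low z].
Proof.
by apply: measurable_pred_set; apply: measurable_and => //; exact: measurable_dom.
Qed.

Lemma measurable_dom_high y : measurable [set z | dom y z && ~~ low z].
Proof.
apply: measurable_pred_set; apply: measurable_and; first exact: measurable_dom.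
exact: measurable_neg.
Qed.

Lemma hitE y : m [set z | dom y z] = (hit y)%:E.
Proof. by rewrite fineK// fin_num_measure//; exact: measurable_dom_section. Qed.

Lemma hit_lowE y : m [set z | dom y z && low z] = (hit_low y)%:E.
Proof. by rewrite fineK// fin_num_measure//; exact: measurable_dom_low. Qed.

Lemma hit_highE y : m [set z | dom y z && ~~ low z] = (hit_high y)%:E.
Proof. by rewrite fineK// fin_num_measure//; exact: measurable_dom_high. Qed.

Lemma hit_split y : hit y = hit_low y + hit_high y.
Proof.
apply: EFin_inj; rewrite EFinD -hitE -hit_lowE -hit_highE -measureU//.
- by congr (m _); apply/seteqP; split => z /=;
    case: (dom y z); case: (low z) => //=; tauto.
- exact: measurable_dom_low.
- exact: measurable_dom_high.
- by apply/seteqP; split => // z /=; case: (low z); rewrite /= ?andbF => -[].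
Qed.

Lemma hit_low_ge0 y : 0 <= hit_low y. Proof. by rewrite fine_ge0. Qed.
Lemma hit_high_ge0 y : 0 <= hit_high y. Proof. by rewrite fine_ge0. Qed.

Lemma hit_le1 y : hit y <= 1.
Proof. by rewrite -lee_fin -hitE probability_le1//; exact: measurable_dom_section. Qed.

Lemma hit_high_le1 y : hit_high y <= 1.
Proof. by rewrite (le_trans _ (hit_le1 y))// hit_split lerDr hit_low_ge0. Qed.

Lemma measurable_hit : measurable_fun setT hit.
Proof.
apply: measurableT_comp => //.
apply: (measurable_section_measurel m (S := [set p : T * T | dom p.1 p.2])).
exact: measurable_pred_set.
Qed.

Lemma measurable_hit_low : measurable_fun setT hit_low.
Proof.
apply: measurableT_comp => //.
apply: (measurable_section_measurel m (S := [set p : T * T | dom p.1 p.2 && low p.2])).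
apply: measurable_pred_set; apply: measurable_and => //.
exact: measurableT_comp.
Qed.

Lemma measurable_hit_high : measurable_fun setT hit_high.
Proof.
apply: measurableT_comp => //.
apply: (measurable_section_measurel m (S := [set p : T * T | dom p.1 p.2 && ~~ low p.2])).
apply: measurable_pred_set; apply: measurable_and => //; apply: measurable_neg.
exact: measurableT_comp.
Qed.

Lemma iid_undom n y : iid m n [set t | undom t y] = ((1 - hit y) ^+ n)%:E.
Proof.
rewrite (_ : [set t | _] = box (fun _ : 'I_n => ~` [set z | dom y z])); last first.
  by apply/seteqP; split => t /= => [/forallP h i /=|h];
    [exact/negP/h|apply/forallP => i; exact/negP/h].
rewrite iid_box => [|_]; last exact/measurableC/measurable_dom_section.
transitivity (\prod_(i < n) (1 - hit y)%:E)%E.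
  apply: eq_bigr => i _; rewrite probability_setC ?hitE ?EFinB//.
  exact: measurable_dom_section.
by rewrite prodEFin prodr_const card_ord.
Qed.

(** The probability, for a band point y, that one given point of a sample is low
and dominates y while the other points of the sample do not dominate y from
above the level. *)
Definition clash n (y : T) : R :=
  (band y)%:R * hit_low y * (1 - hit_high y) ^+ n.-1.

Lemma clash_ge0 n y : 0 <= clash n y.
Proof. by rewrite !mulr_ge0 ?hit_low_ge0// exprn_ge0// subr_ge0 hit_high_le1. Qed.

Lemma measurable_nat_of_bool d' (T' : measurableType d') (b : T' -> bool) :
  measurable_fun setT b -> measurable_fun setT (fun x => (b x)%:R : R).
Proof.
move=> mb; exact: (@measurableT_comp _ _ _ _ _ _ (fun c : bool => c%:R : R)).
Qed.

Lemma measurable_clash n : measurable_fun setT (clash n).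
Proof.
apply: measurable_funM.
  by apply: measurable_funM; [exact: measurable_nat_of_bool|exact: measurable_hit_low].
by apply: measurable_funX; apply: measurable_funB => //; exact: measurable_hit_high.
Qed.

Lemma iid_tnth n (i : 'I_n) (D : set T) : measurable D ->
  iid m n [set t | D (tnth t i)] = m D.
Proof.
move=> mD; have mS : measurable [set t : n.-tuple T | D (tnth t i)].
  by rewrite -[X in measurable X]setTI; exact: measurable_tnth.
transitivity (\int[iid m n]_t (EFin \o \1_D) (tnth t i))%E.
  rewrite -[in LHS](setIT [set t : n.-tuple T | _]) -integral_indic//.
rewrite integral_iid_tnth ?integral_indic ?setIT//; first exact/measurable_EFinP.
by move=> x; rewrite lee_fin.
Qed.

Lemma near_event_prob n (i : 'I_n) :
  (iid m n \x iid m n)%E [set p | near_event i p] = (fine (m [set x | near x]) ^+ 2)%:E.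
Proof.
have mN : measurable [set x | near x].
  by apply: measurable_pred_set; exact: measurable_near.
have mS : measurable [set t : n.-tuple T | near (tnth t i)].
  apply: measurable_pred_set; apply: (measurableT_comp measurable_near).
  exact: measurable_tnth.
rewrite (_ : [set p | _] =
  [set t | near (tnth t i)] `*` [set t | near (tnth t i)]); last first.
  by apply/seteqP; split => p /= => [/andP[]|[]]; rewrite /near_event => -> ->.
transitivity (iid m n [set t | near (tnth t i)] * iid m n [set t | near (tnth t i)])%E.
  exact: product_measure1E.
rewrite (iid_tnth i mN) expr2 EFinM fineK// fin_num_measure//.
Qed.

Lemma cross_event_prob n (ij : 'I_n * 'I_n) :
  (iid m n \x iid m n)%E [set p | cross_event ij p] = (\int[m]_y (clash n y)%:E)%E.
Proof.
rewrite product_sectionr; last first.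
  by apply: measurable_pred_set; exact: measurable_cross_event.
rewrite -(@integral_iid_tnth _ _ _ m n ij.1 (EFin \o clash n)); last 2 first.
- by apply/measurable_EFinP; exact: measurable_clash.
- by move=> y; rewrite lee_fin clash_ge0.
apply: eq_integral => t _ /=; rewrite /clash; set y := tnth t ij.1.
have [by_|nby] := boolP (band y); last first.
  rewrite !mul0r (_ : [set x | _] = set0) ?measure0//.
  by apply/seteqP; split => // x /=; rewrite /cross_event/= -/y (negbTE nby).
rewrite mul1r.
rewrite (_ : [set x | _] = box (fun k => if k == ij.2
   then [set z | dom y z && low z] else ~` [set z | dom y z && ~~ low z])); last first.
  apply/seteqP; split => x /=; rewrite /cross_event/= -/y by_/=.
    move=> /forallP h k; have := h k; case: (k == ij.2) => //= hk.
    exact/negP.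
  move=> h; apply/forallP => k; have := h k; case: (k == ij.2) => //= hk.
  exact/negP.
rewrite iid_box; last first.
  move=> k; case: ifP => _; first exact: measurable_dom_low.
  exact/measurableC/measurable_dom_high.
rewrite (bigD1 ij.2)//= eqxx hit_lowE EFinM; congr (_ * _)%E.
transitivity (\prod_(k < n | k != ij.2) (1 - hit_high y)%:E)%E.
  apply: eq_bigr => k /negbTE ->.
  rewrite probability_setC ?hit_highE ?EFinB//; exact: measurable_dom_high.
rewrite prodEFin prodr_const; congr ((_ ^+ _)%:E).
by rewrite cardC1 card_ord.
Qed.

(** The dominator z belongs to the same sample as y, so it is resampled in order
to integrate it separately; the n factors 1 - hit y are then weakened to the
n - 1 factors 1 - hit_high y of [clash]. *)
Lemma inner_event_prob n (ij : 'I_n * 'I_n) :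
  ((iid m n \x iid m n) [set p | inner_event ij p] <= \int[m]_y (clash n y)%:E)%E.
Proof.
have clash0 : (0 <= \int[m]_y (clash n y)%:E)%E.
  by apply: integral_ge0 => y _; rewrite lee_fin clash_ge0.
case: ij => i j; have [ij|ij] := eqVneq j i.
  rewrite (_ : [set p | _] = set0) ?measure0//.
  by apply/seteqP; split => // p; rewrite /inner_event/= ij eqxx.
pose c p : R := (band p.1 && (dom p.1 p.2 && low p.2))%:R.
pose G p : R := c p * (1 - hit p.1) ^+ n.
have mb : measurable_fun setT (fun p : T * T => band p.1 && (dom p.1 p.2 && low p.2)).
  apply: measurable_and; first exact: measurableT_comp.
  by apply: measurable_and => //; exact: measurableT_comp.
have mG : measurable_fun setT G.
  apply: measurable_funM; first exact: measurable_nat_of_bool.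
  apply: measurable_funX; apply: measurable_funB => //.
  by apply: measurableT_comp => //; exact: measurable_hit.
have G0 p : 0 <= G p by rewrite mulr_ge0// exprn_ge0// subr_ge0 hit_le1.
rewrite product_sectionr; last first.
  by apply: measurable_pred_set; exact: measurable_inner_event.
have -> : (\int[iid m n]_t iid m n [set x | [set p | inner_event (i, j) p] (x, t)]
    = \int[iid m n]_t (G (tnth t i, tnth t j))%:E)%E.
  apply: eq_integral => t _; rewrite /G /c /=.
  have [h|nh] := boolP [&& band (tnth t i), dom (tnth t i) (tnth t j) & low (tnth t j)].
    rewrite mul1r -iid_undom; congr (iid m n _); apply/seteqP; split => x /=.
      by rewrite /inner_event/= h ij.
    by rewrite /inner_event/= h ij.
  rewrite mul0r (_ : [set x | _] = set0) ?measure0//.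
  by apply/seteqP; split => // x /=; rewrite /inner_event/= (negbTE nh) andbF.
have mGt : measurable_fun setT (fun t : n.-tuple T => G (tnth t i, tnth t j)).
  apply: (measurableT_comp mG).
  by apply: measurable_fun_pair; exact: measurable_tnth.
rewrite (integral_iid_resample m j)//; last 2 first.
- by apply/measurable_EFinP.
- by move=> t; rewrite lee_fin.
have -> : (\int[m]_z \int[iid m n]_t
      (G (tnth (set_tuple j (z, t)) i, tnth (set_tuple j (z, t)) j))%:E
    = \int[m]_z \int[m]_y (G (y, z))%:E)%E.
  apply: eq_integral => z _.
  rewrite -(@integral_iid_tnth _ _ _ m n i (fun y => (G (y, z))%:E)); last 2 first.
  - apply/measurable_EFinP; apply: (measurableT_comp mG).
    exact: measurable_fun_pair.
  - by move=> y; rewrite lee_fin.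
  by apply: eq_integral => t _; rewrite !tnth_mktuple eqxx eq_sym (negbTE ij).
rewrite -(fubini_tonelli (fun p => (G p)%:E)); last 2 first.
- exact/measurable_EFinP.
- by move=> p; rewrite lee_fin.
have mGy y : measurable_fun setT (fun z => (G (y, z))%:E).
  apply/measurable_EFinP; apply: (measurableT_comp mG).
  exact: measurable_fun_pair.
apply: ge0_le_integral => //.
- by move=> y _; apply: integral_ge0 => z _; rewrite lee_fin.
- apply: (@measurable_fun_fubini_tonelli_F _ _ _ _ _ _ (fun p => (G p)%:E)).
    exact/measurable_EFinP.
  by move=> p; rewrite lee_fin.
- by apply/measurable_EFinP; exact: measurable_clash.
move=> y _.
have -> : (\int[m]_z (G (y, z))%:E =
    ((band y)%:R * hit_low y * (1 - hit y) ^+ n)%:E)%E.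
  rewrite /G /c /=; case: (band y) => /=; last first.
    by under eq_integral do rewrite mul0r; rewrite integral0 !mul0r.
  under eq_integral do rewrite mulrC EFinM.
  rewrite mul1r ge0_integralZl_EFin//; last 2 first.
  - apply/measurable_EFinP; apply: measurable_nat_of_bool.
    by apply: measurable_and => //; exact: measurable_dom.
  - by rewrite exprn_ge0// subr_ge0 hit_le1.
  rewrite mulrC EFinM -hit_lowE; congr (_ * _)%E.
  rewrite -[in RHS](setIT [set z | _]) -integral_indic//; last exact: measurable_dom_low.
  by apply: eq_integral => z _; rewrite indicE mem_setE.
rewrite lee_fin /clash ler_wpM2l//; first by rewrite mulr_ge0// hit_low_ge0.
have h1 : 1 - hit y <= 1 - hit_high y by rewrite lerD2l lerN2 hit_split lerDr hit_low_ge0.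
have h0 : 0 <= 1 - hit y by rewrite subr_ge0 hit_le1.
apply: (@le_trans _ _ ((1 - hit_high y) ^+ n)).
  by rewrite lerXn2r// nnegrE (le_trans h0).
apply: ler_wiXn2l; last exact: leq_pred.
  exact: le_trans h0 h1.
by rewrite lerBlDr lerDl hit_high_ge0.
Qed.

(** The merged sample has the law of a single sample, so the union bound over
the mismatches of [merge_mismatch] compares the two counts. *)
Lemma coupling_bound n (B : set nat) :
  (iid m n [set t | B (count_maxima band t)] <=
   (iid m n \x iid m n) [set p | B (count_undom p)]
   + (n%:R * fine (m [set x | near x]) ^+ 2)%:E
   + (2 * n%:R ^+ 2)%:E * \int[m]_y (clash n y)%:E)%E.
Proof.
have mB d' (T' : measurableType d') (f : T' -> nat) :
    measurable_fun setT f -> measurable [set p | B (f p)].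
  by move=> mf; rewrite -[X in measurable X]setTI; exact: mf.
have mM := @measurable_count_maxima band n mband.
rewrite -(merge_tuple_law m mlow (mB _ _ _ mM)).
set P := (_ \x _)%E; set S := [set p | _].
have mS : measurable S.
  by apply: mB; apply: (measurableT_comp mM); exact: measurable_merge_tuple.
pose SU : set (n.-tuple T * n.-tuple T) := [set p | B (count_undom p)].
have mSU : measurable SU by apply: mB; exact: measurable_count_undom.
pose S1 : set (n.-tuple T * n.-tuple T) := \bigcup_(i in [set: 'I_n]) [set p | near_event i p].
pose S2 : set (n.-tuple T * n.-tuple T) := \bigcup_(i in [set: 'I_n * 'I_n]) [set p | cross_event i p].
pose S3 : set (n.-tuple T * n.-tuple T) := \bigcup_(i in [set: 'I_n * 'I_n]) [set p | inner_event i p].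
have m1 i : measurable [set p : n.-tuple T * n.-tuple T | near_event i p].
  by apply: measurable_pred_set; exact: measurable_near_event.
have m2 i : measurable [set p : n.-tuple T * n.-tuple T | cross_event i p].
  by apply: measurable_pred_set; exact: measurable_cross_event.
have m3 i : measurable [set p : n.-tuple T * n.-tuple T | inner_event i p].
  by apply: measurable_pred_set; exact: measurable_inner_event.
have mS1 : measurable S1 by exact: fin_bigcup_measurable.
have mS2 : measurable S2 by exact: fin_bigcup_measurable.
have mS3 : measurable S3 by exact: fin_bigcup_measurable.
have J0 : (0 <= \int[m]_y (clash n y)%:E)%E.
  by apply: integral_ge0 => y _; rewrite lee_fin clash_ge0.
have P1 : (P S1 <= (n%:R * fine (m [set x | near x]) ^+ 2)%:E)%E.
  rewrite (le_trans (union_bound P mS1 m1 _))//; first by move=> p [i _ ?]; exists i.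
  apply: (@le_trans _ _ (\sum_(i < n) (fine (m [set x | near x]) ^+ 2)%:E)%E).
    by apply: lee_sum => i _; rewrite -(near_event_prob i); exact: lexx.
  by rewrite sumEFin sumr_const card_ord mulr_natl.
have cardE : #|{: 'I_n * 'I_n}|%:R = n%:R ^+ 2 :> R.
  by rewrite card_prod card_ord natrM expr2.
have P2 : (P S2 <= (n%:R ^+ 2)%:E * \int[m]_y (clash n y)%:E)%E.
  rewrite (le_trans (union_bound P mS2 m2 _))//; first by move=> p [i _ ?]; exists i.
  apply: (@le_trans _ _ (\sum_(i : 'I_n * 'I_n) \int[m]_y (clash n y)%:E)%E).
    by apply: lee_sum => i _; rewrite -(cross_event_prob i); exact: lexx.
  by rewrite sumr_const -cardE mule_natl.
have P3 : (P S3 <= (n%:R ^+ 2)%:E * \int[m]_y (clash n y)%:E)%E.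
  rewrite (le_trans (union_bound P mS3 m3 _))//; first by move=> p [i _ ?]; exists i.
  rewrite (le_trans (lee_sum _ (fun i _ => inner_event_prob i)))//.
  by rewrite sumr_const -cardE mule_natl.
apply: (@le_trans _ _ (P (SU `|` (S1 `|` (S2 `|` S3))))).
  apply: le_measure; rewrite ?inE//; first by do 3! apply: measurableU => //.
  move=> p Sp; have [E|/merge_mismatch[[i e]|[[i e]|[i e]]]] :=
    pselect (count_maxima band (merge_tuple low p) = count_undom p).
  - by left; rewrite /SU /= -E.
  - by right; left; exists i.
  - by right; right; left; exists i.
  - by right; right; right; exists i.
rewrite (le_trans (measureU2 _ _ _))//; first by do 2! apply: measurableU => //.
rewrite -addeA; apply: leeD2l.
rewrite (le_trans (measureU2 _ _ _))//; first exact: measurableU.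
apply: leeD => //; rewrite (le_trans (measureU2 _ _ _))//.
rewrite mulr2n mulrDl mul1r EFinD ge0_muleDl ?lee_fin ?exprn_ge0//.
exact: leeD.
Qed.

End undominated_points.

(** * The conditional binomial law and the moments of its success probability *)

Section mixed_binomial.
Context {disp : measure_display} {T : measurableType disp} {R : realType}.
Variable P : probability T R.

Lemma integrable_bounded (f : T -> R) (c : R) : measurable_fun setT f ->
  (forall x, `|f x| <= c) -> P.-integrable setT (EFin \o f).
Proof.
move=> mf fc; apply: measurable_bounded_integrable => //.
  exact: fin_num_fun_lty.
exists c; split; first exact: num_real.
by move=> x cx y _; exact: le_trans (fc y) (ltW cx).
Qed.

Lemma measurable_bern n f (q : T -> R) : measurable_fun setT q ->
  measurable_fun setT (fun x => bern n f (q x)).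
Proof.
move=> mq; elim: n f => [|n IH] f //=.
apply: measurable_funD; apply: measurable_funM => //.
exact: measurable_funB.
Qed.

(** The first order term of the expansion of [bern n] around the mean q1 has
expectation zero, so only the variance q2 - q1^2 of the random success
probability remains.  The factor 2 bounds the second differences of an
indicator. *)
Lemma mixed_binomial_le n (B : set nat) (q : T -> R) (q1 q2 : R) :
  measurable_fun setT q -> (forall x, 0 <= q x <= 1) ->
  (\int[P]_x (q x)%:E = q1%:E)%E -> (\int[P]_x (q x ^+ 2)%:E = q2%:E)%E ->
  (\int[P]_x (bern n \1_B (q x))%:E
    <= (bern n \1_B q1 + 2 * n%:R ^+ 2 * (q2 - q1 ^+ 2))%:E)%E.
Proof.
move=> mq q01 Eq1 Eq2.
have iq : P.-integrable setT (EFin \o q).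
  apply: (@integrable_bounded _ 1) => // x.
  by have /andP[q0 qle] := q01 x; rewrite ger0_norm.
have iq2 : P.-integrable setT (EFin \o (fun x => q x ^+ 2)).
  apply: (@integrable_bounded _ 1); first exact: measurable_funX.
  by move=> x; have /andP[q0 qle] := q01 x; rewrite ger0_norm ?exprn_ge0// exprn_ile1.
have ib : P.-integrable setT (EFin \o (fun x => bern n \1_B (q x))).
  apply: (@integrable_bounded _ 1); first exact: measurable_bern.
  by move=> x; apply: bern_norm => // k; rewrite indicE; case: (_ \in _); rewrite ?normr1 ?normr0.
have ic (c : R) : P.-integrable setT (EFin \o (fun=> c)).
  exact: (@integrable_bounded _ `|c|).
have RE (f : T -> R) : P.-integrable setT (EFin \o f) ->
    (\int[P]_x (f x)%:E = (Rintegral P setT f)%:E)%E.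
  by move=> fi; rewrite /Rintegral fineK//; exact: integrable_fin_num.
have q1E : Rintegral P setT q = q1 by apply: EFin_inj; rewrite -RE.
have q2E : Rintegral P setT (fun x => q x ^+ 2) = q2 by apply: EFin_inj; rewrite -RE.
have q101 : 0 <= q1 <= 1.
  rewrite -!lee_fin -Eq1; apply/andP; split.
    by apply: integral_ge0 => x _; rewrite lee_fin; have /andP[] := q01 x.
  rewrite (@le_trans _ _ (\int[P]_x (cst 1 x))%E)//.
    apply: ge0_le_integral => //.
    - by move=> x _; rewrite lee_fin; have /andP[] := q01 x.
    - exact/measurable_EFinP.
    - by move=> x _; rewrite lee_fin; have /andP[] := q01 x.
  by rewrite integral_cst// mul1e [leLHS]probability_setT.
(* pointwise, bern n is at most its quadratic expansion at q1 *)
set d := dbern n \1_B q1; set c := 2 * n%:R ^+ 2.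
rewrite RE// lee_fin.
apply: (@le_trans _ _ (Rintegral P setT (fun x =>
   ((bern n \1_B q1 - d * q1 + c * q1 ^+ 2) + (d - 2 * c * q1) * q x) + c * q x ^+ 2))).
  apply: le_Rintegral => //.
    have h1 := integrableD measurableT (ic (bern n \1_B q1 - d * q1 + c * q1 ^+ 2))
      (integrableZl measurableT (d - 2 * c * q1) iq).
    exact: (integrableD measurableT h1 (integrableZl measurableT c iq2)).
  move=> x _; have := @bern_taylor R n \1_B q1 (q x) 2 q101 (q01 x).
  rewrite ler_norml => /(_ _)/andP[|_].
    by move=> k; rewrite !indicE; do 3! case: (_ \in _);
      rewrite ler_norml /=; apply/andP; split; lra.
  rewrite -/d /c; lra.
have iA (A : R) : P.-integrable setT (EFin \o (fun x => A + (d - 2 * c * q1) * q x)).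
  exact: (integrableD measurableT (ic A) (integrableZl measurableT (d - 2 * c * q1) iq)).
rewrite RintegralD//; last exact: (integrableZl measurableT c iq2).
rewrite RintegralD//; last exact: (integrableZl measurableT (d - 2 * c * q1) iq).
have rc A : Rintegral P setT (fun=> A) = A.
  by apply: EFin_inj; rewrite -RE// (integral_cst P measurableT) [X in (_ * X)%E]probability_setT mule1.
rewrite !RintegralZl// q1E q2E rc.
by rewrite le_eqVlt; apply/orP; left; apply/eqP; ring.
Qed.

End mixed_binomial.

Section undominated_moments.
Context {disp : measure_display} {T : measurableType disp} {R : realType}.
Variable m : probability T R.
Variables (dom : T -> T -> bool) (low band : T -> bool).
Hypothesis mdom : measurable_fun setT (fun p : T * T => dom p.1 p.2).
Hypothesis domxx : forall x, dom x x = false.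
Hypotheses (mlow : measurable_fun setT low) (mband : measurable_fun setT band).
Hypothesis band_low : forall x, band x -> low x.

(** The success probability, given the first sample, of the binomial variable
that counts the undominated band points of the second one. *)
Definition free_mass n (t : n.-tuple T) : R :=
  fine (m [set y | band y && undom dom t y]).

Lemma measurable_free_set n :
  measurable [set p : n.-tuple T * T | band p.2 && undom dom p.1 p.2].
Proof.
apply: measurable_pred_set; apply: measurable_and; first exact: measurableT_comp.
exact: measurable_undom.
Qed.

Lemma measurable_free_section n (t : n.-tuple T) :
  measurable [set y | band y && undom dom t y].
Proof.
by apply: measurable_pred_set; apply: measurable_and => //; exact: measurable_undom.
Qed.

Lemma free_massE n (t : n.-tuple T) :
  m [set y | band y && undom dom t y] = (free_mass t)%:E.
Proof. by rewrite fineK// fin_num_measure//; exact: measurable_free_section. Qed.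

Lemma free_mass01 n (t : n.-tuple T) : 0 <= free_mass t <= 1.
Proof.
rewrite -!lee_fin -free_massE measure_ge0 probability_le1//.
exact: measurable_free_section.
Qed.

Lemma measurable_free_mass n : measurable_fun setT (@free_mass n).
Proof.
apply: measurableT_comp => //.
exact: (measurable_section_measurel m (@measurable_free_set n)).
Qed.

Lemma count_undom_law n (B : set nat) :
  ((iid m n \x iid m n) [set p | B (count_undom dom band p)] =
   \int[iid m n]_t (bern n \1_B (free_mass t))%:E)%E.
Proof.
rewrite product_sectionl; apply: eq_integral => t _.
have mp : measurable_fun setT (fun y => band y && undom dom t y).
  by apply: measurable_and => //; exact: measurable_undom.
rewrite /free_mass -(integral_iid_count m n mp); last by move=> k; rewrite indicE.
have mS : measurable [set t' | B (count_undom dom band (t, t'))].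
  rewrite -[X in measurable X]setTI.
  apply: (measurableT_comp (measurable_count_undom mdom mband (n := n))) => //.
by rewrite -(setIT [set t' | _]) -integral_indic.
Qed.

Lemma free_mass_mean n :
  (\int[iid m n]_t (free_mass t)%:E =
   \int[m]_y ((band y)%:R * (1 - hit m dom y) ^+ n)%:E)%E.
Proof.
transitivity ((iid m n \x m) [set p | band p.2 && undom dom p.1 p.2])%E.
  by rewrite product_sectionl; apply: eq_integral => t _; rewrite -free_massE.
rewrite product_sectionr; last exact: measurable_free_set.
apply: eq_integral => y _ /=; case: (band y) => /=; last first.
  by rewrite mul0r (_ : [set x | _] = set0) ?measure0//; apply/seteqP; split.
by rewrite mul1r -iid_undom.
Qed.

Definition hit2 (p : T * T) : R := fine (m [set z | dom p.1 z || dom p.2 z]).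

Lemma measurable_dom_or p : measurable [set z | dom p.1 z || dom p.2 z].
Proof. by apply: measurable_pred_set; apply: measurable_or; exact: measurable_dom. Qed.

Lemma hit2E p : m [set z | dom p.1 z || dom p.2 z] = (hit2 p)%:E.
Proof. by rewrite fineK// fin_num_measure//; exact: measurable_dom_or. Qed.

Lemma iid_undom2 n p :
  iid m n [set t | undom dom t p.1 && undom dom t p.2] = ((1 - hit2 p) ^+ n)%:E.
Proof.
rewrite (_ : [set t | _] =
  box (fun _ : 'I_n => ~` [set z | dom p.1 z || dom p.2 z])); last first.
  apply/seteqP; split => t /=.
    by move=> /andP[/forallP h1 /forallP h2] i /=; apply/negP;
      rewrite negb_or h1 h2.
  by move=> h; apply/andP; split; apply/forallP => i; have /negP := h i;
    rewrite negb_or => /andP[].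
rewrite iid_box => [|_]; last exact/measurableC/measurable_dom_or.
transitivity (\prod_(i < n) (1 - hit2 p)%:E)%E.
  apply: eq_bigr => i _; rewrite probability_setC ?hit2E ?EFinB//.
  exact: measurable_dom_or.
by rewrite prodEFin prodr_const card_ord.
Qed.

Lemma free_mass_second_moment n :
  (\int[iid m n]_t (free_mass t ^+ 2)%:E =
   \int[m \x m]_p ((band p.1 && band p.2)%:R * (1 - hit2 p) ^+ n)%:E)%E.
Proof.
pose S : set (n.-tuple T * (T * T)) := [set p |
  (band p.2.1 && undom dom p.1 p.2.1) && (band p.2.2 && undom dom p.1 p.2.2)].
have mS : measurable S.
  have m1 : measurable_fun setT (fun p : n.-tuple T * (T * T) => p.2.1) by exact: measurableT_comp.
  have m2 : measurable_fun setT (fun p : n.-tuple T * (T * T) => p.2.2) by exact: measurableT_comp.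
  apply: measurable_pred_set; apply: measurable_and; apply: measurable_and;
    by [exact: (measurableT_comp mband)|exact: measurable_undom].
transitivity ((iid m n \x (m \x m)) S)%E.
  rewrite product_sectionl; apply: eq_integral => t _.
  rewrite (_ : [set y | _] = [set y | band y && undom dom t y] `*` [set y | band y && undom dom t y]).
    rewrite expr2 EFinM -free_massE; apply/esym/product_measure1E; exact: measurable_free_section.
  by apply/seteqP; split => p /=; rewrite /S /=; [case/andP => -> ->|case => -> ->].
rewrite product_sectionr//; apply: eq_integral => -[y y'] _.
rewrite /S /=; case: (band y) => /=; last first.
  by rewrite mul0r (_ : [set x | _] = set0) ?measure0//; apply/seteqP; split.
case: (band y') => /=; last first.
  rewrite mul0r (_ : [set x | _] = set0) ?measure0//; apply/seteqP; split => // t /=.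
  by rewrite andbF.
by rewrite mul1r -(iid_undom2 n (y, y')).
Qed.

(** The two counts differ only if some maximum is low but outside the band. *)
Lemma low_maxima_off_band n (B : set nat) :
  (iid m n [set t | B (count_maxima dom low t)] <=
   iid m n [set t | B (count_maxima dom band t)]
   + n%:R%:E * \int[m]_y ((low y && ~~ band y)%:R * (1 - hit m dom y) ^+ n.-1)%:E)%E.
Proof.
pose F (i : 'I_n) : set (n.-tuple T) :=
  [set t | (low (tnth t i) && ~~ band (tnth t i)) && undom dom t (tnth t i)].
have mr : measurable_fun setT (fun y => low y && ~~ band y).
  by apply: measurable_and => //; exact: measurable_neg.
have mF i : measurable (F i).
  apply: measurable_pred_set; apply: measurable_and.
    by apply: (measurableT_comp mr); exact: measurable_tnth.
  by apply: measurable_undom => //; exact: measurable_tnth.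
have mB keep : measurable_fun setT keep ->
    measurable [set t : n.-tuple T | B (count_maxima dom keep t)].
  move=> mk; rewrite -[X in measurable X]setTI.
  exact: (measurable_count_maxima mdom mk).
have FE i : iid m n (F i) =
    (\int[m]_y ((low y && ~~ band y)%:R * (1 - hit m dom y) ^+ n.-1)%:E)%E.
  rewrite (iid_resample m i)//.
  transitivity (\int[m]_y iid m n [set t | F i (set_tuple i (y, t))])%E.
    exact: product_sectionl.
  apply: eq_integral => y _.
  rewrite (_ : [set t | _] = [set t | (low y && ~~ band y) &&
     [forall k : 'I_n, (k != i) ==> ~~ dom y (tnth t k)]]); last first.
    apply/seteqP; split => t; rewrite /F /= !tnth_mktuple eqxx => /andP[-> /forallP h] /=;
      apply/forallP => k; have := h k; rewrite tnth_mktuple;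
      by case: eqVneq => //= _; rewrite domxx.
  case: (low y && ~~ band y) => /=; last first.
    by rewrite mul0r (_ : [set x | _] = set0) ?measure0//; apply/seteqP; split.
  rewrite mul1r (_ : [set t | _] =
    box (fun k => if k == i then setT else ~` [set z | dom y z])); last first.
    apply/seteqP; split => t /= => [/forallP h k|h].
      by have := h k; case: eqVneq => //= _ /negP.
    by apply/forallP => k; have := h k; case: eqVneq => //= _ /negP.
  rewrite iid_box; last first.
    by move=> k; case: ifP => // _; apply/measurableC/measurable_dom_section.
  rewrite (bigD1 i)//= eqxx probability_setT mul1e.
  transitivity (\prod_(k < n | k != i) (1 - hit m dom y)%:E)%E.
    apply: eq_bigr => k /negbTE ->.
    rewrite probability_setC ?hitE ?EFinB//; exact: measurable_dom_section.
  by rewrite prodEFin prodr_const cardC1 card_ord.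
apply: (@le_trans _ _ (iid m n ([set t | B (count_maxima dom band t)]
    `|` \bigcup_(i in [set: 'I_n]) F i))).
  apply: le_measure; rewrite ?inE; [exact: mB| |].
    by apply: measurableU; [exact: mB|exact: fin_bigcup_measurable].
  move=> t /= Bt; have [[i Fi]|nF] := pselect (exists i, F i t); first by right; exists i.
  left; rewrite (_ : count_maxima _ _ _ = count_maxima dom low t)//.
  apply: eq_card => i; rewrite !inE; apply/andP/andP => -[h u]; split=> //.
    exact: band_low.
  apply/negPn/negP => nb; apply: nF; exists i.
  by rewrite /F /= h nb u.
rewrite (le_trans (measureU2 _ _ _))//; [exact: mB|exact: fin_bigcup_measurable|].
apply: leeD2l; apply: (@le_trans _ _ (\sum_(i < n) iid m n (F i))%E).
  apply: union_bound => //; first exact: fin_bigcup_measurable.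
  by move=> t [i _ Fi]; exists i.
under eq_bigr do rewrite FE.
by rewrite sumr_const card_ord mule_natl.
Qed.

End undominated_moments.

(** * The exponential law and the l1-norm of a vector *)

Section density.
Context {disp : measure_display} {T : measurableType disp} {R : realType}.
Variables (mu nu : {measure set T -> \bar R}) (g : T -> R).
Hypotheses (mg : measurable_fun setT g) (g0 : forall x, 0 <= g x).
Hypothesis nuE : forall A, measurable A -> nu A = (\int[mu]_(x in A) (g x)%:E)%E.

Import HBNNSimple.

Let integral_density_nnsfun (f : {nnsfun T >-> R}) :
  (\int[nu]_x (f x)%:E = \int[mu]_x ((f x)%:E * (g x)%:E))%E.
Proof.
under [LHS]eq_integral do rewrite fimfunE -fsumEFin//.
rewrite [LHS]ge0_integral_fsum//; last 2 first.
- by move=> r; exact/measurable_EFinP/measurableT_comp.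
- by move=> n x _; rewrite EFinM nnfun_muleindic_ge0.
under [RHS]eq_integral => x _.
  rewrite fimfunE -fsumEFin// muleC ge0_mule_fsumr; last first.
    by move=> r; rewrite EFinM nnfun_muleindic_ge0.
  over.
rewrite [RHS]ge0_integral_fsum//; last 2 first.
- move=> r; apply: emeasurable_funM; first exact/measurable_EFinP.
  exact/measurable_EFinP/measurableT_comp.
- move=> r x _; apply: mule_ge0; first by rewrite lee_fin.
  by rewrite EFinM nnfun_muleindic_ge0.
apply: eq_fsbigr => r _; rewrite integralZl_indic_nnsfun//.
rewrite integral_indic// setIT nuE//.
have [r0|r0] := leP 0 r; last first.
  rewrite preimage_nnfun0// integral_set0 mule0; apply/esym/integral0_eq => x _.
  by rewrite indicE in_set0 mulr0 mule0.
transitivity (r%:E * \int[mu]_x ((g x)%:E * (\1_(f @^-1` [set r]) x)%:E))%E.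
  congr (_ * _)%E; rewrite [LHS]integral_mkcond; apply: eq_integral => x _.
  by rewrite patchE indicE; case: ifPn; rewrite ?mule1 ?mule0.
rewrite -ge0_integralZl_EFin//; last 2 first.
- by move=> x _; rewrite mule_ge0// lee_fin.
- by apply: emeasurable_funM; exact/measurable_EFinP.
by apply: eq_integral => x _; rewrite EFinM muleCA.
Qed.

Lemma integral_density (f : T -> \bar R) : measurable_fun setT f ->
  (forall x, 0 <= f x)%E -> (\int[nu]_x f x = \int[mu]_x (f x * (g x)%:E))%E.
Proof.
move=> mf f0; pose f_ := nnsfun_approx measurableT mf.
have cvgf x : ((f_ n x)%:E @[n --> \oo] --> f x)%E.
  by apply: cvg_nnsfun_approx.
have ndf x : nondecreasing_seq (fun n => (f_ n x)%:E).
  by move=> a b ab; rewrite lee_fin; exact/lefP/nd_nnsfun_approx.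
transitivity (lim (\int[nu]_x (f_ n x)%:E @[n --> \oo])%E).
  rewrite -monotone_convergence//=.
  - by apply: eq_integral => x _; apply/esym/cvg_lim.
  - by move=> n; exact/measurable_EFinP/measurable_funTS.
  - by move=> n x _; rewrite lee_fin.
transitivity (lim (\int[mu]_x ((f_ n x)%:E * (g x)%:E) @[n --> \oo])%E).
  by apply: congr_lim; apply/funext => n /=; exact: integral_density_nnsfun.
rewrite -monotone_convergence//=.
- apply: eq_integral => x _; apply/cvg_lim => //.
  by rewrite muleC; under eq_fun do rewrite muleC; apply: cvgeZl.
- by move=> n; apply: emeasurable_funM => //; exact/measurable_EFinP/measurable_funTS.
- by move=> n x _; rewrite mule_ge0// lee_fin.
- by move=> x _ a b ab; rewrite lee_wpmul2r ?lee_fin//; exact: ndf.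
Qed.

End density.

Section exponential_law.
Context {R : realType}.
Notation mu := (@lebesgue_measure R).

Let idTR : measurableTypeR R -> R := fun x => x.

Let measurable_idTR : measurable_fun setT idTR.
Proof. by move=> _ Y mY; rewrite setTI. Qed.

HB.instance Definition _ := isMeasurableFun.Build _ _ _ _ idTR measurable_idTR.

(** The exponential law, transported along the identity from the copy of the
real line on which it is defined to the one that carries the tuples. *)
Definition exp1 : probability R R := distribution
  (exponential_distribution_exponential_prob__canonical__probability_measure_Probability
    (ltr01 : 0 < 1 :> R)) idTR.

Lemma exp1E (A : set R) : exp1 A = exponential_prob 1 A. Proof. by []. Qed.

Definition translate (c : R) : measurableTypeR R -> measurableTypeR R :=
  fun x => (x : R) + c.

Lemma measurable_translate c : measurable_fun setT (translate c).
Proof. exact: (@measurable_funD _ R R setT id (cst c)). Qed.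

HB.instance Definition _ c :=
  isMeasurableFun.Build _ _ _ _ (translate c) (measurable_translate c).

Lemma lebesgue_translation (c : R) (A : set R) : measurable A ->
  pushforward mu (translate c) A = mu A.
Proof.
move=> mA; apply/esym/lebesgue_measure_unique => //= _ [[a b]] _ <-.
rewrite /pushforward.
have -> : translate c @^-1` `]a, b]%classic = `]a - c, b - c]%classic.
  by apply/seteqP; split => x /=; rewrite !in_itv/= ltrBlDr lerBrDr.
rewrite !lebesgue_measure_itv/= !lte_fin ltrD2r; case: ifP => // _.
by congr EFin; ring.
Qed.

Lemma integral_translate (c : R) (f : R -> \bar R) :
  measurable_fun setT f -> (forall x, 0 <= f x)%E ->
  (\int[mu]_x f (translate c x) = \int[mu]_x f x)%E.
Proof.
move=> mf f0.
transitivity (\int[pushforward mu (translate c)]_x f x)%E.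
  by rewrite ge0_integral_pushforward.
by apply: eq_measure_integral => A mA _; exact: lebesgue_translation.
Qed.

Lemma integral_exp1 (f : R -> \bar R) :
  measurable_fun setT f -> (forall x, 0 <= f x)%E ->
  (\int[exp1]_x f x = \int[mu]_(x in `[0%R, +oo[) (f x * (expR (- (x : R)))%:E))%E.
Proof.
move=> mf f0; rewrite /exp1 ge0_integral_distribution//.
rewrite (@integral_density _ _ _ mu _ (exponential_pdf 1))//.
- rewrite [RHS]integral_mkcond; apply: eq_integral => x _.
  rewrite patchE mem_setE in_itv/= andbT; case: leP => x0.
    by rewrite exponential_pdfE// mul1r mulN1r.
  by rewrite lt0_exponential_pdf ?mule0.
- exact: measurable_exponential_pdf.
- by move=> x; exact: exponential_pdf_ge0.
Qed.

Lemma continuous_expRN : continuous (fun x : R => expR (- x)).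
Proof.
move=> x; apply: continuous_comp; last exact: continuous_expR.
exact: (@continuousN _ R^o).
Qed.

Lemma exp1_ray (a : R) : 0 <= a -> exp1 `]a, +oo[%classic = (expR (- a))%:E.
Proof.
move=> a0; rewrite exp1E /exponential_prob integral_itv_obnd_cbnd; last first.
  apply/measurable_EFinP/measurable_funTS; exact: measurable_exponential_pdf.
rewrite (@ge0_continuous_FTC2y _ _ (fun x => - expR (- 1 * x)) _ 0)//.
- by rewrite mulN1r EFinN oppeK add0e.
- by move=> x _; exact: exponential_pdf_ge0.
- apply: (@continuous_subspaceW R^o _ _ [set` `[0, +oo[%R]); last exact: within_continuous_exponential_pdf.
  by apply: subset_itvr; rewrite bnd_simp.
- rewrite -oppr0; apply: cvgN.
  rewrite (_ : (fun x => _) = fun x => expR (- x)); first exact: cvgr_expR.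
  by apply/funext => x; rewrite mulN1r.
- apply: cvgN; apply/cvg_at_right_filter.
  rewrite (_ : (fun x => _) = fun x => expR (- x)); last first.
    by apply/funext => x; rewrite mulN1r.
  by rewrite mulN1r; exact: continuous_expRN.
- move=> x; rewrite in_itv/= andbT => ax; apply: derive1_exponential_pdf.
  by rewrite in_itv/= andbT (le_lt_trans a0).
Qed.

Lemma exp1_interval (a b : R) : 0 <= a -> a <= b ->
  exp1 `]a, b]%classic = (expR (- a) - expR (- b))%:E.
Proof.
move=> a0 ab.
have -> : `]a, b]%classic = `]a, +oo[%classic `\` `]b, +oo[%classic :> set R.
  apply/seteqP; split => x /=; rewrite !in_itv/= !andbT.
    by move=> /andP[-> xb]; split => //; apply/negP; rewrite -leNgt.
  by move=> [-> /negP]; rewrite -leNgt.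
rewrite measureD//; last first.
  by rewrite (@le_lt_trans _ _ 1%E) ?ltry//; exact: probability_le1.
rewrite (_ : _ `&` _ = `]b, +oo[%classic); last first.
  apply/seteqP; split => x /=; rewrite !in_itv/= !andbT; first by case.
  by move=> bx; rewrite (le_lt_trans ab).
by rewrite EFinB -(exp1_ray a0) -(exp1_ray (le_trans a0 ab)).
Qed.

Lemma exp1_ge0 : exp1 `[0, +oo[%classic = 1%E.
Proof.
apply/eqP; rewrite eq_le; apply/andP; split; first exact: probability_le1.
have := exp1_ray (lexx 0); rewrite oppr0 expR0 => <-.
apply: le_measure; rewrite ?inE//.
by apply: subset_itvr; rewrite bnd_simp.
Qed.

Lemma integral_expR_abs (k : R) : 0 < k ->
  (\int[mu]_x (expR (- (k * `|x : R|)))%:E = (2 / k)%:E)%E.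
Proof.
move=> k0; pose h (x : R) := expR (- (k * `|x|)).
have ch : continuous h.
  move=> x; apply: continuous_comp; last exact: continuous_expR.
  apply: (@continuousN _ R^o); apply: (@continuousM _ R^o (cst k)); first exact: cst_continuous.
  exact: norm_continuous.
rewrite (@ge0_symfun_integralT _ h)//; last 2 first.
- by move=> x; exact: expR_ge0.
- by move=> x; rewrite /h/= normrN.
have -> : (\int[mu]_(x in [set x | (0 <= x)%R]) (h x)%:E =
    \int[mu]_x ((k^-1)%:E * (exponential_pdf k x)%:E))%E.
  rewrite -set_itvcy [LHS]integral_mkcond; apply: eq_integral => x _.
  rewrite patchE mem_setE in_itv/= andbT; case: (leP 0 (x : R)) => x0.
    by rewrite exponential_pdfE// -EFinM mulrA mulVf ?gt_eqF// mul1r /h ger0_norm// mulNr.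
  by rewrite lt0_exponential_pdf ?mule0.
rewrite ge0_integralZl_EFin//; last 3 first.
- by move=> x _; rewrite lee_fin exponential_pdf_ge0// ltW.
- by apply/measurable_EFinP; exact: measurable_exponential_pdf.
- by rewrite invr_ge0 ltW.
by rewrite integral_exponential_pdf// mule1 -EFinM.
Qed.

Lemma measurable_laplace (k x : R) :
  measurable_fun setT (fun y : R => expR (- (k * `|y - x|))).
Proof.
apply: measurableT_comp => //; apply: measurable_funN; apply: measurable_funM => //.
by apply: measurableT_comp => //; exact: measurable_funB.
Qed.

(** The weight exp |y| cancels the exponential density, and leaves the integral
over a half-line of a two-sided exponential. *)
Lemma integral_laplace (x k : R) : 0 < k ->
  (\int[exp1]_y (expR `|y| * expR (- (k * `|y - x|)))%:E <= (2 / k)%:E)%E.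
Proof.
move=> k0; have mf := measurable_laplace k x.
rewrite integral_exp1; last 2 first.
- by apply/measurable_EFinP; apply: measurable_funM => //; exact: measurableT_comp.
- by move=> y; rewrite lee_fin mulr_ge0 ?expR_ge0.
rewrite -(integral_expR_abs k0).
rewrite -(@integral_translate (- x) (fun y => (expR (- (k * `|y|)))%:E)); last 2 first.
- apply/measurable_EFinP; have := measurable_laplace k 0.
  by under eq_fun do rewrite subr0.
- by move=> y; rewrite lee_fin expR_ge0.
rewrite [leLHS]integral_mkcond; apply: ge0_le_integral => //.
- by move=> y _; rewrite patchE; case: ifP => // _; rewrite mule_ge0// lee_fin ?mulr_ge0 ?expR_ge0.
- apply/(measurable_restrictT _ _).1 => //; apply: measurable_funTS.
  apply: emeasurable_funM; apply/measurable_EFinP.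
    by apply: measurable_funM => //; exact: measurableT_comp.
  exact: continuous_measurable_fun continuous_expRN.
- exact/measurable_EFinP.
- move=> y _; rewrite patchE mem_setE in_itv/= andbT; case: ifP => y0; last by rewrite lee_fin expR_ge0.
  rewrite -EFinM lee_fin ger0_norm// mulrAC -expRD subrr expR0 mul1r.
  by rewrite /translate.
Qed.

Lemma measurable_l1norm d : measurable_fun setT (@l1norm R d).
Proof.
apply: measurable_sum => j; apply: measurableT_comp => //; exact: measurable_tnth.
Qed.

Lemma l1norm_cons d (x : R) (t : d.-tuple R) :
  l1norm [tuple of x :: t] = `|x| + l1norm t.
Proof.
by rewrite /l1norm big_ord_recl tnth0; congr (_ + _); apply: eq_bigr => i _; rewrite tnthS.
Qed.

Lemma l1norm_nil (t : 0.-tuple R) : l1norm t = 0.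
Proof. by rewrite /l1norm big_ord0. Qed.

Let LR := measurableTypeR R.
(** Indicator of the nonnegative half-line: writing the constraints as factors
lets the integration variables be exchanged and translated freely. *)
Let pos (x : R) : R := ((0 <= x)%R : bool)%:R.

Let measurable_pos : measurable_fun setT pos.
Proof.
apply: (@measurableT_comp _ _ _ _ _ _ (fun b : bool => b%:R : R)) => //.
exact: measurable_fun_ler.
Qed.

Lemma continuous_monomial k (c : R) : continuous (fun r : R => r ^+ k / c).
Proof.
move=> r; apply: (@continuousM _ R^o (fun r : R => r ^+ k) (fun=> c^-1)).
  exact: exprn_continuous.
exact: cst_continuous.
Qed.

Lemma integral_monomial k (v : R) :
  (\int[mu]_r (pos (v - (r : R)) * (pos r * ((r : R) ^+ k / k`!%:R)))%:E =
   (pos v * (v ^+ k.+1 / k.+1`!%:R))%:E)%E.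
Proof.
have -> : (\int[mu]_r (pos (v - (r : R)) * (pos r * ((r : R) ^+ k / k`!%:R)))%:E =
    \int[mu]_(r in `[0%R, v]) ((r : R) ^+ k / k`!%:R)%:E)%E.
  rewrite [RHS]integral_mkcond; apply: eq_integral => r _.
  rewrite patchE mem_setE in_itv/= /pos subr_ge0.
  by case: (leP r v); case: (leP 0 r); rewrite /= ?mul1r ?mul0r ?mulr0 ?mul1r.
rewrite /pos; have [v0|v0|<-] := ltgtP 0 v.
- rewrite mul1r (@continuous_FTC2 _ _ (fun r : R => r ^+ k.+1 / k.+1`!%:R))//.
  + by rewrite expr0n/= mul0r sube0.
  + by apply: continuous_subspaceT; exact: continuous_monomial.
  + split.
    * move=> r _; apply: (@derivableM _ _ (fun r : R => r ^+ k.+1) (cst _)) => //.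
      exact: exprn_derivable.
    * by apply/cvg_at_right_filter; exact: continuous_monomial.
    * by apply/cvg_at_left_filter; exact: continuous_monomial.
  + move=> r _; rewrite (@derive1Mr _ (@GRing.exp R ^~ k.+1)); last exact: exprn_derivable.
    rewrite exp_derive1 factS natrM /= /GRing.scale /=; field.
    by rewrite pnatr_eq0 -lt0n fact_gt0 addrC natr1 pnatr_eq0.
- by rewrite mul0r set_itv_ge ?integral_set0// bnd_simp -ltNge.
- by rewrite expr0n/= mul0r mulr0 set_itv1 integral_set1.
Qed.

(** The l1-norm of k + 1 independent exponential variables has the gamma density
r^k / k! exp(-r): convolving with one more variable integrates r^k to
v^(k + 1) / (k + 1), the exponential factors depending on the sum only. *)
Lemma l1norm_exp_law k (F : R -> \bar R) :
  measurable_fun setT F -> (forall r, 0 <= F r)%E ->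
  (\int[iid exp1 k.+1]_t F (l1norm t) =
   \int[mu]_(r in `[0%R, +oo[)
     (F r * ((r : R) ^+ k / k`!%:R * expR (- (r : R)))%:E))%E.
Proof.
elim: k F => [|k IH] F mF F0.
  rewrite integral_iidS//; last first.
    by apply: (measurableT_comp mF); exact: measurable_l1norm.
  transitivity (\int[exp1]_x F `|x|%R)%E.
    apply: eq_integral => x _; rewrite integral_iid0; first by rewrite l1norm_cons l1norm_nil addr0.
    apply: (measurableT_comp mF); apply: (measurableT_comp (@measurable_l1norm 1)).
    exact: (@measurable_cons _ _ _ _ (cst x) 0 id).
  rewrite integral_exp1//; last exact: (measurableT_comp mF).
  apply: eq_integral => r; rewrite inE/= in_itv/= andbT => r0.
  by rewrite ger0_norm// expr0 divr1 mul1r.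
have mFl d (x : R) : measurable_fun setT (fun t : d.-tuple R => F (`|x| + l1norm t)).
  apply: (measurableT_comp mF); apply: measurable_funD => //; exact: measurable_l1norm.
rewrite integral_iidS//; last first.
  by apply: (measurableT_comp mF); exact: measurable_l1norm.
pose w (r : R) : R := r ^+ k / k`!%:R.
have mw : measurable_fun setT w by apply: measurable_funM => //; exact: measurable_funX.
pose I (x : R) := (\int[iid exp1 k.+1]_t F (`|x| + l1norm t)%R)%E.
have mFabs (x : R) : measurable_fun setT (fun r => F (`|x| + r)).
  by apply: (measurableT_comp mF); exact: measurable_funD.
have IE (x : R) : I x = (\int[mu]_(r in `[0%R, +oo[)
     (F (`|x| + (r : R))%R * (w r * expR (- (r : R)))%:E))%E.
  by rewrite /I (IH (fun r => F (`|x| + r))).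
have mI : measurable_fun setT I.
  apply: (@measurable_fun_fubini_tonelli_F _ _ _ _ _ _
    (fun p : R * k.+1.-tuple R => F (`|p.1| + l1norm p.2))).
    apply: (measurableT_comp mF); apply: measurable_funD; first exact: measurableT_comp.
    by apply: measurableT_comp => //; exact: measurable_l1norm.
  by move=> p.
transitivity (\int[exp1]_x I x)%E.
  by apply: eq_integral => x _; apply: eq_integral => t _; rewrite l1norm_cons.
rewrite integral_exp1//; last by move=> x; exact: integral_ge0.
pose H (p : LR * LR) : \bar R := (F ((p.1 : R) + (p.2 : R))%R *
  (pos p.1 * (pos p.2 * w p.2) * expR (- ((p.1 : R) + (p.2 : R))))%:E)%E.
pose G (r : R) (v : R) : \bar R := (F v *
  (pos (v - r) * (pos r * w r) * expR (- v))%:E)%E.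
have mFw c : measurable_fun setT (fun v : R => (w v * c)%:E).
  by apply/measurable_EFinP; exact: measurable_funM.
have w0 r : 0 <= pos r * w r.
  rewrite /pos /w; case: (leP 0 r) => /= r0; last by rewrite mul0r.
  by rewrite mul1r mulr_ge0// exprn_ge0.
have pos0 r : 0 <= pos r by rewrite /pos.
have mpw : measurable_fun setT (fun r => pos r * w r) by exact: measurable_funM.
have mE : measurable_fun setT (fun x : R => expR (- x)).
  exact: continuous_measurable_fun continuous_expRN.
have mH : measurable_fun setT H.
  have m1 : measurable_fun setT (fun p : LR * LR => p.1 : R) by exact: measurable_fst.
  have m2 : measurable_fun setT (fun p : LR * LR => p.2 : R) by exact: measurable_snd.
  have m12 : measurable_fun setT (fun p : LR * LR => (p.1 : R) + (p.2 : R)).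
    exact: measurable_funD.
  apply: emeasurable_funM; first exact: (measurableT_comp mF m12).
  apply/measurable_EFinP; apply: measurable_funM; last exact: (measurableT_comp mE m12).
  apply: measurable_funM; first exact: (measurableT_comp measurable_pos m1).
  exact: (measurableT_comp mpw m2).
have H0 p : (0 <= H p)%E.
  by rewrite mule_ge0// lee_fin mulr_ge0 ?expR_ge0// mulr_ge0.
(* the joint density of the new variable x and of the norm r of the others *)
transitivity (\int[mu]_x \int[mu]_r H (x, r))%E.
  rewrite [LHS]integral_mkcond; apply: eq_integral => x _.
  rewrite patchE mem_setE in_itv/= andbT; case: ifPn => x0; last first.
    apply/esym/integral0_eq => r _; rewrite /H/= /pos (negbTE x0).
    by rewrite mul0r mul0r mule0.
  rewrite IE muleC -ge0_integralZl_EFin//; last 2 first.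
  - move=> r; rewrite /= in_itv/= andbT => r0.
    by rewrite mule_ge0// lee_fin mulr_ge0 ?expR_ge0// /w mulr_ge0// exprn_ge0.
  - apply: measurable_funTS; apply: emeasurable_funM; first exact: mFabs.
    by apply/measurable_EFinP; exact: measurable_funM.
  rewrite [LHS]integral_mkcond; apply: eq_integral => r _.
  rewrite patchE mem_setE in_itv/= andbT /H /pos x0; case: ifPn => r0; last first.
    by rewrite mul0r mulr0 mul0r mule0.
  rewrite !mul1r muleCA ger0_norm//; congr (_ * _)%E; rewrite -EFinM; congr EFin.
  by rewrite opprD expRD; ring.
rewrite fubini_tonelli//.
(* v = x + r is the norm of the extended vector *)
transitivity (\int[mu]_r \int[mu]_v G r v)%E.
  apply: eq_integral => r _.
  rewrite -(@integral_translate r (G r)); last 2 first.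
  - apply: emeasurable_funM => //; apply/measurable_EFinP.
    apply: measurable_funM => //; apply: measurable_funM => //.
    by apply: (measurableT_comp measurable_pos); exact: measurable_funB.
  - by move=> v; rewrite mule_ge0// lee_fin mulr_ge0 ?expR_ge0// mulr_ge0.
  by apply: eq_integral => x _; rewrite /H /G /translate /= addrK.
rewrite (fubini_tonelli (fun p : LR * LR => G p.1 p.2)); last 2 first.
- have m1 : measurable_fun setT (fun p : LR * LR => p.1 : R) by exact: measurable_fst.
  have m2 : measurable_fun setT (fun p : LR * LR => p.2 : R) by exact: measurable_snd.
  have m12 : measurable_fun setT (fun p : LR * LR => (p.2 : R) - (p.1 : R)).
    exact: measurable_funB.
  apply: emeasurable_funM; first exact: (measurableT_comp mF m2).
  apply/measurable_EFinP; apply: measurable_funM; last exact: (measurableT_comp mE m2).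
  apply: measurable_funM; first exact: (measurableT_comp measurable_pos m12).
  exact: (measurableT_comp mpw m1).
- by move=> p; rewrite mule_ge0// lee_fin mulr_ge0 ?expR_ge0// mulr_ge0.
rewrite [RHS]integral_mkcond; apply: eq_integral => v _.
transitivity (F v * ((expR (- (v : R)))%:E *
  \int[mu]_r (pos ((v : R) - (r : R)) * (pos r * ((r : R) ^+ k / k`!%:R)))%:E))%E.
  rewrite -ge0_integralZl_EFin//; last 2 first.
  - by move=> r _; rewrite lee_fin mulr_ge0// w0.
  - apply/measurable_EFinP; apply: measurable_funM => //.
    by apply: (measurableT_comp measurable_pos); exact: measurable_funB.
  rewrite -ge0_integralZl//; last 2 first.
  - apply: measurable_funeM; apply/measurable_EFinP; apply: measurable_funM => //.
    by apply: (measurableT_comp measurable_pos); exact: measurable_funB.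
  - by move=> r _; rewrite mule_ge0// lee_fin ?expR_ge0// mulr_ge0// w0.
  by apply: eq_integral => r _; rewrite /G/= -EFinM [in RHS]mulrC.
rewrite integral_monomial patchE mem_setE in_itv/= andbT /pos.
case: ifPn => v0; last by rewrite mul0r mule0 mule0.
by rewrite mul1r -EFinM mulrC.
Qed.

End exponential_law.

(** * Domination probabilities for exponential vectors *)

Section almost_sure_comparison.
Context {disp : measure_display} {T : measurableType disp} {R : realType}.
Variables (P : probability T R) (S : set T).
Hypotheses (mS : measurable S) (PS : P S = 1%E).

Lemma integral_full_set (f : T -> \bar R) : measurable_fun setT f ->
  (forall x, 0 <= f x)%E -> (\int[P]_x f x = \int[P]_(x in S) f x)%E.
Proof.
move=> mf f0; rewrite (@ge0_negligible_integral _ _ _ P setT (~` S))//.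
- by rewrite setTD setCK.
- exact: measurableC.
- transitivity (1 - P S)%E; first exact: probability_setC.
  by rewrite PS subee.
Qed.

Lemma le_integral_full_set (f g : T -> \bar R) : measurable_fun setT f ->
  measurable_fun setT g -> (forall x, 0 <= f x)%E -> (forall x, 0 <= g x)%E ->
  (forall x, S x -> f x <= g x)%E -> (\int[P]_x f x <= \int[P]_x g x)%E.
Proof.
move=> mf mg f0 g0 fg; rewrite (integral_full_set mf f0) (integral_full_set mg g0).
apply: ge0_le_integral => //; exact: measurable_funTS.
Qed.

End almost_sure_comparison.

Section exponential_orthants.
Context {R : realType} (d : nat).
Notation E := (d.-tuple R).
Notation mu := (iid (@exp1 R) d).

Definition orthant : set E := [set x | forall j, 0 <= tnth x j].

Lemma orthantE : orthant = box (fun _ : 'I_d => `[0, +oo[%classic : set R).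
Proof. by apply/seteqP; split => x h j; have := h j; rewrite /= in_itv/= andbT. Qed.

Lemma measurable_orthant : measurable orthant.
Proof. by rewrite orthantE; exact: measurable_box. Qed.

Lemma orthant1 : mu orthant = 1%E.
Proof. by rewrite orthantE iid_box// big1// => j _; exact: exp1_ge0. Qed.

Lemma l1norm_orthant x : orthant x -> l1norm x = \sum_(j < d) tnth x j.
Proof. by move=> x0; apply: eq_bigr => j _; rewrite ger0_norm. Qed.

Lemma l1norm_ge0 (x : E) : 0 <= l1norm x.
Proof. by apply: sumr_ge0 => j _; exact: normr_ge0. Qed.

Lemma measurable_prec : measurable_fun setT (fun p : E * E => prec p.1 p.2).
Proof.
apply: measurable_forall => j; apply: measurable_fun_ltr.
  by apply: (@measurableT_comp _ _ _ _ _ _ (@tnth d R ^~ j)) => //; exact: measurable_tnth.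
by apply: (@measurableT_comp _ _ _ _ _ _ (@tnth d R ^~ j)) => //; exact: measurable_tnth.
Qed.

Lemma prec_irr (x : E) : (0 < d)%N -> prec x x = false.
Proof. by move=> d0; apply/negbTE/forallPn; exists (Ordinal d0); rewrite ltxx. Qed.

Lemma prod_expRN (f : 'I_d -> R) :
  \prod_(j < d) expR (- f j) = expR (- \sum_(j < d) f j).
Proof. by rewrite -sumrN expR_sum. Qed.

Lemma hit_prec (x : E) : orthant x -> hit mu (@prec R d) x = expR (- l1norm x).
Proof.
move=> x0; apply: EFin_inj; rewrite -hitE; last exact: measurable_prec.
rewrite (_ : [set z | _] = box (fun j => `]tnth x j, +oo[%classic)).
  rewrite iid_box//; transitivity (\prod_(j < d) (expR (- tnth x j))%:E)%E.
    by apply: eq_bigr => j _; rewrite -(exp1_ray (x0 j)).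
  by rewrite prodEFin prod_expRN l1norm_orthant.
apply/seteqP; split => z /=.
  by move=> /forallP h j; rewrite /= in_itv/= andbT h.
by move=> h; apply/forallP => j; have := h j; rewrite /= in_itv/= andbT.
Qed.

Definition low (b : R) (x : E) : bool := l1norm x <= b.

Lemma measurable_low b : measurable_fun setT (low b).
Proof. by apply: measurable_fun_ler => //; exact: measurable_l1norm. Qed.

(** A low point z that dominates x has |z| - |x| at most s = b - |x|, so each of
its coordinates exceeds that of x by at most s. *)
Lemma hit_low_prec (b : R) (x : E) : orthant x -> low b x ->
  hit_low mu (@prec R d) (low b) x <=
    expR (- l1norm x) * (1 - expR (- (b - l1norm x))) ^+ d.
Proof.
move=> x0 xb; set s := b - l1norm x.
have s0 : 0 <= s by rewrite subr_ge0.
pose I j : set R := `]tnth x j, tnth x j + s]%classic.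
rewrite -lee_fin -hit_lowE; [|exact: measurable_prec|exact: measurable_low].
apply: (@le_trans _ _ (mu (box I))).
  apply: le_measure; rewrite ?inE.
  - apply: measurable_dom_low; [exact: measurable_prec|exact: measurable_low].
  - by apply: measurable_box => j; exact: measurable_itv.
  - move=> z /= /andP[/forallP xz zb] j; rewrite /I /= in_itv/= xz/=.
    have z0 : orthant z by move=> i; rewrite (le_trans (x0 i))// ltW.
    have : \sum_(i < d | i != j) tnth x i <= \sum_(i < d | i != j) tnth z i.
      by apply: ler_sum => i _; exact: ltW.
    move: zb; rewrite /s /low (l1norm_orthant z0) (l1norm_orthant x0).
    have -> : \sum_(i < d) tnth z i = tnth z j + \sum_(i < d | i != j) tnth z i by rewrite (bigD1 j).
    have -> : \sum_(i < d) tnth x i = tnth x j + \sum_(i < d | i != j) tnth x i by rewrite (bigD1 j).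
    lra.
rewrite iid_box => [|j]; last exact: measurable_itv.
rewrite (_ : (\prod_(j < d) _)%E =
    (\prod_(j < d) (expR (- tnth x j) * (1 - expR (- s))))%:E).
  by rewrite big_split/= prod_expRN prodr_const card_ord -l1norm_orthant.
rewrite -prodEFin; apply: eq_bigr => j _; rewrite -[LHS]/(exp1 (I j)) exp1_interval//.
  by rewrite opprD expRD mulrBr mulr1.
by rewrite lerDl.
Qed.

Definition l1dist (x y : E) : R := \sum_(j < d) `|tnth x j - tnth y j|.

(** The probability of dominating both x and y, that is the coordinatewise
maximum: the l1-norm of this maximum is half of |x| + |y| + |x - y|. *)
Definition meet_mass (x y : E) : R :=
  expR (- ((l1norm x + l1norm y + l1dist x y) / 2)).

Lemma hit2_prec (x y : E) : orthant x -> orthant y ->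
  hit2 mu (@prec R d) (x, y) =
    expR (- l1norm x) + expR (- l1norm y) - meet_mass x y.
Proof.
move=> x0 y0; apply: EFin_inj; rewrite -hit2E; last exact: measurable_prec.
have mx := measurable_dom_section (@measurable_prec) x.
have my := measurable_dom_section (@measurable_prec) y.
rewrite (_ : [set z | _] = [set z | prec x z] `|` [set z | prec y z]); last first.
  by apply/seteqP; split => z /= => [/orP[]|[]] -> //; [left|right|rewrite orbT].
rewrite measureUfinr//; last by rewrite -ge0_fin_numE// fin_num_measure.
rewrite !EFinD EFinN -!hit_prec// -!hitE; [|exact: measurable_prec..].
congr (_ + _ - _)%E.
rewrite (_ : _ `&` _ = box (fun j => `]Num.max (tnth x j) (tnth y j), +oo[%classic)).
  transitivity (\prod_(j < d) exp1 `]Num.max (tnth x j) (tnth y j), +oo[%classic)%E.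
    by apply: iid_box.
  transitivity (\prod_(j < d) (expR (- Num.max (tnth x j) (tnth y j)))%:E)%E.
    by apply: eq_bigr => j _; rewrite -exp1_ray// le_max x0.
  rewrite prodEFin prod_expRN /meet_mass (l1norm_orthant x0) (l1norm_orthant y0).
  rewrite /l1dist -!big_split/= mulr_suml; congr (expR (- _))%:E.
  by apply: eq_bigr => j _; rewrite maxr_absE.
apply/seteqP; split => z /=.
  move=> [/forallP xz /forallP yz] j; rewrite /= in_itv/= andbT gt_max.
  by rewrite xz yz.
move=> h; split; apply/forallP => j; have := h j;
  by rewrite /= in_itv/= andbT gt_max => /andP[].
Qed.

Lemma measurable_l1dist d' (T' : measurableType d') (f g : T' -> E) :
  measurable_fun setT f -> measurable_fun setT g ->
  measurable_fun setT (fun p => l1dist (f p) (g p)).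
Proof.
move=> mf mg; apply: measurable_sum => j; apply: measurableT_comp => //.
by apply: measurable_funB; apply: (@measurableT_comp _ _ _ _ _ _ (@tnth d R ^~ j)) => //;
  exact: measurable_tnth.
Qed.

Lemma l1distC x y : l1dist x y = l1dist y x.
Proof. by apply: eq_bigr => j _; rewrite distrC. Qed.

Lemma l1dist_ge0 x y : 0 <= l1dist x y.
Proof. by apply: sumr_ge0 => j _. Qed.

Lemma integral_l1dist (x : E) (c : R) : 0 < c ->
  (\int[mu]_y (expR (l1norm y) * expR (- (c * l1dist x y)))%:E
    <= ((2 / c) ^+ d)%:E)%E.
Proof.
move=> c0.
pose g (j : 'I_d) (r : R) := expR `|r| * expR (- (c * `|r - tnth x j|)).
have mg j : measurable_fun setT (g j).
  apply: measurable_funM; last exact: measurable_laplace.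
  exact: measurableT_comp.
have -> : (\int[mu]_y (expR (l1norm y) * expR (- (c * l1dist x y)))%:E =
    \int[mu]_y (\prod_(j < d) g j (tnth y j))%:E)%E.
  apply: eq_integral => y _; congr EFin.
  rewrite /g big_split/= -expR_sum prod_expRN; congr (_ * expR (- _)).
  by rewrite l1distC /l1dist mulr_sumr.
rewrite integral_iid_prod//; last by move=> j r; rewrite mulr_ge0 ?expR_ge0.
have -> : ((2 / c) ^+ d)%:E = (\prod_(j < d) (2 / c)%:E)%E.
  by rewrite prodEFin prodr_const card_ord.
suff : forall (F G : 'I_d -> \bar R), (forall j, 0 <= F j)%E ->
    (forall j, F j <= G j)%E -> (\prod_(j < d) F j <= \prod_(j < d) G j)%E.
  apply=> j; last exact: integral_laplace.
  by apply: integral_ge0 => r _; rewrite lee_fin mulr_ge0 ?expR_ge0.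
move=> F G F0 FG.
suff /andP[] : (0 <= \prod_(j < d) F j)%E && (\prod_(j < d) F j <= \prod_(j < d) G j)%E by [].
elim/big_rec2 : _ => [|j u v _ /andP[u0 uv]]; first by rewrite lexx lee01.
by rewrite mule_ge0//= lee_pmul.
Qed.

End exponential_orthants.

(** * Integrals of a double exponential of the norm *)

Section doubly_exponential_integrals.
Context {R : realType}.
Notation leb := (@lebesgue_measure R).
Variable a : R.
Hypothesis a0 : 0 < a.

(** With a = n, an upper bound for the probability that a point at norm r
survives n points.  The substitution u = exp(-r) makes [dexp] times the
exponential density an exact derivative, so only the monomial factor of the
gamma density has to be estimated. *)
Definition dexp (r : R) : R := expR (- (a * expR (- r))).

Lemma is_derive_dexp (r : R) :
  is_derive r 1 (fun r => dexp r / a) (dexp r * expR (- r)).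
Proof.
have d1 := is_derive1_comp (is_derive_expR (- r)) (is_deriveNid r 1).
have d2 := is_deriveN (is_deriveZ a d1).
have d3 := is_deriveZ a^-1 (@is_derive1_comp _ expR (- (a \*: (expR \o -%R))) r _ _ (is_derive_expR _) d2).
rewrite (_ : (fun r => _) = a^-1 \*: (expR \o (- (a \*: (expR \o -%R))))); last first.
  by apply/funext => x /=; rewrite /dexp mulrC.
apply: (is_derive_eq d3); rewrite /dexp /GRing.scale /=; field; exact: lt0r_neq0.
Qed.

Lemma continuous_dexp : continuous dexp.
Proof.
move=> x; rewrite /dexp; apply: continuous_comp; last exact: continuous_expR.
apply: (@continuousN _ R^o); apply: (@continuousM _ R^o (fun=> a) (fun r => expR (- r))).
  exact: cst_continuous.
exact: continuous_expRN.
Qed.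

Lemma dexp_ge0 r : 0 <= dexp r. Proof. exact: expR_ge0. Qed.

Lemma integral_dexp (c1 c2 : R) : c1 <= c2 ->
  (\int[leb]_(r in `[c1, c2]) (dexp r * expR (- (r : R)))%:E =
   ((dexp c2 - dexp c1) / a)%:E)%E.
Proof.
rewrite le_eqVlt => /orP[/eqP ->|c12].
  by rewrite set_itv1 integral_set1 subrr mul0r.
rewrite (@continuous_FTC2 _ (fun r => dexp r * expR (- r)) (fun r => dexp r / a) _ _ c12).
- by rewrite -EFinB mulrBl.
- apply: continuous_subspaceT => r; apply: (@continuousM _ R^o dexp (fun r => expR (- r))).
    exact: continuous_dexp.
  exact: continuous_expRN.
- have cF : continuous (fun r => dexp r / a).
    move=> r; apply: (@continuousM _ R^o dexp (fun=> a^-1)); first exact: continuous_dexp.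
    exact: cst_continuous.
  split.
  + by move=> r _; apply: ex_derive; exact: is_derive_dexp.
  + by apply/cvg_at_right_filter; exact: cF.
  + by apply/cvg_at_left_filter; exact: cF.
- move=> r _; rewrite derive1E; apply: derive_val; exact: is_derive_dexp.
Qed.

Variable k : nat.
Notation mu := (iid (@exp1 R) k.+1).

Let measurable_dexp : measurable_fun setT dexp.
Proof. exact: continuous_measurable_fun continuous_dexp. Qed.

Let shell (c1 c2 r : R) : R := (((c1 <= r)%R && (r <= c2)%R) : bool)%:R.

Let measurable_shell c1 c2 : measurable_fun setT (shell c1 c2).
Proof.
apply: (@measurableT_comp _ _ _ _ _ _ (fun b : bool => b%:R : R)) => //.
by apply: measurable_and; exact: measurable_fun_ler.
Qed.

Lemma integral_shell (c1 c2 : R) : 0 <= c1 ->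
  (\int[mu]_y (shell c1 c2 (l1norm y) * dexp (l1norm y))%:E =
   \int[leb]_(r in `[c1, c2])
     ((dexp r * expR (- (r : R)))%:E * ((r : R) ^+ k / k`!%:R)%:E))%E.
Proof.
move=> c10.
rewrite (@l1norm_exp_law R k (fun r => (shell c1 c2 r * dexp r)%:E)); last 2 first.
- by apply/measurable_EFinP; exact: measurable_funM.
- by move=> r; rewrite lee_fin mulr_ge0// dexp_ge0.
rewrite [LHS]integral_mkcond [RHS]integral_mkcond; apply: eq_integral => r _.
rewrite !patchE !mem_setE !in_itv/= andbT /shell.
case: (leP 0 (r : R)) => r0.
  by case: ifP => _; rewrite ?mul0r ?mul0e//= mul1r -!EFinM; congr EFin; ring.
by rewrite (lt_geF (lt_le_trans r0 c10)).
Qed.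

Lemma integral_ball_le (c : R) : 0 <= c ->
  (\int[mu]_y ((l1norm y <= c)%R%:R * dexp (l1norm y))%:E
    <= (c ^+ k / k`!%:R * (dexp c / a))%:E)%E.
Proof.
move=> c0.
have -> : (\int[mu]_y ((l1norm y <= c)%R%:R * dexp (l1norm y))%:E =
    \int[mu]_y (shell 0 c (l1norm y) * dexp (l1norm y))%:E)%E.
  by apply: eq_integral => y _; rewrite /shell l1norm_ge0.
rewrite integral_shell//.
apply: (@le_trans _ _ (\int[leb]_(r in `[0%R, c])
   ((c ^+ k / k`!%:R)%:E * (dexp r * expR (- (r : R)))%:E))%E).
  apply: ge0_le_integral => //.
  - move=> r; rewrite /= in_itv/= => /andP[r0 _].
    by rewrite mule_ge0// lee_fin ?mulr_ge0 ?expR_ge0// exprn_ge0.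
  - apply: measurable_funTS; apply: emeasurable_funM; apply/measurable_EFinP.
      by apply: measurable_funM => //; exact: continuous_measurable_fun continuous_expRN.
    by apply: measurable_funM => //; exact: measurable_funX.
  - apply: measurable_funTS; apply: emeasurable_funM; apply/measurable_EFinP => //.
    by apply: measurable_funM => //; exact: continuous_measurable_fun continuous_expRN.
  - move=> r; rewrite /= in_itv/= => /andP[r0 rc].
    rewrite muleC -!EFinM lee_fin ler_wpM2r ?mulr_ge0 ?expR_ge0//.
    by rewrite ler_wpM2r ?invr_ge0// lerXn2r// nnegrE.
rewrite ge0_integralZl_EFin//; last 3 first.
- by move=> r _; rewrite lee_fin mulr_ge0 ?expR_ge0.
- apply: measurable_funTS; apply/measurable_EFinP.
  by apply: measurable_funM => //; exact: continuous_measurable_fun continuous_expRN.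
- by rewrite divr_ge0// exprn_ge0.
rewrite integral_dexp// -EFinM lee_fin ler_wpM2l ?divr_ge0 ?exprn_ge0//.
by rewrite ler_wpM2r ?invr_ge0 ?(ltW a0)// gerBl dexp_ge0.
Qed.

Lemma integral_shell_ge (c1 c2 : R) : 0 <= c1 -> c1 <= c2 ->
  ((c1 ^+ k / k`!%:R * ((dexp c2 - dexp c1) / a))%:E <=
   \int[mu]_y (((c1 <= l1norm y)%R && (l1norm y <= c2)%R)%:R * dexp (l1norm y))%:E)%E.
Proof.
move=> c10 c12; rewrite [leRHS]integral_shell// EFinM -integral_dexp//.
rewrite -ge0_integralZl_EFin//; last 3 first.
- by move=> r _; rewrite lee_fin mulr_ge0 ?expR_ge0.
- apply: measurable_funTS; apply/measurable_EFinP.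
  by apply: measurable_funM => //; exact: continuous_measurable_fun continuous_expRN.
- by rewrite divr_ge0// exprn_ge0.
apply: ge0_le_integral => //.
- by move=> r _; rewrite mule_ge0// lee_fin ?mulr_ge0 ?invr_ge0 ?exprn_ge0 ?expR_ge0.
- apply: measurable_funTS; apply: emeasurable_funM; apply/measurable_EFinP => //.
  by apply: measurable_funM => //; exact: continuous_measurable_fun continuous_expRN.
- apply: measurable_funTS; apply: emeasurable_funM; apply/measurable_EFinP.
    by apply: measurable_funM => //; exact: continuous_measurable_fun continuous_expRN.
  by apply: measurable_funM => //; exact: measurable_funX.
- move=> r; rewrite /= in_itv/= => /andP[r1 _].
  rewrite muleC -!EFinM lee_fin ler_wpM2l ?mulr_ge0 ?expR_ge0//.
  rewrite ler_wpM2r ?invr_ge0// lerXn2r// nnegrE//; exact: le_trans r1.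
Qed.

End doubly_exponential_integrals.

(** * Real estimates *)

Section real_estimates.
Context {R : realType}.
Implicit Types (n : nat) (A B C M r s : R).
Notation e := (expR 1 : R).

Lemma expR1_ge2 : 2 <= e.
Proof. by have := expR_ge1Dx (1 : R); lra. Qed.

Lemma expRN_le r : 0 <= r <= 1 -> expR (- r) <= 1 - r / 2.
Proof.
move=> /andP[r0 r1]; rewrite expRN -[leLHS]mul1r ler_pdivrMr ?expR_gt0//.
have := expR_ge1Dx r; have : 0 <= 1 - r / 2 by lra.
nra.
Qed.

Lemma expR_le r : 0 <= r <= 1 -> expR r <= 1 + 3 * r.
Proof.
move=> /andP[r0 r1]; set x := expR (- (r / 2)).
have h : 1 - r / 2 <= x by have := expR_ge1Dx (- (r / 2)); rewrite -/x; lra.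
have x0 : 0 < x by exact: expR_gt0.
have -> : expR r = (x ^+ 2)^-1.
  by rewrite -expRM_natl -expRN; congr expR; field.
rewrite -[leLHS]mul1r ler_pdivrMr ?exprn_gt0//.
have h2 : (1 - r / 2) ^+ 2 <= x ^+ 2 by rewrite lerXn2r// nnegrE; lra.
have : (1 + 3 * r) * (1 - r / 2) ^+ 2 <= (1 + 3 * r) * x ^+ 2 by rewrite ler_wpM2l//; lra.
have -> : (1 + 3 * r) * (1 - r / 2) ^+ 2 = 1 + r * ((1 - r) * (2 - 3 / 4 * r)) by field.
have : 0 <= r * ((1 - r) * (2 - 3 / 4 * r)) by rewrite !mulr_ge0//; lra.
lra.
Qed.

Lemma exprn_le_expR n r : 0 <= r -> r ^+ n <= n`!%:R * expR r.
Proof.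
case: n => [|n] r0; first by rewrite expr0 fact0 mul1r -expR0 ler_expR.
have := expR_ge1Dxn n r0; rewrite mulrC => h.
rewrite -ler_pdivrMl ?ltr0n ?fact_gt0//; apply: (le_trans _ h).
by rewrite lerDr.
Qed.

Lemma pow1B_le n A : A <= 1 -> (1 - A) ^+ n <= expR (- (n%:R * A)).
Proof.
move=> A1; rewrite -mulrN expRM_natl lerXn2r ?nnegrE ?subr_ge0 ?expR_ge0//.
exact: expR_ge1Dx.
Qed.

Lemma pow1B_pred_le n A : A <= 1 ->
  (1 - A) ^+ n.-1 <= e * expR (- (n%:R * A)).
Proof.
move=> A1; rewrite (le_trans (pow1B_le _ A1))// -expRD ler_expR.
by case: n => [|n] /=; rewrite ?mul0r -?natr1; lra.
Qed.

Lemma bernoulli n r : -1 <= r -> 1 + n%:R * r <= (1 + r) ^+ n.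
Proof.
move=> r1; elim: n => [|n IH]; first by rewrite mul0r addr0 expr0.
have r10 : 0 <= 1 + r by lra.
rewrite exprSr; apply: (le_trans _ (ler_wpM2r r10 IH)).
by rewrite -natr1; have := ler0n R n; nra.
Qed.

Lemma pow1B_ge n A : 0 <= A <= 1 ->
  (1 - n%:R * A ^+ 2) * expR (- (n%:R * A)) <= (1 - A) ^+ n.
Proof.
move=> /andP[A0 A1].
have h : (1 - A ^+ 2) * expR (- A) <= 1 - A.
  rewrite expRN ler_pdivrMr ?expR_gt0//.
  have := expR_ge1Dx A; have : 0 <= 1 - A by lra.
  nra.
have A20 : 0 <= 1 - A ^+ 2 by nra.
apply: (@le_trans _ _ (((1 - A ^+ 2) * expR (- A)) ^+ n)); last first.
  by rewrite lerXn2r// nnegrE ?mulr_ge0 ?expR_ge0//; lra.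
rewrite exprMn -expRM_natl mulrN ler_wpM2r ?expR_ge0//.
have := @bernoulli n (- A ^+ 2); rewrite mulrN => -> //.
by nra.
Qed.

Lemma pow_sub_le n (u v : R) : 0 <= u -> u <= v ->
  v ^+ n - u ^+ n <= n%:R * (v - u) * v ^+ n.-1.
Proof.
move=> u0 uv; have v0 := le_trans u0 uv.
case: n => [|n]; first by rewrite !expr0 subrr !mul0r.
rewrite subrXX mulrC -mulrA mulrCA [leRHS]mulrC ler_wpM2r ?subr_ge0//=.
apply: (@le_trans _ _ (\sum_(i < n.+1) v ^+ n)).
  apply: ler_sum => i _; rewrite -[in leRHS](subnK (leq_ord i)) exprD.
  by rewrite ler_wpM2l ?exprn_ge0// lerXn2r.
by rewrite sumr_const card_ord mulr_natl.
Qed.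

(** Here s = b - |y|, A is the probability of being dominated, and l and h the
parts of A due to low and to high points.  Two effects compete: low dominators
exist only through a factor s^d, whereas moving away from the edge increases
n h to at least M (1 + s / 2), as 1 - exp(-s) enters with a power d >= 2.  Hence
s^d is absorbed by half of the decay exp(-(M s / 2)), at the price of M^(-d);
the other half is turned into a function of n A that can be integrated
exactly. *)
Lemma clash_le n d M s A l h : (0 < n)%N -> (1 < d)%N -> 0 < M -> 0 <= s <= 1 ->
  n%:R * A = M * expR s -> A <= 1 -> 0 <= l -> 0 <= h -> l + h = A ->
  l <= A * (1 - expR (- s)) ^+ d ->
  l * (1 - h) ^+ n.-1 <=
  e ^+ 2 * M * (d`!%:R * (4 / M) ^+ d) * expR (- (11 / 12 * M)) / n%:R
    * expR (- (1 / 12 * (n%:R * A))).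
Proof.
move=> n0 d1 M0 s01 nA A1 l0 h0 lhA lA; have /andP[s0 s1] := s01.
have n0' : 0 < n%:R :> R by rewrite ltr0n.
set w := 1 - expR (- s) in lA.
have w0 : 0 <= w by rewrite subr_ge0 -expR0 ler_expR oppr_le0.
have ws : w <= s by have := expR_ge1Dx (- s); rewrite /w; lra.
have w1 : w <= 1 by have := expR_ge0 (- s); rewrite /w; lra.
have A0 : 0 <= A by rewrite -(pmulr_rge0 _ n0') nA mulr_ge0 ?expR_ge0// ltW.
have AE : A = M * expR s / n%:R by rewrite -nA mulrC mulKf ?gt_eqF.
have l1 : l <= e * M / n%:R * s ^+ d.
  rewrite (le_trans lA)// ler_pM ?exprn_ge0//; last by rewrite lerXn2r.
  by rewrite AE ler_wpM2r ?invr_ge0 ?(ltW n0')// mulrC ler_wpM2r ?(ltW M0)// ler_expR.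
have wd : w ^+ d <= w ^+ 2 by apply: ler_wiXn2l.
have es : expR s * expR (- s) = 1 by rewrite expRxMexpNx_1.
have h1 : M * (1 + s / 2) <= n%:R * h.
  have hE : A * (1 - w ^+ 2) <= h.
    by have := ler_wpM2l A0 wd; lra.
  have := ler_wpM2l (ltW n0') hE; rewrite mulrA nA.
  have -> : M * expR s * (1 - w ^+ 2) = M * (2 - expR (- s)) * (expR s * expR (- s)).
    by rewrite /w; ring.
  rewrite es mulr1; apply: le_trans; rewrite ler_wpM2l ?(ltW M0)//.
  by have := expRN_le s01; lra.
have h2 : (1 - h) ^+ n.-1 <= e * expR (- (M * (1 + s / 2))).
  rewrite (le_trans (@pow1B_pred_le n h _))//; last by rewrite ler_wpM2l ?expR_ge0// ler_expR lerN2.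
  lra.
(* s^d = (4 / M)^d t^d with t = M s / 4, and t^d <= d! exp t *)
have x4 : s ^+ d * expR (- (M * s / 4)) <= d`!%:R * (4 / M) ^+ d.
  have Ms0 : 0 <= M * s / 4 by rewrite divr_ge0// mulr_ge0// ltW.
  have -> : s ^+ d = (4 / M) ^+ d * (M * s / 4) ^+ d.
    by rewrite -exprMn; congr (_ ^+ _); field; exact: lt0r_neq0.
  rewrite expRN mulrAC -mulrA mulrC ler_wpM2r ?exprn_ge0 ?divr_ge0 ?(ltW M0)//.
  by rewrite ler_pdivrMl ?expR_gt0// [leRHS]mulrC exprn_le_expR.
(* exp s <= 1 + 3 s gives n A / 12 <= M / 12 + M s / 4 *)
have x5 : expR (- (M * s / 4)) <= expR (M / 12) * expR (- (1 / 12 * (n%:R * A))).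
  rewrite -expRD ler_expR nA; have := ler_wpM2l (ltW M0) (expR_le s01); lra.
have -> : e ^+ 2 * M * (d`!%:R * (4 / M) ^+ d) * expR (- (11 / 12 * M)) / n%:R
    * expR (- (1 / 12 * (n%:R * A))) =
  (e * M / n%:R * (d`!%:R * (4 / M) ^+ d)) * (e * expR (- M) *
    (expR (M / 12) * expR (- (1 / 12 * (n%:R * A))))).
  have -> : expR (- (11 / 12 * M)) = expR (- M) * expR (M / 12).
    by rewrite -expRD; congr expR; field.
  by field; exact: lt0r_neq0.
have e0 := expR_ge0 (1 : R); have eM0 := expR_ge0 (- M).
have c0 : 0 <= e * M / n%:R by rewrite !mulr_ge0 ?invr_ge0// ltW.
apply: (@le_trans _ _ ((e * M / n%:R * s ^+ d) * (e * expR (- (M * (1 + s / 2)))))).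
  by apply: ler_pM => //; rewrite exprn_ge0// subr_ge0; lra.
have -> : expR (- (M * (1 + s / 2))) = expR (- M) * (expR (- (M * s / 4)) * expR (- (M * s / 4))).
  by rewrite -!expRD; congr expR; field.
have -> : e * M / n%:R * s ^+ d * (e * (expR (- M) * (expR (- (M * s / 4)) * expR (- (M * s / 4))))) =
  (e * M / n%:R * (s ^+ d * expR (- (M * s / 4)))) * (e * expR (- M) * expR (- (M * s / 4))) by ring.
apply: ler_pM.
- by rewrite mulr_ge0// mulr_ge0 ?exprn_ge0 ?expR_ge0.
- by rewrite !mulr_ge0 ?expR_ge0.
- by rewrite ler_wpM2l.
- by rewrite ler_wpM2l// mulr_ge0.
Qed.

(** Decay, in the separation r of two points, of the excess of the probability
of avoiding both over the product of the two probabilities. *)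
Definition clump M r : R := expR (- (M * r / 2)) + e * M * expR (- (M / 2)) * expR (- r).

Lemma clump_ge0 M r : 0 <= M -> 0 <= clump M r.
Proof. by move=> M0; rewrite addr_ge0 ?expR_ge0// !mulr_ge0 ?expR_ge0. Qed.

(** Here A, B, C are the probabilities of dominating the first point, the second
point and both.  At separation r <= 1 the avoidance probability itself is small:
by n (B - C) >= M (1 - exp(-r)), the second point brings an additional factor
exp(-(M r / 2)).  At larger separation the bases 1 - (A + B - C) and
(1 - A) (1 - B) differ by at most C, which is at most e M exp(-r) / n, and the
remaining n - 1 factors still bring exp(-(M / 2)). *)
Lemma pair_excess_le n A B C M r : 0 < M -> 0 <= r ->
  0 <= A <= 1 -> 0 <= B <= 1 -> 0 <= C -> 0 <= A + B - C <= 1 ->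
  M <= n%:R * A -> M <= n%:R * B -> n%:R * A <= e * M -> n%:R * B <= e * M ->
  C <= Num.max A B * expR (- r) ->
  (1 - (A + B - C)) ^+ n <= ((1 - A) * (1 - B)) ^+ n +
    e * (expR (- (n%:R * A)) + expR (- (n%:R * B))) * clump M r.
Proof.
wlog AB : A B / A <= B.
  move=> H; have [AB|BA] := orP (le_total A B); first exact: H.
  move=> M0 r0 hA hB C0 hC nA nB nA' nB' CAB.
  have := H B A BA M0 r0 hB hA C0; rewrite (addrC B A) maxC (mulrC (1 - B)).
  by rewrite (addrC (expR (- (n%:R * B)))); apply.
move=> M0 r0 /andP[A0 A1] /andP[B0 B1] C0 /andP[D0 D1] nA nB nA' nB'.
rewrite (max_idPr AB) => CB.
have e2 := expR1_ge2; have e0 : 0 <= e by exact: expR_ge0.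
set u := (1 - A) * (1 - B); set v := 1 - (A + B - C).
have u0 : 0 <= u by rewrite mulr_ge0// subr_ge0.
have v0 : 0 <= v by rewrite subr_ge0.
have G0 : 0 <= clump M r by exact: clump_ge0 (ltW M0).
have EA := expR_ge0 (- (n%:R * A)); have EB := expR_ge0 (- (n%:R * B)).
have [vu|uv] := leP v u.
  apply: (@le_trans _ _ (u ^+ n)); first by rewrite lerXn2r.
  by rewrite lerDl mulr_ge0// mulr_ge0// addr_ge0.
have r1e : expR (- r) <= 1 by rewrite -expR0 ler_expR oppr_le0.
have nD : n%:R * A + M * (1 - expR (- r)) <= n%:R * (A + B - C).
  have h1 : M * (1 - expR (- r)) <= n%:R * B * (1 - expR (- r)).
    by rewrite ler_wpM2r// subr_ge0.
  by have := ler_wpM2l (ler0n R n) CB; lra.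
have vn : v ^+ n <= expR (- (n%:R * A)) * expR (- (M * (1 - expR (- r)))).
  rewrite (le_trans (pow1B_le n D1))// -expRD ler_expR; lra.
rewrite -lerBlDl.
(* close points: the avoidance probability itself is small *)
have [rle|rgt] := leP r 1.
  have r01 : 0 <= r <= 1 by rewrite r0.
  apply: (@le_trans _ _ (1 * expR (- (n%:R * A)) * expR (- (M * r / 2)))).
    apply: (@le_trans _ _ (v ^+ n)); first by rewrite gerBl exprn_ge0.
    rewrite (le_trans vn)// mul1r ler_wpM2l// ler_expR lerN2.
    have := ler_wpM2l (ltW M0) (expRN_le r01); lra.
  apply: ler_pM; rewrite ?mul1r ?expR_ge0//.
    have : 0 <= (e - 1) * expR (- (n%:R * A)) by rewrite mulr_ge0//; lra.
    have : 0 <= e * expR (- (n%:R * B)) by rewrite mulr_ge0.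
    lra.
  by rewrite lerDl !mulr_ge0 ?expR_ge0// ltW.
(* distant points: exp(-r) <= 1/2, and the difference of powers is used *)
have v1 : v ^+ n.-1 <= e * (expR (- (n%:R * A)) * expR (- (M / 2))).
  rewrite (le_trans (pow1B_pred_le n D1))// ler_wpM2l// -expRD ler_expR.
  have : expR (- r) <= 1 / 2.
    apply: (@le_trans _ _ (expR (- 1))); first by rewrite ler_expR lerN2 (ltW rgt).
    by rewrite expRN -[leLHS]mul1r ler_pdivrMr ?expR_gt0//; lra.
  by move=> h; have := ler_wpM2l (ltW M0) h; lra.
have vuC : n%:R * (v - u) <= e * M * expR (- r).
  apply: (@le_trans _ _ (n%:R * C)).
    rewrite ler_wpM2l// /v /u; have := mulr_ge0 A0 B0; lra.
  rewrite (le_trans (ler_wpM2l _ CB))// mulrA ler_wpM2r ?expR_ge0//.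
rewrite (le_trans (pow_sub_le n u0 (ltW uv)))//.
apply: (@le_trans _ _ ((e * M * expR (- r)) * (e * (expR (- (n%:R * A)) * expR (- (M / 2)))))).
  by apply: ler_pM => //; rewrite ?exprn_ge0// mulr_ge0// subr_ge0 ltW.
have -> : e * M * expR (- r) * (e * (expR (- (n%:R * A)) * expR (- (M / 2)))) =
  (e * expR (- (n%:R * A))) * (e * M * expR (- (M / 2)) * expR (- r)) by ring.
apply: ler_pM; rewrite ?mulr_ge0 ?expR_ge0 ?(ltW M0)//.
  by rewrite ler_wpM2l// lerDl.
by rewrite lerDr expR_ge0.
Qed.

End real_estimates.

(** * Estimates for the band *)

Section pair_comparison.
Context {disp : measure_display} {T : measurableType disp} {R : realType}.
Variables (P : probability T R) (S : set T).
Hypotheses (mS : measurable S) (PS : P S = 1%E).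

Lemma le_integral_full_rectangle (f g : T * T -> \bar R) :
  measurable_fun setT f -> measurable_fun setT g ->
  (forall p, 0 <= f p)%E -> (forall p, 0 <= g p)%E ->
  (forall x y, S x -> S y -> f (x, y) <= g (x, y))%E ->
  (\int[P \x P]_p f p <= \int[P \x P]_p g p)%E.
Proof.
move=> mf mg f0 g0 fg; rewrite !fubini_tonelli1//.
have msec (h : T * T -> \bar R) x : measurable_fun setT h -> measurable_fun setT (fun y : T => h (x, y)).
  by move=> mh; apply: (measurableT_comp mh); exact: measurable_fun_pair.
apply: (le_integral_full_set mS PS).
- exact: measurable_fun_fubini_tonelli_F.
- exact: measurable_fun_fubini_tonelli_F.
- by move=> x; exact: integral_ge0.
- by move=> x; exact: integral_ge0.
move=> x Sx; apply: (le_integral_full_set mS PS) => //; try exact: msec.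
by move=> y; exact: fg.
Qed.

End pair_comparison.

Section band_estimates.
Context {R : realType}.
Variables (k n : nat) (b : R).
Hypotheses (k0 : (0 < k)%N) (n0 : (0 < n)%N) (b1 : 1 <= b).
Notation d := k.+1.
Notation E := (d.-tuple R).
Notation mu := (iid (@exp1 R) d).
Notation e := (expR 1 : R).
Notation dom := (@prec R d).

(** Width one suffices: below it the survival probability is at most
exp(-(e M)) instead of exp(-M). *)
Definition band (y : E) : bool := (b - 1 <= l1norm y)%R && (l1norm y <= b)%R.

Let M := n%:R * expR (- b).
Let N := b ^+ k / k`!%:R : R.

Let n0R : 0 < n%:R :> R. Proof. by rewrite ltr0n. Qed.
Let M0 : 0 < M. Proof. by rewrite mulr_gt0 ?expR_gt0. Qed.
Let N0 : 0 <= N.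
Proof. by rewrite divr_ge0// exprn_ge0//; exact: le_trans b1. Qed.

Lemma measurable_band : measurable_fun setT band.
Proof. by apply: measurable_and; apply: measurable_fun_ler => //; exact: measurable_l1norm. Qed.

Lemma band_low y : band y -> low b y. Proof. by case/andP. Qed.

Let mlow : measurable_fun setT (@low R d b). Proof. exact: measurable_low. Qed.
Let mdom : measurable_fun setT (fun p : E * E => dom p.1 p.2). Proof. exact: measurable_prec. Qed.
Let mhit : measurable_fun setT (hit mu dom). Proof. exact: measurable_hit. Qed.

Let measurable_ind (p : E -> bool) : measurable_fun setT p ->
  measurable_fun setT (fun y => (p y)%:R : R).
Proof. exact: measurable_nat_of_bool. Qed.

Let measurable_dexp_norm a : measurable_fun setT (fun y : E => dexp a (l1norm y)).
Proof.
apply: measurableT_comp; last exact: measurable_l1norm.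
exact: (continuous_measurable_fun (@continuous_dexp R a)).
Qed.

Let measurable_ball c : measurable_fun setT (fun y : E => ((l1norm y <= c)%R)%:R : R).
Proof. by apply: measurable_ind; apply: measurable_fun_ler => //; exact: measurable_l1norm. Qed.

Let expRN_le1 (y : E) : expR (- l1norm y) <= 1.
Proof. by rewrite -expR0 ler_expR oppr_le0 l1norm_ge0. Qed.

Lemma off_band_le :
  (\int[mu]_y ((low b y && ~~ band y)%:R * (1 - hit mu dom y) ^+ n.-1)%:E
   <= (e * N * expR (- (e * M)) / n%:R)%:E)%E.
Proof.
have mf1 : measurable_fun setT (fun y : E => (low b y && ~~ band y)%:R : R).
  apply: measurable_ind; apply: measurable_and => //; apply: measurable_neg.
  exact: measurable_band.
have mg : measurable_fun setT (fun y : E => (l1norm y <= b - 1)%R%:R * dexp n%:R (l1norm y)).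
  exact: measurable_funM.
apply: (@le_trans _ _ (\int[mu]_y (e%:E * ((l1norm y <= b - 1)%R%:R * dexp n%:R (l1norm y))%:E))%E).
  apply: (le_integral_full_set (@measurable_orthant R d) (@orthant1 R d)).
  - apply/measurable_EFinP; apply: measurable_funM => //; apply: measurable_funX.
    exact: measurable_funB.
  - by apply: measurable_funeM; exact/measurable_EFinP.
  - by move=> y; rewrite lee_fin mulr_ge0// exprn_ge0// subr_ge0 hit_le1.
  - by move=> y; rewrite mule_ge0// lee_fin ?expR_ge0// mulr_ge0// dexp_ge0.
  - move=> y y0; rewrite -EFinM lee_fin hit_prec// /low /band.
    have [yb|yb] := boolP ((l1norm y <= b) && ~~ ((b - 1 <= l1norm y) && (l1norm y <= b))); last first.
      by rewrite mul0r !mulr_ge0 ?expR_ge0.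
    move: yb; rewrite negb_and => /andP[-> /orP[yb|//]].
    rewrite -ltNge in yb; rewrite (ltW yb) !mul1r /dexp.
    exact: pow1B_pred_le.
rewrite ge0_integralZl_EFin ?expR_ge0//; last 2 first.
- by move=> y _; rewrite lee_fin mulr_ge0// dexp_ge0.
- exact/measurable_EFinP.
have b10 : 0 <= b - 1 by rewrite subr_ge0.
apply: (@le_trans _ _ (e%:E * ((b - 1) ^+ k / k`!%:R * (dexp n%:R (b - 1) / n%:R))%:E)%E).
  by rewrite lee_pmul2l ?lte_fin ?expR_gt0//; exact: integral_ball_le.
rewrite -EFinM lee_fin.
have -> : dexp n%:R (b - 1) = expR (- (e * M)).
  by rewrite /dexp /M mulrCA -expRD; congr (expR (- (_ * expR _))); ring.
rewrite -[leRHS]mulrA -[leRHS]mulrA ler_wpM2l ?expR_ge0// /N.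
rewrite ler_wpM2r ?divr_ge0 ?expR_ge0// ler_wpM2r ?invr_ge0//.
by apply: lerXn2r; rewrite ?nnegrE//; lra.
Qed.

(** The tail of the gamma law, by an exponential moment: any exponent above 1/2
makes n times the square of the mass tend to 0, and 2/3 leaves the moment
finite, since it amounts to [integral_l1dist] around the origin with rate
1/3. *)
Lemma near_mass_le :
  fine (mu [set x | near (low b) band x]) <= 6 ^+ d * expR (- (2 / 3 * (b - 1))).
Proof.
pose z : E := [tuple 0 | j < d].
have zy y : l1dist z y = l1norm y.
  by apply: eq_bigr => j _; rewrite tnth_mktuple sub0r normrN.
have mN : measurable [set x | near (low b) band x].
  apply: measurable_pred_set; apply: measurable_near => //; exact: measurable_band.
have mi : measurable_fun setT (fun y => (expR (l1norm y) * expR (- (1 / 3 * l1dist z y)))).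
  apply: measurable_funM.
    by apply: measurableT_comp => //; exact: measurable_l1norm.
  apply: measurableT_comp => //; apply: measurable_funN; apply: measurable_funM => //.
  exact: measurable_l1dist.
rewrite -lee_fin fineK ?fin_num_measure// -(setIT [set x | _]) -integral_indic//.
apply: (@le_trans _ _ (\int[mu]_y ((expR (- (2 / 3 * (b - 1))))%:E *
    (expR (l1norm y) * expR (- (1 / 3 * l1dist z y)))%:E))%E).
  apply: ge0_le_integral => //.
  - exact/measurable_EFinP.
  - by apply: measurable_funeM; exact/measurable_EFinP.
  - move=> y _; rewrite indicE (_ : (y \in _) = near (low b) band y); last first.
      by apply/idP/idP; rewrite inE.
    rewrite zy -EFinM lee_fin -!expRD.
    have [h|_] := boolP (near (low b) band y); last exact: expR_ge0.
    rewrite -[leLHS]/(1 : R) -[leLHS]expR0 ler_expR.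
    have : b - 1 <= l1norm y.
      case/orP: h => [/andP[]//|]; rewrite /low -ltNge => h; lra.
    lra.
rewrite ge0_integralZl_EFin ?expR_ge0//; last exact/measurable_EFinP.
rewrite [leRHS]EFinM [leRHS]muleC lee_pmul2l ?lte_fin ?expR_gt0//.
rewrite (le_trans (integral_l1dist _ _))// lee_fin.
by rewrite le_eqVlt; apply/orP; left; apply/eqP; congr (_ ^+ _); field.
Qed.

Lemma exp_band y : band y -> M <= n%:R * expR (- l1norm y) <= e * M.
Proof.
move=> /andP[y1 y2]; rewrite ler_wpM2l ?ler_expR ?lerN2//=.
by rewrite /M mulrCA ler_wpM2l// -expRD ler_expR; lra.
Qed.

Lemma integral_clash_le :
  (\int[mu]_y (clash mu dom (low b) band n y)%:E <=
   (12 * e ^+ 2 * M * (d`!%:R * (4 / M) ^+ d) * N * expR (- M) / n%:R ^+ 2)%:E)%E.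
Proof.
pose c3 := e ^+ 2 * M * (d`!%:R * (4 / M) ^+ d) * expR (- (11 / 12 * M)) / n%:R.
have c30 : 0 <= c3.
  by rewrite /c3 !mulr_ge0 ?exprn_ge0 ?expR_ge0 ?divr_ge0 ?invr_ge0 ?(ltW M0)//;
    rewrite ?mulr_ge0 ?invr_ge0 ?(ltW M0).
have a0 : 0 < n%:R / 12 :> R by rewrite divr_gt0.
have mg : measurable_fun setT (fun y : E => (l1norm y <= b)%R%:R * dexp (n%:R / 12) (l1norm y)).
  exact: measurable_funM.
(* the rate n / 12 and the exponent 11 / 12 are those of [clash_le] *)
apply: (@le_trans _ _ (\int[mu]_y (c3%:E * ((l1norm y <= b)%R%:R * dexp (n%:R / 12) (l1norm y))%:E))%E).
  apply: (le_integral_full_set (@measurable_orthant R d) (@orthant1 R d)).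
  - by apply/measurable_EFinP; apply: measurable_clash => //; exact: measurable_band.
  - by apply: measurable_funeM; exact/measurable_EFinP.
  - by move=> y; rewrite lee_fin clash_ge0.
  - by move=> y; rewrite mule_ge0// lee_fin// mulr_ge0// dexp_ge0.
  - move=> y y0; rewrite -EFinM lee_fin /clash.
    have [yb|_] := boolP (band y); last by rewrite !mul0r mulr_ge0// mulr_ge0// dexp_ge0.
    have /andP[yb1 yb2] := yb; rewrite yb2 !mul1r.
    have -> : dexp (n%:R / 12) (l1norm y) = expR (- (1 / 12 * (n%:R * expR (- l1norm y)))).
      by rewrite /dexp; congr expR; field.
    have hs : hit_low mu dom (low b) y + hit_high mu dom (low b) y = expR (- l1norm y).
      by rewrite -hit_split// hit_prec.
    apply: (@clash_le _ n d M (b - l1norm y)) => //.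
    + by rewrite subr_ge0 yb2/=; lra.
    + by rewrite /M -mulrA -expRD; congr (_ * expR _); ring.
    + exact: hit_low_ge0.
    + exact: hit_high_ge0.
    + exact: hit_low_prec.
rewrite ge0_integralZl_EFin//; last 2 first.
- by move=> y _; rewrite lee_fin mulr_ge0// dexp_ge0.
- exact/measurable_EFinP.
have b0 : 0 <= b by exact: le_trans b1.
apply: (@le_trans _ _ (c3%:E * (b ^+ k / k`!%:R * (dexp (n%:R / 12) b / (n%:R / 12)))%:E)%E).
  by apply: lee_wpmul2l => //; exact: integral_ball_le.
rewrite -EFinM lee_fin le_eqVlt; apply/orP; left; apply/eqP.
have -> : dexp (n%:R / 12) b = expR (- (M / 12)).
  by rewrite /dexp /M; congr expR; field.
have -> : expR (- M) = expR (- (11 / 12 * M)) * expR (- (M / 12)).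
  by rewrite -expRD; congr expR; field.
rewrite /c3 /N; move: (expR (- (11 / 12 * M))) (expR (- (M / 12))) (_ ^+ d) => u v w.
by field; rewrite !gt_eqF// ltr0n fact_gt0.
Qed.

(** The mean of [free_mass], the success probability of the binomial law. *)
Definition band_mean : R :=
  fine (\int[mu]_y ((band y)%:R * (1 - hit mu dom y) ^+ n)%:E)%E.

Let mfree : measurable_fun setT (fun y => (band y)%:R * (1 - hit mu dom y) ^+ n).
Proof.
apply: measurable_funM; first by apply: measurable_ind; exact: measurable_band.
by apply: measurable_funX; exact: measurable_funB.
Qed.

Let free0 y : 0 <= (band y)%:R * (1 - hit mu dom y) ^+ n.
Proof. by rewrite mulr_ge0// exprn_ge0// subr_ge0 hit_le1. Qed.

Let mg : measurable_fun setT (fun y : E => (l1norm y <= b)%R%:R * dexp n%:R (l1norm y)).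
Proof. exact: measurable_funM. Qed.

Let free_le :
  (\int[mu]_y ((band y)%:R * (1 - hit mu dom y) ^+ n)%:E <= (N * expR (- M) / n%:R)%:E)%E.
Proof.
apply: (@le_trans _ _ (\int[mu]_y ((l1norm y <= b)%R%:R * dexp n%:R (l1norm y))%:E)%E).
  apply: (le_integral_full_set (@measurable_orthant R d) (@orthant1 R d)).
  - exact/measurable_EFinP.
  - exact/measurable_EFinP.
  - by move=> y; rewrite lee_fin.
  - by move=> y; rewrite lee_fin mulr_ge0// dexp_ge0.
  - move=> y y0; rewrite lee_fin hit_prec//.
    have [/andP[_ ->]|_] := boolP (band y); last by rewrite mul0r mulr_ge0// dexp_ge0.
    by rewrite !mul1r; exact: pow1B_le.
have b0 : 0 <= b by exact: le_trans b1.
by rewrite (le_trans (integral_ball_le _ _ _))// lee_fin mulrA.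
Qed.

Lemma band_meanE :
  (\int[mu]_y ((band y)%:R * (1 - hit mu dom y) ^+ n)%:E = band_mean%:E)%E.
Proof.
rewrite /band_mean fineK// ge0_fin_numE; last by apply: integral_ge0 => y _; rewrite lee_fin.
exact: le_lt_trans free_le (ltry _).
Qed.

Lemma band_mean_le : band_mean <= N * expR (- M) / n%:R.
Proof. by rewrite -lee_fin -band_meanE. Qed.

Lemma band_mean_ge0 : 0 <= band_mean.
Proof. by rewrite /band_mean fine_ge0//; apply: integral_ge0 => y _; rewrite lee_fin. Qed.

Lemma band_mean_ge : (e * M) ^+ 2 <= n%:R ->
  (1 - (e * M) ^+ 2 / n%:R) *
    ((b - 1) ^+ k / k`!%:R * ((expR (- M) - expR (- (e * M))) / n%:R)) <= band_mean.
Proof.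
move=> eMn; have b10 : 0 <= b - 1 by rewrite subr_ge0.
have bb : b - 1 <= b by lra.
have c0 : 0 <= 1 - (e * M) ^+ 2 / n%:R by rewrite subr_ge0 ler_pdivrMr// mul1r.
rewrite -lee_fin -band_meanE EFinM.
have := integral_shell_ge n0R k b10 bb.
have -> : dexp n%:R b = expR (- M) by [].
have -> : dexp n%:R (b - 1) = expR (- (e * M)).
  by rewrite /dexp /M mulrCA -expRD; congr (expR (- (_ * expR _))); ring.
move=> h; apply: (le_trans (lee_wpmul2l _ h)); first by rewrite lee_fin.
have ms : measurable_fun setT (fun y : E => ((b - 1 <= l1norm y)%R && (l1norm y <= b)%R)%:R * dexp n%:R (l1norm y)).
  by apply: measurable_funM => //; exact: (measurable_ind measurable_band).
rewrite -ge0_integralZl_EFin//; last 2 first.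
- by move=> y _; rewrite lee_fin mulr_ge0// dexp_ge0.
- exact/measurable_EFinP.
apply: (le_integral_full_set (@measurable_orthant R d) (@orthant1 R d)).
- by apply: measurable_funeM; exact/measurable_EFinP.
- exact/measurable_EFinP.
- by move=> y; rewrite mule_ge0// lee_fin// mulr_ge0// dexp_ge0.
- by move=> y; rewrite lee_fin.
move=> y y0; rewrite -EFinM lee_fin hit_prec// -/(band y).
have [yb|_] := boolP (band y); last by rewrite !mul0r mulr0.
rewrite !mul1r; have A01 : 0 <= expR (- l1norm y) <= 1 by rewrite expR_ge0 expRN_le1.
apply: le_trans (pow1B_ge n A01); rewrite ler_wpM2r ?expR_ge0//.
have /andP[_ hA] := exp_band yb; rewrite lerD2l lerN2 ler_pdivlMr//.
rewrite (_ : _ * _ * _ = (n%:R * expR (- l1norm y)) ^+ 2); last by ring.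
by rewrite lerXn2r// nnegrE mulr_ge0 ?expR_ge0// ltW.
Qed.

(** A bound for the mass of the band within correlation range of a given
point. *)
Let V := e * M / n%:R * ((8 / M) ^+ d + e * M * expR (- (M / 2)) * 4 ^+ d).

Let measurable_clump (x : E) :
  measurable_fun setT (fun y => clump M (l1dist x y / 2)).
Proof.
have mr : measurable_fun setT (fun y : E => l1dist x y / 2).
  by apply: measurable_funM => //; exact: measurable_l1dist.
apply: measurable_funD.
  apply: measurableT_comp => //; apply: measurable_funN; apply: measurable_funM => //.
  exact: measurable_funM.
apply: measurable_funM => //; apply: measurableT_comp => //; exact: measurable_funN.
Qed.

(** On the band, 1 <= (e M / n) exp |y|; inserting this factor reduces both terms
of [clump] to [integral_l1dist]. *)
Lemma integral_clump_le (x : E) :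
  (\int[mu]_y ((band y)%:R * clump M (l1dist x y / 2))%:E <= V%:E)%E.
Proof.
have eM0 : 0 <= e * M / n%:R by rewrite !mulr_ge0 ?expR_ge0 ?invr_ge0 ?(ltW M0).
have eM1 : 0 <= e * M * expR (- (M / 2)) by rewrite !mulr_ge0 ?expR_ge0 ?(ltW M0).
have me c : measurable_fun setT (fun y => expR (l1norm y) * expR (- (c * l1dist x y))).
  apply: measurable_funM.
    by apply: measurableT_comp => //; exact: measurable_l1norm.
  apply: measurableT_comp => //; apply: measurable_funN; apply: measurable_funM => //.
  exact: measurable_l1dist.
have e0 c y : 0 <= expR (l1norm y) * expR (- (c * l1dist x y)).
  by rewrite mulr_ge0 ?expR_ge0.
apply: (@le_trans _ _ (\int[mu]_y ((e * M / n%:R)%:E *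
   ((expR (l1norm y) * expR (- (M / 4 * l1dist x y)))%:E +
    (e * M * expR (- (M / 2)))%:E * (expR (l1norm y) * expR (- (1 / 2 * l1dist x y)))%:E)))%E).
  apply: ge0_le_integral => //.
  - by move=> y _; rewrite lee_fin mulr_ge0// clump_ge0// ltW.
  - apply/measurable_EFinP; apply: measurable_funM => //.
    exact: (measurable_ind measurable_band).
  - apply: measurable_funeM; apply: emeasurable_funD; first exact/measurable_EFinP.
    by apply: measurable_funeM; exact/measurable_EFinP.
  - move=> y _; rewrite -[X in (_ <= X)%E]/((e * M / n%:R *
      (expR (l1norm y) * expR (- (M / 4 * l1dist x y)) + e * M * expR (- (M / 2)) *
        (expR (l1norm y) * expR (- (1 / 2 * l1dist x y)))))%:E) lee_fin.
    have [yb|_] := boolP (band y); last first.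
      by rewrite mul0r mulr_ge0// addr_ge0// mulr_ge0.
    have h : 1 <= e * M / n%:R * expR (l1norm y).
      have /andP[h _] := exp_band yb.
      have /andP[_ yb2] := yb; have /andP[yb1 _] := yb.
      rewrite /M (_ : e * _ / _ * _ = e * (expR (- b) * expR (l1norm y))); last first.
        by field; rewrite gt_eqF.
      rewrite -!expRD -[leLHS]expR0 ler_expR; lra.
    rewrite -[true%:R]/(1 : R) [leLHS]mul1r /clump.
    rewrite (_ : M * (l1dist x y / 2) / 2 = M / 4 * l1dist x y); last by field.
    rewrite (_ : l1dist x y / 2 = 1 / 2 * l1dist x y); last by field.
    move: h; set u := expR (- (M / 4 * _)); set v := expR (- (1 / 2 * _)).
    set w := expR (l1norm y) => h.
    rewrite (_ : _ * (w * u + _) = (e * M / n%:R * w) * (u + e * M * expR (- (M / 2)) * v)); last by ring.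
    by rewrite ler_peMl// addr_ge0 ?expR_ge0// mulr_ge0 ?expR_ge0.
rewrite ge0_integralZl_EFin//; last 2 first.
- by move=> y _; rewrite adde_ge0// mule_ge0// lee_fin.
- apply: emeasurable_funD; first exact/measurable_EFinP.
  by apply: measurable_funeM; exact/measurable_EFinP.
rewrite [leRHS](EFinM (e * M / n%:R)); apply: lee_wpmul2l; first by rewrite lee_fin.
rewrite ge0_integralD//; last 3 first.
- exact/measurable_EFinP.
- by move=> y _; rewrite mule_ge0// lee_fin.
- by apply: measurable_funeM; exact/measurable_EFinP.
rewrite EFinD; apply: leeD.
  rewrite (le_trans (integral_l1dist _ _)) ?divr_gt0// lee_fin.
  rewrite le_eqVlt; apply/orP; left; apply/eqP; congr (_ ^+ _).
  by field; rewrite gt_eqF.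
rewrite ge0_integralZl_EFin//; last exact/measurable_EFinP.
rewrite [leRHS]EFinM; apply: lee_wpmul2l; first by rewrite lee_fin.
rewrite (le_trans (integral_l1dist _ _))// lee_fin.
by rewrite le_eqVlt; apply/orP; left; apply/eqP; congr (_ ^+ _); field.
Qed.

(** Half of the bound of [pair_excess_le]: the survival probability of the first
point times the decay in the separation.  The other half exchanges the two
points. *)
Let W (x y : E) : R :=
  (l1norm x <= b)%R%:R * dexp n%:R (l1norm x) * ((band y)%:R * clump M (l1dist x y / 2)).

Let W0 x y : 0 <= W x y.
Proof. by rewrite !mulr_ge0 ?dexp_ge0 ?clump_ge0 ?(ltW M0). Qed.

Let mW d' (T' : measurableType d') (f g : T' -> E) : measurable_fun setT f ->
  measurable_fun setT g -> measurable_fun setT (fun p => W (f p) (g p)).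
Proof.
move=> mf mg'; apply: measurable_funM; first exact: (measurableT_comp mg mf).
apply: measurable_funM; first exact: (measurableT_comp (measurable_ind measurable_band) mg').
have mr : measurable_fun setT (fun p => l1dist (f p) (g p) / 2).
  by apply: measurable_funM => //; exact: measurable_l1dist.
apply: measurable_funD.
  apply: measurableT_comp => //; apply: measurable_funN; apply: measurable_funM => //.
  exact: measurable_funM.
apply: measurable_funM => //; apply: measurableT_comp => //; exact: measurable_funN.
Qed.

Let V0 : 0 <= V.
Proof.
have eM0 : 0 <= e * M by rewrite mulr_ge0 ?expR_ge0 ?(ltW M0).
rewrite mulr_ge0 ?divr_ge0// addr_ge0// ?exprn_ge0 ?divr_ge0 ?(ltW M0)//.
by rewrite mulr_ge0 ?exprn_ge0// mulr_ge0 ?expR_ge0.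
Qed.

Let integral_W_le : (\int[mu]_x \int[mu]_y (W x y)%:E <= (N * expR (- M) / n%:R * V)%:E)%E.
Proof.
apply: (@le_trans _ _ (\int[mu]_x (V%:E * ((l1norm x <= b)%R%:R * dexp n%:R (l1norm x))%:E))%E).
  apply: ge0_le_integral => //.
  - by move=> x _; apply: integral_ge0 => y _; rewrite lee_fin.
  - apply: (@measurable_fun_fubini_tonelli_F _ _ _ _ _ _ (fun p => (W p.1 p.2)%:E)).
      by apply/measurable_EFinP; exact: mW.
    by move=> p; rewrite lee_fin.
  - by apply: measurable_funeM; exact/measurable_EFinP.
  - move=> x _; rewrite /W.
    under eq_integral do rewrite EFinM.
    rewrite ge0_integralZl_EFin//.
    + by rewrite muleC lee_wpmul2r// ?lee_fin ?mulr_ge0 ?dexp_ge0//; exact: integral_clump_le.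
    + by move=> y _; rewrite lee_fin mulr_ge0// clump_ge0// ltW.
    + apply/measurable_EFinP; apply: measurable_funM => //.
      exact: (measurable_ind measurable_band).
    + by rewrite mulr_ge0// dexp_ge0.
rewrite ge0_integralZl_EFin//; last 2 first.
- by move=> y; rewrite lee_fin mulr_ge0// dexp_ge0.
- exact/measurable_EFinP.
rewrite [leRHS]EFinM [leRHS]muleC; apply: lee_wpmul2l; first by rewrite lee_fin.
have b0 : 0 <= b by exact: le_trans b1.
by rewrite (le_trans (integral_ball_le _ _ _))// lee_fin mulrA.
Qed.

Let meet_mass_le (x y : E) :
  meet_mass x y <= Num.max (expR (- l1norm x)) (expR (- l1norm y)) * expR (- (l1dist x y / 2)).
Proof.
rewrite /meet_mass (_ : - _ = - ((l1norm x + l1norm y) / 2) + - (l1dist x y / 2)); last by field.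
rewrite expRD ler_wpM2r ?expR_ge0// le_max !ler_expR.
by have [h|h] := orP (le_total (l1norm x) (l1norm y)); apply/orP; [left|right]; lra.
Qed.

Let mhit2 : measurable_fun setT (hit2 mu dom).
Proof.
apply: measurableT_comp => //.
apply: (measurable_section_measurel mu
  (S := [set q : (E * E) * E | dom q.1.1 q.2 || dom q.1.2 q.2])).
apply: measurable_pred_set; apply: measurable_or.
  apply: (@measurableT_comp _ _ _ _ _ _ (fun p : E * E => dom p.1 p.2) _
    (fun q : (E * E) * E => (q.1.1, q.2))) => //.
  by apply: measurable_fun_pair => //; exact: measurableT_comp.
apply: (@measurableT_comp _ _ _ _ _ _ (fun p : E * E => dom p.1 p.2) _
  (fun q : (E * E) * E => (q.1.2, q.2))) => //.
by apply: measurable_fun_pair => //; exact: measurableT_comp.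
Qed.

Let hit2_01 p : 0 <= hit2 mu dom p <= 1.
Proof.
rewrite -!lee_fin -hit2E// measure_ge0 probability_le1//.
exact: measurable_dom_or.
Qed.

Lemma second_moment_le :
  (\int[mu \x mu]_p ((band p.1 && band p.2)%:R * (1 - hit2 mu dom p) ^+ n)%:E
   <= (band_mean ^+ 2 + 2 * e * (N * expR (- M) / n%:R * V))%:E)%E.
Proof.
pose f y := (band y)%:R * (1 - hit mu dom y) ^+ n.
have m1 : measurable_fun setT (fun p : E * E => f p.1) by apply: (measurableT_comp mfree).
have m2 : measurable_fun setT (fun p : E * E => f p.2) by apply: (measurableT_comp mfree).
have mF : measurable_fun setT (fun p : E * E => (f p.1 * f p.2)%:E).
  by apply/measurable_EFinP; exact: (measurable_funM m1 m2).
have mWp : measurable_fun setT (fun p : E * E => (W p.1 p.2)%:E).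
  by apply/measurable_EFinP; exact: mW.
have mWp' : measurable_fun setT (fun p : E * E => (W p.2 p.1)%:E).
  by apply/measurable_EFinP; exact: mW.
have mWW : measurable_fun setT (fun p : E * E => e%:E * ((W p.1 p.2)%:E + (W p.2 p.1)%:E))%E.
  by apply: measurable_funeM; exact: emeasurable_funD.
have f0 y : 0 <= f y by exact: free0.
have mfE : measurable_fun setT (fun y => (f y)%:E) by apply/measurable_EFinP; exact: mfree.
apply: (@le_trans _ _ (\int[mu \x mu]_p ((f p.1 * f p.2)%:E +
    e%:E * ((W p.1 p.2)%:E + (W p.2 p.1)%:E)))%E).
  apply: (le_integral_full_rectangle (@measurable_orthant R d) (@orthant1 R d)).
  - apply/measurable_EFinP; apply: measurable_funM.
      apply: measurable_nat_of_bool; apply: measurable_and.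
        exact: (measurableT_comp measurable_band).
      exact: (measurableT_comp measurable_band).
    by apply: measurable_funX; exact: measurable_funB.
  - exact: emeasurable_funD.
  - move=> p; rewrite lee_fin mulr_ge0// exprn_ge0// subr_ge0.
    by have /andP[] := hit2_01 p.
  - move=> p; apply: adde_ge0; first by rewrite lee_fin mulr_ge0.
    rewrite -[leRHS]/((e * (W p.1 p.2 + W p.2 p.1))%:E) lee_fin.
    by rewrite mulr_ge0 ?expR_ge0// addr_ge0.
  - move=> x y x0 y0.
    rewrite -[leLHS]/(((band x && band y)%:R * (1 - hit2 mu dom (x, y)) ^+ n)%:E).
    rewrite -[leRHS]/((f x * f y + e * (W x y + W y x))%:E) lee_fin.
    have r0 : 0 <= f x * f y + e * (W x y + W y x).
      apply: addr_ge0; first exact: mulr_ge0.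
      by apply: mulr_ge0; [exact: expR_ge0|exact: addr_ge0].
    have [xb|_] := boolP (band x); last first.
      by rewrite [leLHS]mul0r.
    have [yb|_] := boolP (band y); last first.
      by rewrite [leLHS]mul0r.
    have /andP[_ xb2] := xb; have /andP[_ yb2] := yb.
    rewrite /f /W xb yb xb2 yb2 !mul1r !hit_prec// (l1distC y x) hit2_prec//.
    have h2 := hit2_01 (x, y); rewrite hit2_prec// in h2.
    have /andP[nA nA'] := exp_band xb; have /andP[nB nB'] := exp_band yb.
    rewrite -exprMn -mulrDl mulrA; apply: pair_excess_le => //.
    + by rewrite divr_ge0// l1dist_ge0.
    + by rewrite expR_ge0 expRN_le1.
    + by rewrite expR_ge0 expRN_le1.
    + exact: expR_ge0.
rewrite ge0_integralD//; last 2 first.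
- by move=> p _; rewrite lee_fin mulr_ge0.
- move=> p _; rewrite -[leRHS]/((e * (W p.1 p.2 + W p.2 p.1))%:E) lee_fin.
  by rewrite mulr_ge0 ?expR_ge0// addr_ge0.
rewrite EFinD; apply: leeD.
  rewrite fubini_tonelli1//; last by move=> p; rewrite lee_fin mulr_ge0.
  have inner x : (\int[mu]_y (f x * f y)%:E = (f x)%:E * band_mean%:E)%E.
    under eq_integral do rewrite EFinM.
    rewrite ge0_integralZl_EFin//; last by move=> y _; rewrite lee_fin.
    by rewrite band_meanE.
  rewrite (_ : integral _ _ _ = (\int[mu]_x ((f x)%:E * band_mean%:E))%E); last first.
    by apply: eq_integral => x _; rewrite -inner.
  rewrite ge0_integralZr//; last 2 first.
  - by move=> y _; rewrite lee_fin.
  - by rewrite lee_fin band_mean_ge0.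
  by rewrite band_meanE -EFinM expr2.
rewrite ge0_integralZl_EFin ?expR_ge0//; last 2 first.
- by move=> p _; rewrite -[leRHS]/((W p.1 p.2 + W p.2 p.1)%:E) lee_fin addr_ge0.
- exact: emeasurable_funD.
rewrite [X in (_ <= X%:E)%E](_ : _ = e * (N * expR (- M) / n%:R * V + N * expR (- M) / n%:R * V)); last by ring.
rewrite EFinM; apply: lee_wpmul2l; first by rewrite lee_fin expR_ge0.
rewrite ge0_integralD//; last 2 first.
- by move=> p _; rewrite lee_fin.
- by move=> p _; rewrite lee_fin.
rewrite EFinD; apply: leeD.
  have -> : (\int[mu \x mu]_p (W p.1 p.2)%:E = \int[mu]_x \int[mu]_y (W x y)%:E)%E.
    apply: (fubini_tonelli1 _ mWp).
    by move=> p; rewrite lee_fin.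
  exact: integral_W_le.
have -> : (\int[mu \x mu]_p (W p.2 p.1)%:E = \int[mu]_x \int[mu]_y (W x y)%:E)%E.
  apply: (fubini_tonelli2 _ mWp').
  by move=> p; rewrite lee_fin.
exact: integral_W_le.
Qed.

End band_estimates.

(** * Poisson approximation of the number of low maxima *)

Section low_maxima_poisson.
Context {R : realType}.
Variables (k n : nat) (b l : R).
Hypotheses (k0 : (0 < k)%N) (n0 : (0 < n)%N) (b1 : 1 <= b).
Notation d := k.+1.
Notation mu := (iid (@exp1 R) d).
Notation e := (expR 1 : R).
Notation dom := (@prec R d).

Let M := n%:R * expR (- b).
Let N := b ^+ k / k`!%:R : R.

Hypotheses (l_in : 0 < l <= n%:R) (Nl : N * expR (- M) <= l)
  (Mn : (e * M) ^+ 2 <= n%:R).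

(** In order: maxima outside the band, indices carrying near-edge points in both
samples, low dominators, variance of the success probability, distance of its
mean to l / n, and Poisson approximation of the binomial law. *)
Definition approximation_error : R :=
  e * N * expR (- (e * M)) +
  n%:R * (6 ^+ d * expR (- (2 / 3 * (b - 1)))) ^+ 2 +
  24 * e ^+ 2 * M * (d`!%:R * (4 / M) ^+ d) * (N * expR (- M)) +
  4 * e ^+ 2 * M * ((8 / M) ^+ d + e * M * expR (- (M / 2)) * 4 ^+ d) * (N * expR (- M)) +
  (l - (1 - (e * M) ^+ 2 / n%:R) *
    ((b - 1) ^+ k / k`!%:R * (expR (- M) - expR (- (e * M))))) +
  l ^+ 2 / n%:R.

Let n0R : 0 < n%:R :> R. Proof. by rewrite ltr0n. Qed.
Let nn : n%:R != 0 :> R. Proof. by rewrite gt_eqF. Qed.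

Let mlow : measurable_fun setT (@low R d b). Proof. exact: measurable_low. Qed.
Let mdom : measurable_fun setT (fun p : d.-tuple R * d.-tuple R => dom p.1 p.2).
Proof. exact: measurable_prec. Qed.
Let mband : measurable_fun setT (@band R k b). Proof. exact: measurable_band. Qed.
Let domxx x : dom x x = false. Proof. exact: prec_irr. Qed.

Let q1 := band_mean k n b.

Let q1_le : n%:R * q1 <= l.
Proof.
apply: le_trans Nl; rewrite mulrC -ler_pdivlMr//.
exact: band_mean_le.
Qed.

Let q10 : 0 <= q1. Proof. exact: band_mean_ge0. Qed.

Let bern_mean_le (B : set nat) :
  bern n \1_B q1 <= bern n \1_B (l / n%:R) + (l - (1 - (e * M) ^+ 2 / n%:R) *
    ((b - 1) ^+ k / k`!%:R * (expR (- M) - expR (- (e * M))))).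
Proof.
have /andP[l0 l1] := l_in.
have ln01 : 0 <= l / n%:R <= 1.
  by rewrite divr_ge0 ?(ltW l0)//= ler_pdivrMr// mul1r.
have q1l : q1 <= l / n%:R by rewrite ler_pdivlMr// mulrC.
have q101 : 0 <= q1 <= 1.
  by rewrite q10 (le_trans q1l)//; have /andP[] := ln01.
have := @bern_lipschitz R n \1_B (l / n%:R) q1 1 ln01 q101.
rewrite ler_norml => /(_ _)/andP[|_].
  by move=> j; rewrite !indicE; do 2! case: (_ \in _);
    rewrite ler_norml /=; apply/andP; split; lra.
rewrite lerBlDl mulr1 ler0_norm ?subr_le0// => /le_trans; apply.
rewrite lerD2l opprB mulrBr mulrCA mulfV// mulr1 lerD2l lerN2.
have := band_mean_ge k n0 b1 Mn; rewrite -/q1 => h.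
rewrite -ler_pdivrMl//; apply: le_trans h; rewrite -/M.
by rewrite le_eqVlt; apply/orP; left; apply/eqP; field;
  rewrite nn pnatr_eq0 -lt0n fact_gt0.
Qed.

Lemma low_maxima_poisson_le (B : set nat) :
  (iid mu n [set t | B (count_maxima dom (low b) t)] <=
   poisson_prob l 0 B + approximation_error%:E)%E.
Proof.
pose q2 := fine (\int[iid mu n]_t (free_mass mu dom (band b) t ^+ 2)%:E)%E.
have q2E : (\int[iid mu n]_t (free_mass mu dom (band b) t ^+ 2)%:E = q2%:E)%E.
  rewrite /q2 fineK// ge0_fin_numE; last by apply: integral_ge0 => t _; rewrite lee_fin sqr_ge0.
  rewrite free_mass_second_moment//.
  exact: (le_lt_trans (second_moment_le k n0 b1)) (ltry _).
have q2le : q2 <= q1 ^+ 2 + 2 * e * (N * expR (- M) / n%:R *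
   (e * M / n%:R * ((8 / M) ^+ d + e * M * expR (- (M / 2)) * 4 ^+ d))).
  by rewrite -lee_fin -q2E free_mass_second_moment//; exact: second_moment_le.
have h4 : (\int[iid mu n]_t (bern n \1_B (free_mass mu dom (band b) t))%:E <=
    (bern n \1_B q1 + 4 * e ^+ 2 * M * ((8 / M) ^+ d + e * M * expR (- (M / 2)) * 4 ^+ d)
      * (N * expR (- M)))%:E)%E.
  have mx := @mixed_binomial_le _ _ R (iid mu n) n B (fun t => free_mass mu dom (band b) t) q1 q2
    (measurable_free_mass mu mdom mband (n := n)) (free_mass01 mu mdom mband (n := n))
    (etrans (free_mass_mean mu mdom mband n) (band_meanE k n0 b1)) q2E.
  apply: (le_trans mx); rewrite lee_fin lerD2l.
  have -> : 4 * e ^+ 2 * M * ((8 / M) ^+ d + e * M * expR (- (M / 2)) * 4 ^+ d)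
      * (N * expR (- M)) = 2 * n%:R ^+ 2 * (2 * e * (N * expR (- M) / n%:R *
   (e * M / n%:R * ((8 / M) ^+ d + e * M * expR (- (M / 2)) * 4 ^+ d)))).
    by field.
  by apply: ler_wpM2l; [rewrite mulr_ge0 ?exprn_ge0|rewrite lerBlDl].
have pfin : poisson_prob l 0 B \is a fin_num by rewrite fin_num_measure.
have h5 : bern n \1_B (l / n%:R) <= fine (poisson_prob l 0 B) + l ^+ 2 / n%:R.
  by rewrite -lee_fin EFinD fineK//; exact: le_cam.
have h1 : (n%:R%:E * \int[mu]_y ((low b y && ~~ band b y)%:R * (1 - hit mu dom y) ^+ n.-1)%:E
    <= (e * N * expR (- (e * M)))%:E)%E.
  rewrite [leRHS](_ : _ = n%:R%:E * (e * N * expR (- (e * M)) / n%:R)%:E)%E; last first.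
    by rewrite -EFinM; congr EFin; field.
  by apply: lee_wpmul2l; [rewrite lee_fin|exact: off_band_le].
have h2 : ((n%:R * fine (mu [set x | near (low b) (band b) x]) ^+ 2)%:E <=
    (n%:R * (6 ^+ d * expR (- (2 / 3 * (b - 1)))) ^+ 2)%:E)%E.
  rewrite lee_fin; apply: ler_wpM2l => //; rewrite lerXn2r// ?nnegrE ?mulr_ge0 ?exprn_ge0 ?expR_ge0//.
    exact: fine_ge0.
  exact: near_mass_le.
have h3 : ((2 * n%:R ^+ 2)%:E * \int[mu]_y (clash mu dom (low b) (band b) n y)%:E <=
    (24 * e ^+ 2 * M * (d`!%:R * (4 / M) ^+ d) * (N * expR (- M)))%:E)%E.
  rewrite [leRHS](_ : _ = (2 * n%:R ^+ 2)%:E *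
    (12 * e ^+ 2 * M * (d`!%:R * (4 / M) ^+ d) * N * expR (- M) / n%:R ^+ 2)%:E)%E; last first.
    by rewrite -EFinM; congr EFin; field.
  by apply: lee_wpmul2l; [rewrite lee_fin mulr_ge0 ?exprn_ge0|exact: integral_clash_le].
apply: (le_trans (low_maxima_off_band mu mdom domxx mlow mband (@band_low R k b) n B)).
have := coupling_bound mu mdom domxx mlow mband (@band_low R k b) n B.
rewrite (count_undom_law mu mdom mband) => cb.
apply: (le_trans (leeD (le_trans cb (leeD (leeD h4 h2) h3)) h1)).
rewrite -(fineK pfin) -!EFinD lee_fin /approximation_error.
have := bern_mean_le B; move: h5; lra.
Qed.

End low_maxima_poisson.

(** * Size of the error at the critical level *)

Section asymptotics.
Context {R : realType}.
Variables (k n : nat) (s a : R).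
Notation d := k.+1.
Notation e := (expR 1 : R).
Hypotheses (k0 : (0 < k)%N) (s_large : 216 * k%:R ^+ 2 + 4 <= s)
  (nE : n%:R = expR (expR s))
  (a_small : `|a| <= 1 / (2 * k%:R) * (ln s - 2 * ln (ln s))).

(** Here s stands for ln ln n and L for ln n, and D = s^(-k) is the order of the
errors relative to l. *)
Let L := expR s.
Let b := L - ln s - ln k%:R - ln (1 - a / s).
Let M := k%:R * (s - a).
Let l := expR (k%:R * a) / k`!%:R.
Let D := (s ^+ k)^-1.
Let target := expR (- ((k%:R - 1 / 2) * ln s)) / ln s.

Let k1 : 1 <= k%:R :> R. Proof. by rewrite ler1n. Qed.
Let k00 : 0 < k%:R :> R. Proof. by rewrite ltr0n. Qed.
Let s4 : 4 <= s.
Proof. by apply: le_trans s_large; rewrite lerDr mulr_ge0 ?exprn_ge0. Qed.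
Let s0 : 0 < s. Proof. by apply: lt_le_trans s4. Qed.
Let L0 : 0 < L. Proof. exact: expR_gt0. Qed.
Let e4 : e <= 4.
Proof. by have := @expR_le R 1; rewrite lexx ler01 => /(_ isT); lra. Qed.
Let e2 : 2 <= e. Proof. exact: expR1_ge2. Qed.

Let ln_le1 (x : R) : 0 < x -> ln x <= x - 1.
Proof. by move=> x0; have := expR_ge1Dx (ln x); rewrite lnK//; lra. Qed.

Let lns1 : 1 <= ln s.
Proof. by rewrite -[leLHS](@expRK R) ler_ln ?posrE ?expR_gt0//; exact: le_trans s4. Qed.

Let lnln0 : 0 <= ln (ln s). Proof. by rewrite ln_ge0. Qed.

Let ka_abs : k%:R * `|a| <= ln s / 2 - ln (ln s).
Proof.
apply: (le_trans (ler_wpM2l (ltW k00) a_small)).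
by rewrite le_eqVlt; apply/orP; left; apply/eqP; field; rewrite gt_eqF.
Qed.

Let ka_le : k%:R * a <= ln s / 2 - ln (ln s).
Proof. by apply: le_trans ka_abs; rewrite ler_wpM2l// ler_norm. Qed.

Let a_le : `|a| <= s / 2.
Proof.
have h : `|a| <= k%:R * `|a| by rewrite ler_peMl.
apply: (le_trans h); apply: (le_trans ka_abs).
by have := ln_le1 s0; have := lnln0; lra.
Qed.

Let sa : s / 2 <= s - a <= 3 / 2 * s.
Proof. by move: a_le; rewrite ler_norml => /andP[h1 h2]; apply/andP; split; lra. Qed.

Let sM : s / 2 <= M.
Proof.
have /andP[h _] := sa; apply: (le_trans h); rewrite /M ler_peMl//; move: s4; lra.
Qed.

Let Ms : M <= 3 / 2 * (k%:R * s).
Proof. by rewrite mulrCA ler_wpM2l//; have /andP[] := sa. Qed.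

Let M1 : 1 <= M. Proof. by apply: le_trans sM; move: s4; lra. Qed.
Let M0 : 0 < M. Proof. exact: lt_le_trans M1. Qed.

Let lnM_le : ln M <= M - 1. Proof. exact: ln_le1. Qed.
Let lnM0 : 0 <= ln M. Proof. by rewrite ln_ge0. Qed.

(** By definition of the level, n exp(-b) is exactly k (s - a). *)
Let bE : b = L - ln M.
Proof.
have sa0 : 0 < s - a by move: sa s4 => /andP[h _]; lra.
have as0 : 0 < 1 - a / s.
  by rewrite (_ : 1 - a / s = (s - a) / s) ?divr_gt0//; field; rewrite gt_eqF.
rewrite /b (_ : M = s * (k%:R * (1 - a / s))); last by rewrite /M; field; rewrite gt_eqF.
by rewrite !lnM ?posrE ?mulr_gt0//; ring.
Qed.

Let scale_le j : s ^+ j <= j`!%:R * L.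
Proof. exact: exprn_le_expR (ltW s0). Qed.

(** Every power of s is negligible against L = exp s, to the precision D. *)
Let s_over_L j : s ^+ j / L <= (j + k)`!%:R * D.
Proof.
rewrite ler_pdivrMr// /D mulrAC ler_pdivlMr ?exprn_gt0//.
by rewrite -exprD; exact: scale_le.
Qed.

Let nL : L <= n%:R.
Proof. by rewrite nE; have := expR_ge1Dx L; rewrite -/L; lra. Qed.

Let n0R : 0 < n%:R :> R. Proof. exact: lt_le_trans nL. Qed.

Let nEb : n%:R * expR (- b) = M.
Proof. by rewrite nE -expRD bE opprB addrCA subrr addr0 lnK. Qed.

Let D0 : 0 < D. Proof. by rewrite invr_gt0 exprn_gt0. Qed.

Let MD : M ^- k <= 2 ^+ k * D.
Proof.
rewrite -ler_pV2 ?inE ?unitfE ?gt_eqF ?mulr_gt0 ?invr_gt0 ?exprn_gt0//.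
rewrite invrK invfM invrK mulrC -expr_div_n lerXn2r ?nnegrE ?divr_ge0 ?(ltW M0)//.
exact: ltW.
Qed.

Let expM j : M ^+ j * expR (- M) <= j`!%:R.
Proof.
rewrite expRN ler_pdivrMr ?expR_gt0//; exact: exprn_le_expR (ltW M0).
Qed.

Let expNM : expR (- M) <= k`!%:R * 2 ^+ k * D.
Proof.
apply: (@le_trans _ _ (k`!%:R * M ^- k)); last by rewrite -mulrA ler_wpM2l.
by rewrite ler_pdivlMr ?exprn_gt0// mulrC.
Qed.

Let l0 : 0 < l. Proof. by rewrite divr_gt0 ?expR_gt0 ?ltr0n ?fact_gt0. Qed.

(** As exp(-M) = L^(-k) exp(k a), the intensity is L^k / k! exp(-M): it is the
expected number with b replaced by L. *)
Let lE : l = L ^+ k * expR (- M) / k`!%:R.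
Proof.
rewrite /l /L -expRM_natl -expRD; congr (expR _ / _); rewrite /M; ring.
Qed.

(** This is where the bound on |a| enters: it caps the intensity. *)
Let l_le : l <= expR (ln s / 2) / ln s.
Proof.
apply: (@le_trans _ _ (expR (k%:R * a))).
  by rewrite /l ler_piMr ?expR_ge0// invf_le1 ?ltr0n ?fact_gt0// ler1n fact_gt0.
apply: (@le_trans _ _ (expR (ln s / 2 - ln (ln s)))); first by rewrite ler_expR.
by rewrite expRD expRN lnK// posrE; apply: lt_le_trans lns1.
Qed.

Let lnspos : 0 < ln s. Proof. exact: lt_le_trans lns1. Qed.

Let lD : l * D <= target.
Proof.
apply: (le_trans (ler_wpM2r (ltW D0) l_le)).
rewrite /target (_ : - _ = ln s / 2 - k%:R * ln s); last by field.
by rewrite expRD mulrAC expRN expRM_natl lnK.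
Qed.

Let l_s : l <= s.
Proof.
apply: (le_trans l_le); rewrite ler_pdivrMr//.
apply: (@le_trans _ _ (expR (ln s))); first by rewrite ler_expR; move: lns1; lra.
by rewrite lnK// ler_peMr// ltW.
Qed.

Let target_ge : (s ^+ k.+1)^-1 <= target.
Proof.
rewrite exprSr invfM /target ler_pM ?invr_ge0 ?exprn_ge0 ?(ltW s0)//.
  rewrite -{1}(lnK (x := s))// -expRM_natl -expRN ler_expR.
  by move: lns1; lra.
by rewrite lef_pV2//; have := ln_le1 s0; lra.
Qed.

(** The constant 216 = 6 * 36 in the threshold for s makes s^3 / 6, a lower bound
for L, exceed the bound 36 k^2 s^2 of (e M)^2. *)
Let k2s2 : 216 * k%:R ^+ 2 * s ^+ 2 <= s ^+ 3.
Proof.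
rewrite [leRHS]exprS ler_wpM2r ?exprn_ge0 ?(ltW s0)//.
by apply: le_trans s_large; rewrite lerDl.
Qed.

Lemma level_ge1 : 1 <= b.
Proof.
rewrite bE; have := scale_le 2; rewrite -[2`!]/2%N => h.
have h2 : k%:R * s <= k%:R ^+ 2 * s.
  by rewrite expr2 -mulrA ler_peMl// mulr_ge0// ltW.
have h3 : 216 * k%:R ^+ 2 * s <= s ^+ 2.
  by rewrite expr2 ler_wpM2r ?(ltW s0)//; apply: le_trans s_large; rewrite lerDl.
have h4 : 0 <= k%:R * s by rewrite mulr_ge0// ltW.
have h5 := lnM_le; have h6 := Ms; lra.
Qed.

Let b0 : 0 <= b. Proof. exact: le_trans level_ge1. Qed.
Let bL : b <= L. Proof. by rewrite bE; move: lnM0; lra. Qed.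

Lemma intensity_in : 0 < l <= n%:R.
Proof.
rewrite l0/=; apply: (le_trans l_s); apply: le_trans nL.
by have := scale_le 1; rewrite mul1r.
Qed.

Let M2 : M ^+ 2 <= 9 / 4 * (k%:R ^+ 2 * s ^+ 2).
Proof.
rewrite (_ : 9 / 4 * _ = (3 / 2 * (k%:R * s)) ^+ 2); last by field.
rewrite lerXn2r ?nnegrE ?(ltW M0)//.
by rewrite !mulr_ge0// ltW.
Qed.

Let eM2 : (e * M) ^+ 2 <= 36 * (k%:R ^+ 2 * s ^+ 2).
Proof.
rewrite exprMn; apply: (@le_trans _ _ (16 * (9 / 4 * (k%:R ^+ 2 * s ^+ 2)))); last lra.
rewrite ler_pM ?exprn_ge0 ?expR_ge0 ?(ltW M0)//.
rewrite (_ : 16 = 4 ^+ 2 :> R); last by ring.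
by rewrite lerXn2r ?nnegrE ?expR_ge0.
Qed.

Lemma scaled_mass_le : (e * (n%:R * expR (- b))) ^+ 2 <= n%:R.
Proof.
rewrite nEb; apply: (le_trans eM2); apply: le_trans nL.
have := scale_le 3; rewrite -[3`!]/6%N => h.
by have := k2s2; lra.
Qed.

Lemma intensity_ge : b ^+ k / k`!%:R * expR (- (n%:R * expR (- b))) <= l.
Proof.
rewrite nEb lE mulrAC ler_wpM2r ?invr_ge0// ler_wpM2r ?expR_ge0//.
by rewrite lerXn2r ?nnegrE// ltW.
Qed.

Let N := b ^+ k / k`!%:R.
Let N0 : 0 <= N. Proof. by rewrite divr_ge0 ?exprn_ge0. Qed.
Let Nl : N * expR (- M) <= l. Proof. by have := intensity_ge; rewrite nEb. Qed.
Let NM0 : 0 <= N * expR (- M). Proof. by rewrite mulr_ge0 ?expR_ge0. Qed.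
Let l00 : 0 <= l := ltW l0.

Let expeM : expR (- (e * M)) <= expR (- M) * expR (- M).
Proof. by rewrite -expRD ler_expR; have := ler_wpM2r (ltW M0) e2; lra. Qed.

Let err1 : e * N * expR (- (e * M)) <= 4 * (k`!%:R * 2 ^+ k) * (l * D).
Proof.
apply: (@le_trans _ _ (4 * (l * (k`!%:R * 2 ^+ k * D)))); last first.
  by rewrite le_eqVlt; apply/orP; left; apply/eqP; ring.
apply: (@le_trans _ _ (e * N * (expR (- M) * expR (- M)))).
  by rewrite ler_wpM2l// mulr_ge0 ?expR_ge0.
rewrite -mulrA (mulrA N) ler_pM ?expR_ge0//; first by rewrite mulr_ge0 ?expR_ge0.
by rewrite ler_pM ?expR_ge0.
Qed.

(** The only error that does not carry the factor l; it is a power of 1 / n up to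
logarithms, hence compared with s^(-k - 1) <= target. *)
Let err2 : n%:R * (6 ^+ d * expR (- (2 / 3 * (b - 1)))) ^+ 2 <=
  108 * 36 ^+ d * k%:R ^+ 2 * (k.+3)`!%:R * target.
Proof.
apply: (@le_trans _ _ (36 ^+ d * (16 * M ^+ 2 * (3 / L)))).
  rewrite exprMn mulrCA -exprM mulnC exprM (_ : 6 ^+ 2 = 36 :> R); last by ring.
  rewrite ler_wpM2l ?exprn_ge0// -expRM_natl nE -/L -expRD.
  apply: (@le_trans _ _ (expR 2 * M ^+ 2 * expR (- (L / 3)))).
    rewrite -[in leRHS](lnK (x := M))// -expRM_natl -!expRD ler_expR bE.
    by have := lnM0; lra.
  have M20 : 0 <= M ^+ 2 by exact: sqr_ge0.
  apply: ler_pM; [by apply: mulr_ge0; rewrite ?expR_ge0|exact: expR_ge0| |].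
    apply: ler_wpM2r => //.
    rewrite (_ : expR 2 = e ^+ 2); last by rewrite -expRM_natl mulr1.
    by rewrite (_ : 16 = 4 ^+ 2 :> R); [rewrite lerXn2r ?nnegrE ?expR_ge0|ring].
  rewrite expRN -[leRHS]invf_div lef_pV2 ?posrE ?expR_gt0 ?divr_gt0//.
  by have := expR_ge1Dx (L / 3); lra.
apply: (@le_trans _ _ (108 * 36 ^+ d * k%:R ^+ 2 * (s ^+ 2 / L))).
  rewrite (_ : 36 ^+ d * _ = 48 * (36 ^+ d / L) * M ^+ 2); last by ring.
  rewrite [leRHS](_ : _ = 48 * (36 ^+ d / L) * (9 / 4 * (k%:R ^+ 2 * s ^+ 2))).
    by rewrite ler_wpM2l ?mulr_ge0 ?exprn_ge0 ?invr_ge0 ?(ltW L0).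
  by field; rewrite gt_eqF.
rewrite -[leRHS]mulrA ler_wpM2l ?mulr_ge0 ?exprn_ge0//.
apply: (@le_trans _ _ ((k.+3)`!%:R * (s ^+ k.+1)^-1)); last by rewrite ler_wpM2l.
rewrite ler_pdivrMr// mulrAC ler_pdivlMr ?exprn_gt0// -exprD.
exact: scale_le.
Qed.

Let err3 : 24 * e ^+ 2 * M * (d`!%:R * (4 / M) ^+ d) * (N * expR (- M)) <=
  384 * d`!%:R * 4 ^+ d * 2 ^+ k * (l * D).
Proof.
rewrite (_ : 24 * _ * _ * _ * _ = 24 * d`!%:R * 4 ^+ d * (e ^+ 2 * ((N * expR (- M)) * M ^- k))); last first.
  by rewrite expr_div_n (exprS M k); field; rewrite expf_neq0// gt_eqF.
rewrite (_ : _ * (l * D) = 24 * d`!%:R * 4 ^+ d * (4 ^+ 2 * (l * (2 ^+ k * D)))); last by ring.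
rewrite ler_wpM2l ?mulr_ge0 ?exprn_ge0// ler_pM ?exprn_ge0 ?expR_ge0//.
- by rewrite mulr_ge0// invr_ge0 exprn_ge0// ltW.
- by rewrite lerXn2r ?nnegrE ?expR_ge0.
- by rewrite ler_pM// invr_ge0 exprn_ge0// ltW.
Qed.

Let half_expM : M ^+ 2 * expR (- (M / 2)) <= (k.+2)`!%:R * 2 ^+ k.+2 * M ^- k.
Proof.
rewrite expRN ler_pdivrMr ?expR_gt0// mulrAC ler_pdivlMr ?exprn_gt0// -exprD.
have := @exprn_le_expR R k.+2 (M / 2); rewrite divr_ge0 ?(ltW M0)// => /(_ isT).
by rewrite expr_div_n ler_pdivrMr ?exprn_gt0// -[(2 + k)%N]/k.+2 mulrAC.
Qed.

Let err4 : 4 * e ^+ 2 * M * ((8 / M) ^+ d + e * M * expR (- (M / 2)) * 4 ^+ d) * (N * expR (- M)) <=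
  64 * (8 ^+ d + 4 * 4 ^+ d * ((k.+2)`!%:R * 2 ^+ k.+2)) * 2 ^+ k * (l * D).
Proof.
rewrite (_ : 4 * _ * _ * _ * _ = 4 * (e ^+ 2 * ((N * expR (- M)) *
    (8 ^+ d * M ^- k + 4 ^+ d * (e * (M ^+ 2 * expR (- (M / 2)))))))); last first.
  by rewrite expr_div_n (exprS M k); field; rewrite expf_neq0// gt_eqF.
rewrite (_ : 64 * _ * _ * _ = 4 * (4 ^+ 2 * (l * (8 ^+ d * (2 ^+ k * D) +
    4 ^+ d * (4 * ((k.+2)`!%:R * 2 ^+ k.+2 * (2 ^+ k * D))))))); last by ring.
have MV : 0 <= M ^- k by rewrite invr_ge0 exprn_ge0// ltW.
have eM0 : 0 <= M ^+ 2 * expR (- (M / 2)) by rewrite mulr_ge0 ?expR_ge0// exprn_ge0// ltW.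
rewrite ler_wpM2l// ler_pM ?exprn_ge0 ?expR_ge0//.
- by rewrite mulr_ge0// addr_ge0// mulr_ge0 ?exprn_ge0// mulr_ge0 ?expR_ge0.
- by rewrite lerXn2r ?nnegrE ?expR_ge0.
rewrite ler_pM//.
- by rewrite addr_ge0// mulr_ge0 ?exprn_ge0// mulr_ge0 ?expR_ge0.
rewrite lerD// ler_wpM2l ?exprn_ge0// ler_pM ?expR_ge0//.
by apply: (le_trans half_expM); rewrite ler_wpM2l// mulr_ge0 ?exprn_ge0.
Qed.

(** The mean falls short of l by the factors 1 - x, y and 1 - z, which come from
(1 - A)^n versus exp(-n A), from ((b - 1) / L)^k, and from the inner edge of the
band; each of them is close to 1. *)
Let err5 : l - (1 - (e * M) ^+ 2 / n%:R) *
    ((b - 1) ^+ k / k`!%:R * (expR (- M) - expR (- (e * M)))) <=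
  (36 * k%:R ^+ 2 * (k.+2)`!%:R + 2 * k%:R ^+ 2 * (k.+1)`!%:R + k`!%:R * 2 ^+ k) * (l * D).
Proof.
set x := (e * M) ^+ 2 / n%:R.
have x0 : 0 <= x by rewrite divr_ge0 ?sqr_ge0// ltW.
have x1 : x <= 1 by rewrite ler_pdivrMr// mul1r; have := scaled_mass_le; rewrite nEb.
have xD : x <= 36 * k%:R ^+ 2 * (k.+2)`!%:R * D.
  apply: (@le_trans _ _ (36 * k%:R ^+ 2 * (s ^+ 2 / L))); last first.
    rewrite -[leRHS]mulrA ler_wpM2l ?mulr_ge0 ?exprn_ge0//; exact: s_over_L.
  rewrite (_ : _ * _ * _ = 36 * (k%:R ^+ 2 * s ^+ 2) / L); last by ring.
  rewrite ler_pM ?sqr_ge0 ?invr_ge0 ?(ltW n0R)//.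
  by rewrite lef_pV2.
set y := ((b - 1) / L) ^+ k.
have bb : 0 <= b - 1 by rewrite subr_ge0 level_ge1.
have y0 : 0 <= y by rewrite exprn_ge0// divr_ge0// ltW.
have yD : 1 - y <= 2 * k%:R ^+ 2 * (k.+1)`!%:R * D.
  apply: (@le_trans _ _ (2 * k%:R ^+ 2 * (s ^+ 1 / L))); last first.
    rewrite -[leRHS]mulrA ler_wpM2l ?mulr_ge0 ?exprn_ge0//; exact: s_over_L.
  have := @bernoulli R k (- ((1 + ln M) / L)).
  have -> : 1 + - ((1 + ln M) / L) = (b - 1) / L.
    by rewrite bE; field; rewrite gt_eqF.
  have h : (1 + ln M) / L <= 3 / 2 * (k%:R * s) / L.
    rewrite ler_wpM2r ?invr_ge0 ?(ltW L0)//; have := lnM_le; have := Ms; lra.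
  have h1 : -1 <= - ((1 + ln M) / L).
    rewrite lerN2 ler_pdivrMr// mul1r; move: bb; rewrite bE; lra.
  rewrite -/y => /(_ h1) h2.
  have := ler_wpM2l (ltW k00) h.
  rewrite (_ : k%:R * (3 / 2 * (k%:R * s) / L) = 3 / 2 * (k%:R ^+ 2 * (s / L))); last by ring.
  rewrite (_ : 2 * _ * _ = 2 * (k%:R ^+ 2 * (s / L))); last by ring.
  have : 0 <= k%:R ^+ 2 * (s / L) by rewrite mulr_ge0 ?exprn_ge0// divr_ge0// ltW.
  move: h2; rewrite mulrN; lra.
have y1 : y <= 1.
  rewrite exprn_ile1//; first by rewrite divr_ge0// ltW.
  rewrite ler_pdivrMr// mul1r; move: bL; lra.
set z := expR (- M).
have z0 : 0 <= z by exact: expR_ge0.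
have z1 : z <= 1 by rewrite -expR0 ler_expR oppr_le0 ltW.
apply: (@le_trans _ _ (l * (x + (1 - y) + z))).
  have E : (b - 1) ^+ k / k`!%:R * z = l * y.
    by rewrite lE /y /z expr_div_n; field; rewrite expf_neq0 ?gt_eqF// ltr0n fact_gt0.
  have h : l * y * (1 - z) <= (b - 1) ^+ k / k`!%:R * (z - expR (- (e * M))).
    rewrite -E -mulrA ler_wpM2l ?divr_ge0 ?exprn_ge0//.
    rewrite mulrBr mulr1 lerD2l lerN2; exact: expeM.
  have h2 := ler_wpM2l (_ : 0 <= 1 - x) h; rewrite subr_ge0 in h2.
  have := h2 x1.
  have h3 : 1 - (x + (1 - y) + z) <= (1 - x) * (y * (1 - z)).
    have u1 : 0 <= x * (1 - y) by rewrite mulr_ge0// subr_ge0.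
    have u2 : 0 <= y * z * (1 - x) by rewrite !mulr_ge0// subr_ge0.
    have u3 : 0 <= z * (1 - y) by rewrite mulr_ge0// subr_ge0.
    nra.
  have := ler_wpM2l l00 h3.
  rewrite (_ : l * ((1 - x) * _) = (1 - x) * (l * y * (1 - z))); last by ring.
  by rewrite mulrBr mulr1; lra.
rewrite (_ : _ * (l * D) = l * (36 * k%:R ^+ 2 * (k.+2)`!%:R * D +
  2 * k%:R ^+ 2 * (k.+1)`!%:R * D + k`!%:R * 2 ^+ k * D)); last by ring.
by rewrite ler_wpM2l// !lerD.
Qed.

Let err6 : l ^+ 2 / n%:R <= (k.+1)`!%:R * (l * D).
Proof.
rewrite (_ : l ^+ 2 / _ = l * (l / n%:R)); last by ring.
rewrite [leRHS]mulrCA ler_wpM2l//.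
apply: le_trans (s_over_L 1); rewrite ler_pM ?invr_ge0 ?(ltW n0R)//.
by rewrite lef_pV2.
Qed.

Definition error_constant : R :=
  4 * (k`!%:R * 2 ^+ k) + 108 * 36 ^+ d * k%:R ^+ 2 * (k.+3)`!%:R +
   384 * d`!%:R * 4 ^+ d * 2 ^+ k +
   64 * (8 ^+ d + 4 * 4 ^+ d * ((k.+2)`!%:R * 2 ^+ k.+2)) * 2 ^+ k +
   (36 * k%:R ^+ 2 * (k.+2)`!%:R + 2 * k%:R ^+ 2 * (k.+1)`!%:R + k`!%:R * 2 ^+ k) +
   (k.+1)`!%:R.

Lemma approximation_error_le : approximation_error k n b l <= error_constant * target.
Proof.
rewrite /approximation_error nEb -/N /error_constant.
have dist (a1 a2 a3 a4 a5 a6 t : R) : (a1 + a2 + a3 + a4 + a5 + a6) * t =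
    a1 * t + a2 * t + a3 * t + a4 * t + a5 * t + a6 * t by ring.
rewrite dist.
have up c r : r <= c * (l * D) -> 0 <= c -> r <= c * target.
  by move=> h c0; apply: (le_trans h); rewrite ler_wpM2l.
apply: lerD; last by apply: (up _ _ err6).
apply: lerD; last first.
  by apply: (up _ _ err5); rewrite !addr_ge0 ?mulr_ge0 ?exprn_ge0.
apply: lerD; last first.
  by apply: (up _ _ err4); rewrite mulr_ge0 ?exprn_ge0// mulr_ge0// addr_ge0 ?exprn_ge0//
    !mulr_ge0 ?exprn_ge0.
apply: lerD; last first.
  apply: (up _ _ err3).
  apply: mulr_ge0; last by apply: exprn_ge0.
  apply: mulr_ge0; last by apply: exprn_ge0.
  by apply: mulr_ge0; exact: ler0n.
apply: lerD; last exact: err2.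
by apply: (up _ _ err1); rewrite !mulr_ge0 ?exprn_ge0.
Qed.

End asymptotics.

(** * From the random vectors to the product law *)

Section joint_law.
Context {disp disp' : measure_display} {T : measurableType disp}
  {T' : measurableType disp'} {R : realType}.
Variables (P : probability T R) (m : probability T' R).

(** Independence is a product rule over finite sets of indices; g selects the n
indices that form the sample, and the events of the other indices are taken to
be full. *)
Lemma independent_box (I : choiceType) (Y : I -> T -> T') n (g : 'I_n -> I)
    (B : 'I_n -> set T') :
  mutually_independent P Y -> injective g -> (forall i, measurable (B i)) ->
  P [set w | forall i, B i (Y (g i) w)] = (\prod_(i < n) P (Y (g i) @^-1` B i))%E.
Proof.
move=> indY g_inj mB.
pose J := [fset x in map g (enum 'I_n)]%fset.
pose B' x := if [pick i | g i == x] is Some i then B i else setT.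
have B'g i : B' (g i) = B i.
  rewrite /B'; case: pickP => [j /eqP/g_inj ->//|/(_ i)].
  by rewrite eqxx.
have gJ i : g i \in J by rewrite !inE map_f// mem_enum.
rewrite (_ : [set w | _] = \bigcap_(x in [set` J]) (Y x @^-1` B' x)); last first.
  apply/seteqP; split => w /=.
    move=> h x /=; rewrite !inE => /mapP[i _ ->]; rewrite B'g; exact: h.
  by move=> h i; have := h (g i) (gJ i); rewrite /= B'g.
rewrite indY; last by move=> x; rewrite !inE => /mapP[i _ ->]; rewrite B'g.
rewrite (perm_big (map g (enum 'I_n))); last first.
  apply: uniq_perm; first exact: fset_uniq.
    by rewrite map_inj_uniq// enum_uniq.
  by move=> x; rewrite !inE.
by rewrite big_map big_enum; apply: eq_bigr => i _; rewrite B'g.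
Qed.

Lemma independent_iid n (Z : 'I_n -> T -> T') :
  (forall i, measurable_fun setT (Z i)) ->
  (forall B : 'I_n -> set T', (forall i, measurable (B i)) ->
     P [set w | forall i, B i (Z i w)] = (\prod_(i < n) P (Z i @^-1` B i))%E) ->
  (forall i B, measurable B -> P (Z i @^-1` B) = m B) ->
  forall A, measurable A -> P [set w | A [tuple Z i w | i < n]] = iid m n A.
Proof.
move=> mZ indZ lawZ A mA.
pose W w := [tuple Z i w | i < n].
have mW : measurable_fun setT W.
  apply/measurable_fun_tnthP => i; apply: eq_measurable_fun (mZ i) => w _.
  by rewrite /= tnth_mktuple.
pose isW := isMeasurableFun.Build _ _ _ _ W mW.
pose W' : {mfun T >-> n.-tuple T'} := HB.pack W isW.
have <- : distribution P W' A = P [set w | A [tuple Z i w | i < n]] by [].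
apply: iid_unique => // B mB.
transitivity (P [set w | forall i, B i (Z i w)]).
  congr (P _); apply/seteqP; split => w h i; have := h i; by rewrite /= tnth_mktuple.
by rewrite indZ//; apply: eq_bigr => i _; exact: lawZ.
Qed.

End joint_law.

Section sample_of_vectors.
Context {disp : measure_display} {T : measurableType disp} {R : realType}.
Variables (d : nat) (P : probability T R) (X : nat -> {RV P >-> d.-tuple R}).
Hypothesis iidX : iid_exp1_vectors X.
Notation mu := (iid (@exp1 R) d).

Lemma vector_law i (A : set (d.-tuple R)) : measurable A -> P (X i @^-1` A) = mu A.
Proof.
move=> mA.
transitivity (P [set w | A [tuple tnth (X i w) j | j < d]]).
  congr (P _); apply/seteqP; split => w /=; rewrite (_ : [tuple _ | _ < _] = X i w)//;
    by apply: eq_from_tnth => j; rewrite tnth_mktuple.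
apply: independent_iid => //.
- move=> j; apply: (@measurableT_comp _ _ _ _ _ _ (@tnth d R ^~ j)) => //.
  exact: measurable_tnth.
- move=> B mB.
  exact: (independent_box (coordinates_independent iidX i) (g := id)).
- move=> j B mB; exact: (coordinates_exp1 iidX).
Qed.

Lemma rho_law n (b : R) (B : set nat) :
  P [set w | B (rho n b (fun i => X i w))] =
  iid mu n [set t | B (count_maxima (@prec R d) (low b) t)].
Proof.
have mA : measurable [set t : n.-tuple (d.-tuple R) | B (count_maxima (@prec R d) (low b) t)].
  rewrite -[X in measurable X]setTI.
  apply: measurable_count_maxima => //; first exact: measurable_prec.
  exact: measurable_low.
transitivity (P [set w | B (count_maxima (@prec R d) (low b) [tuple X i w | i < n])]).
  congr (P _); apply/seteqP; split => w /=;
    rewrite (_ : count_maxima _ _ _ = rho n b (fun i => X i w))//;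
    apply: eq_card => i; rewrite !inE /is_maximum /low tnth_mktuple andbC;
    congr (_ && _); apply: eq_forallb => j; by rewrite tnth_mktuple.
apply: (independent_iid (m := mu) (Z := fun (i : 'I_n) w => X i w) _ _ _ mA).
- by move=> i.
- move=> C mC.
  exact: (independent_box (vectors_independent iidX) (g := val) val_inj).
- by move=> i C mC; exact: vector_law.
Qed.

End sample_of_vectors.

(** An upper bound for the complement of an event is a lower bound for the
event. *)
Lemma two_sided {disp1 disp2 : measure_display} {T1 : measurableType disp1}
    {T2 : measurableType disp2} {R : realType} (P1 : probability T1 R)
    (P2 : probability T2 R) (f : T1 -> nat) (g : T2 -> nat) (r : R) :
  (forall B : set nat, measurable (f @^-1` B)) ->
  (forall B : set nat, measurable (g @^-1` B)) ->
  (forall B : set nat, P1 (f @^-1` B) <= P2 (g @^-1` B) + r%:E)%E ->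
  forall B : set nat, (`|P1 (f @^-1` B) - P2 (g @^-1` B)| <= r%:E)%E.
Proof.
move=> mf mg h B.
have h1 := h B; have := h (~` B).
rewrite -[f @^-1` (~` B)]/(~` (f @^-1` B)) -[g @^-1` (~` B)]/(~` (g @^-1` B)).
rewrite (probability_setC P1 (mf B)) (probability_setC P2 (mg B)).
have f1 : P1 (f @^-1` B) \is a fin_num by rewrite fin_num_measure.
have f2 : P2 (g @^-1` B) \is a fin_num by rewrite fin_num_measure.
move: h1; rewrite -(fineK f1) -(fineK f2) -!EFinN -!EFinD !lee_fin => h1 h2.
by rewrite ler_norml; apply/andP; split; lra.
Qed.

Lemma iterln_large {R : realType} (s0 : R) : 0 <= s0 ->
  exists n0 : nat, forall n, (n0 <= n)%N ->
    s0 <= iterln 2 n%:R /\ n%:R = expR (expR (iterln 2 n%:R)) :> R.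
Proof.
move=> s00; exists (Num.bound (expR (expR s0))) => n n0n.
have h : expR (expR s0) <= n%:R :> R.
  apply: (@le_trans _ _ (Num.bound (expR (expR s0)))%:R); last by rewrite ler_nat.
  by apply/ltW/archi_boundP; exact: expR_ge0.
have n0 : 0 < n%:R :> R by apply: lt_le_trans h; exact: expR_gt0.
have h1 : expR s0 <= ln n%:R by rewrite -(@expRK R (expR s0)) ler_ln ?posrE ?expR_gt0.
have l0 : 0 < ln n%:R :> R by apply: lt_le_trans h1; exact: expR_gt0.
split; last by rewrite /iterln /= !lnK.
by rewrite /iterln /= -(@expRK R s0) ler_ln ?posrE ?expR_gt0.
Qed.

Theorem theorem1p2 (R : realType) (d : nat) (hd : (2 <= d)%N) :
  exists (C : R) (n0 : nat),
    forall (disp : measure_display) (T : measurableType disp)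
      (P : probability T R) (X : nat -> {RV P >-> d.-tuple R}),
      iid_exp1_vectors X ->
      forall (n : nat) (a : R), (n0 <= n)%N -> `|a| <= a_ R d n ->
        (dTV (law P (fun w : T =>
                (rho n (b_ d n a) (fun i => X i w))%:Z))
             (law (poisson (lambda_ d a)) Posz)
         <= (C * (iterln 2 n%:R `^ (- (d%:R - 3 / 2))
                  * (iterln 3 n%:R)^-1))%:E)%E.
Proof.
case: d hd => [//|k] hd; have k0 : (0 < k)%N by [].
have [n0 n0P] := @iterln_large R (216 * k%:R ^+ 2 + 4) ltac:(by rewrite addr_ge0// mulr_ge0// exprn_ge0).
exists (error_constant k), (maxn n0 1) => disp T P X iidX n a.
rewrite geq_max => /andP[/n0P[]].
set s := iterln 2 n%:R => s_large nE n1 aa.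
have dk : k.+1%:R - 1 = k%:R :> R by rewrite -natr1 addrK.
have i3 : iterln 3 n%:R = ln s by [].
have i4 : iterln 4 n%:R = ln (ln s) by [].
have i1 : iterln 1 n%:R = expR s.
  by rewrite nE /iterln /= expRK.
have s0 : 0 < s by apply: lt_le_trans s_large; rewrite ltr_wpDl// mulr_ge0// exprn_ge0.
have a_small : `|a| <= 1 / (2 * k%:R) * (ln s - 2 * ln (ln s)).
  by move: aa; rewrite /a_ dk i3 i4.
rewrite /b_ /lambda_ subn1 dk i1 i3 -/s /=.
rewrite /powR (gt_eqF s0).
set b := expR s - ln s - ln k%:R - ln (1 - a / s).
set l := expR (k%:R * a) / k`!%:R.
have b1 : 1 <= b by exact: level_ge1 a_small.
have l01 : 0 < l <= n%:R by exact: intensity_in a_small.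
have Nl : b ^+ k / k`!%:R * expR (- (n%:R * expR (- b))) <= l by exact: intensity_ge a_small.
have Mn : (expR 1 * (n%:R * expR (- b))) ^+ 2 <= n%:R by exact: scaled_mass_le a_small.
have err := approximation_error_le k0 s_large nE a_small.
apply: ge_ereal_sup => _ [A _ <-].
apply: (@le_trans _ _ (approximation_error k n b l)%:E); last first.
  rewrite lee_fin (_ : - (k.+1%:R - 3 / 2) * ln s = - ((k%:R - 1 / 2) * ln s)).
    exact: err.
  by rewrite -natr1; field.
rewrite /law (_ : P _ = iid (iid (@exp1 R) k.+1) n
  [set t | (Posz @^-1` A) (count_maxima (@prec R k.+1) (low b) t)]); last first.
  exact: (rho_law iidX n b (Posz @^-1` A)).
apply: (two_sided (P1 := iid (iid (@exp1 R) k.+1) n) (P2 := poisson l)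
  (f := fun t => count_maxima (@prec R k.+1) (low b) t) (g := id)).
- move=> B; rewrite -[X in measurable X]setTI.
  by apply: measurable_count_maxima => //; [exact: measurable_prec|exact: measurable_low].
- by [].
- by move=> B; exact: low_maxima_poisson_le.
Qed.
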